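(* Let $\epsilon>0$ and let $m=m(k)$ be a function from even positive integers $k$ to positive integers such that $m(k)/k\to\infty$ as $k\to\infty$ and $m(k)\ll k^{\frac32-\epsilon}$. Then for every smooth compactly supported function $\psi\in C_c^\infty(\mathrm{SL}_2(\mathbb{Z})\backslash\mathbb{H})$, $$\int_{\mathrm{SL}_2(\mathbb{Z})\backslash\mathbb{H}}\big|\widetilde P_{k,m}(z)\big|^2\psi(z)\,y^k\,\mathrm{d}\mu\;\xrightarrow{k\to\infty}\;\frac{3}{\pi}\int_{\mathrm{SL}_2(\mathbb{Z})\backslash\mathbb{H}}\psi(z)\,\mathrm{d}\mu,$$ where $\widetilde P_{k,m}=P_{k,m}/\langle P_{k,m},P_{k,m}\rangle^{1/2}$ (i.e. the sequence $\{P_{k,m}\}$ has mass equidistribution).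
   Context: Throughout, $k$ is an even positive integer and $k\to\infty$ through even integers. $\mathbb{H}=\{z=x+iy: y>0\}$, $\mathrm{d}\mu=\frac{\mathrm{d}x\,\mathrm{d}y}{y^2}$ is the hyperbolic measure. For $m\ge1$, the Poincaré series of weight $k$ and index $m$ is $$P_{k,m}(z)=\sum_{\gamma\in\Gamma_\infty\backslash\mathrm{SL}_2(\mathbb{Z})}e(m\gamma z)\,j(\gamma,z)^{-k}=\frac12\sum_{\substack{c,d\in\mathbb{Z}\\ \gcd(c,d)=1}}\frac{e(m\gamma_{c,d}z)}{(cz+d)^k},$$ where $e(z)=e^{2\pi i z}$, $\Gamma_\infty=\{\pm\begin{pmatrix}1&*\\0&1\end{pmatrix}\}\subset\mathrm{SL}_2(\mathbb{Z})$, $j(\begin{pmatrix}a&b\\c&d\end{pmatrix},z)=cz+d$, and $\gamma_{c,d}$ is any matrix in $\mathrm{SL}_2(\mathbb{Z})$ with bottom row $(c,d)$; it is a cusp form of weight $k$ for $\mathrm{SL}_2(\mathbb{Z})$. The Petersson inner product is $\langle f,g\rangle=\int_{\mathcal F}f(z)\overline{g(z)}y^k\,\mathrm{d}\mu$, with $\mathcal F$ the standard fundamental domain of $\mathrm{SL}_2(\mathbb{Z})$. The notation $A\ll B$ means $|A|\le C|B|$ for some constant $C>0$. *)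

(* Defs.v *)
From HB Require Import structures.
From mathcomp Require Import all_boot all_order all_algebra.
From mathcomp Require Import finmap.
From mathcomp Require Import all_classical all_reals all_analysis.
From mathcomp Require Import summability.
From mathcomp Require Import complex.

Set Implicit Arguments.
Unset Strict Implicit.
Unset Printing Implicit Defensive.
Import Order.TTheory GRing.Theory Num.Theory.
Import numFieldNormedType.Exports.

Local Open Scope classical_set_scope.
Local Open Scope ring_scope.
Local Open Scope complex_scope.

(* The topology of R[i] is that of its alias R[i]^o (norm topology). *)

Section Modular.
Variable R : realType.
Implicit Types (z : R[i]) (f g : R[i] -> R[i]) (A : 'M[int]_2).

Definition ofxy (p : R * R) : R[i] := p.1 +i* p.2.

Definition upper_half : set R[i]^o := [set z : R[i] | 0 < complex.Im z].

Definition SL2Z : set 'M[int]_2 := [set A | \det A = 1].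

Definition autj A z : R[i] := (A 1 0)%:~R * z + (A 1 1)%:~R.

Definition mobius A z : R[i] :=
  ((A 0 0)%:~R * z + (A 0 1)%:~R) / autj A z.

(* e(z) = exp(2 pi i z) *)
Definition e2pi z : R[i] :=
  (expR (- (2 * pi * complex.Im z)))%:C *
  (cos (2 * pi * complex.Re z) +i* sin (2 * pi * complex.Re z)).

(* A matrix with bottom row (c, d), in SL2(Z) when c and d are coprime: if
   u c + v d = 1 are the Bezout coefficients, its top row is (v, -u). *)
Definition gamma_cd (c d : int) : 'M[int]_2 :=
  \matrix_(i < 2, j < 2)
    if i == 0 then (if j == 0 then (egcdz c d).2 else - (egcdz c d).1)
    else (if j == 0 then c else d).

Lemma gamma_cd_SL2Z (c d : int) : coprimez c d -> SL2Z (gamma_cd c d).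
Proof.
rewrite /SL2Z /= /coprimez => /eqP gcd1.
rewrite (expand_det_row _ 0) !big_ord_recl big_ord0 addr0 /cofactor !det_mx11.
rewrite !mxE /=; case: egcdzP => u v /= Duv _.
by rewrite expr0 expr1 mul1r mulN1r mulrNN addrC -gcd1 -Duv.
Qed.

(* Unordered sum over the pairs (c, d) with gcd(c, d) = 1; it converges
   absolutely for k > 2. *)
Definition Poincare (k m : nat) z : R[i] :=
  2^-1 * sum (fun q : {p : int * int | coprimez p.1 p.2} =>
    let A := gamma_cd (val q).1 (val q).2 in
    (e2pi (m%:R * mobius A z) / autj A z ^+ k : R[i]^o)).

Definition fund_domain : set (R * R) :=
  [set p | [/\ 0 < p.2, `|p.1| <= 2^-1 & 1 <= p.1 ^+ 2 + p.2 ^+ 2]].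

Definition lebesgue2 := (@lebesgue_measure R \x @lebesgue_measure R)%E.

(* The integral over SL2(Z)\H, against dx dy / y^2, of an SL2(Z)-invariant
   function f, computed on the standard fundamental domain. *)
Definition modular_integral f : R[i] :=
  (\int[lebesgue2]_(p in fund_domain) (complex.Re (f (ofxy p)) / p.2 ^+ 2))
  +i*
  (\int[lebesgue2]_(p in fund_domain) (complex.Im (f (ofxy p)) / p.2 ^+ 2)).

Definition petersson (k : nat) f g : R[i] :=
  modular_integral (fun z => f z * (g z)^* * ((complex.Im z) ^+ k)%:C).

Definition Poincare_normalized (k m : nat) z : R[i] :=
  Poincare k m z / sqrtC (petersson k (Poincare k m) (Poincare k m)).

(* The iterated partial derivative prescribed by s, false standing for d/dx
   and true for d/dy. *)
Definition iter_partial (s : seq bool) (h : R * R -> R) : R * R -> R :=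
  foldr (fun (b : bool) (h' : R * R -> R) =>
    'D_(if b then (0, 1) else (1, 0)) h') h s.

Definition smooth_on (D : set (R * R)) (h : R * R -> R) : Prop :=
  forall (s : seq bool) (p : R * R), D p ->
    [/\ {for p, continuous (iter_partial s h)},
        derivable (iter_partial s h) p (1, 0) &
        derivable (iter_partial s h) p (0, 1)].

Definition smooth_upper_half f : Prop :=
  smooth_on [set p | 0 < p.2] (fun p => complex.Re (f (ofxy p))) /\
  smooth_on [set p | 0 < p.2] (fun p => complex.Im (f (ofxy p))).

Definition SL2Z_invariant f : Prop :=
  forall A z, SL2Z A -> upper_half z -> f (mobius A z) = f z.

(* The support of f in H is contained in SL2(Z).K for some compact subset K of
   H, i.e. its image in SL2(Z)\H is compact. *)
Definition compact_support_mod_SL2Z f : Prop :=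
  exists K : set R[i]^o, [/\ compact K, K `<=` upper_half &
    forall z : R[i]^o, upper_half z ->
      closure [set w : R[i]^o | upper_half w /\ f w != 0] z ->
      exists2 A, SL2Z A & K (mobius A z)].

(* C_c^oo(SL2(Z)\H), as functions on H; values outside H are irrelevant. *)
Definition Cc_infty_modular f : Prop :=
  [/\ smooth_upper_half f, SL2Z_invariant f & compact_support_mod_SL2Z f].

End Modular.

(* k -> oo through even integers *)
Definition even_oo : set_system nat := within [set k | ~~ odd k] \oo.

(* Main.v *)
(* Let F(t) = e^{-2 pi m t} t^{k/2}, G = F^2 and M = 4 pi m. Taking absolute
   values in the double sum for |P_{k,m}|^2 y^k, one finds that it differs from
   the incomplete Eisenstein series E_G(z) = sum of G(Im(gamma z)) over
   Gamma_oo \ SL2(Z) by at most the sum of F(Im(gamma z)) F(Im(gamma' z)) over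
   gamma <> gamma'. Unfolding turns the integral of the latter over the
   fundamental domain into sums over c >= 1 of integrals of a^{-k} e^{-M/a} with
   a^2 = t^2 + c^2; Gamma moments show that it is
   O(M k^{-3/2} + (k/M)^{1/2}) times N = (k-2)! / M^{k-1}, the integral of
   G(y) dy/y^2. This is where both growth conditions on m(k) enter.

   Unfolding the main term, the integral of f E_G is the integral over y of
   G(y) h(y) dy/y^2, where h(y) is the mean of f over the closed horocycle of
   height y. As k/M -> 0, Markov's inequality shows that G(y) dy/y^2
   concentrates at y -> 0, so it remains to see that h(y) tends to the average
   of f. Unfolding the indicator of y >= e, the tail T(e), which is e times the
   integral of h(y) dy/y^2 over y >= e, counts primitive vectors of bounded norm
   in the lattice Z z + Z; summing T(n^2 e)/n^2 over n >= 1 counts all nonzero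
   vectors, which is elementary. Since the sum of 1/n^2 over n >= 2 is below 1,
   the terms n >= 2 can be inverted by a contraction, giving the limit of T.
   Finally h varies slowly on the multiplicative scale, because a compactly
   supported continuous function on the quotient is uniformly continuous for
   the hyperbolic metric; so the limit of T yields that of h. *)

Require Import Defs.
From HB Require Import structures.
From mathcomp Require Import all_boot all_order all_algebra.
From mathcomp Require Import finmap.
From mathcomp Require Import all_classical all_reals all_analysis.
From mathcomp Require Import measurable_realfun summability.
From mathcomp Require Import complex.
From mathcomp Require Import zify ring lra.
Set Implicit Arguments.
Unset Strict Implicit.
Unset Printing Implicit Defensive.
Import Order.TTheory GRing.Theory Num.Theory.
Import numFieldNormedType.Exports.
Local Open Scope classical_set_scope.
Local Open Scope ring_scope.
Local Open Scope complex_scope.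

(** * Measurability and sums of nonnegative families *)

Section MeasurableTools.
Context {R : realType} {d : measure_display} {T : measurableType d}.
Implicit Types (f g : T -> R) (e : T -> \bar R).

(** No formula for the Petersson norm enters: the mass of f and the squared norm, which is the mass
    of the constant function 1, are both compared with the same N, and N cancels in the quotient. In
    the same way the area of the unit disc and the value of zeta(2) are never computed: in the
    lattice count, [average] times the identity for the constant function 1 is subtracted from the
    identity for f, and the unknown constant drops out. Absolute values discard all oscillation of
    the exponentials, so the off-diagonal bound must be sharp in k. A crude bound for the variation
    of a^{-k} e^{-M/a} over unit intervals would lose a factor k^{1/2}; the variance of a Gamma law
    controls it instead. The observable is shifted by a constant to become nonnegative. Integrals
    and sums then have nonnegative extended real values, regions enter as factors [ind], and
    exchanging sums and integrals needs no integrability. Invariance of the hyperbolic measure also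
    comes from Tonelli, after writing an element of SL2(R) as translations around one inversion. *)

Definition ind (b : bool) : \bar R := (b%:R)%:E.

Lemma ind_ge0 b : (0 <= ind b)%E. Proof. by case: b. Qed.

Lemma measurable_ind (b : T -> bool) :
  measurable_fun setT b -> measurable_fun setT (fun x => ind (b x)).
Proof.
move=> mb; apply/measurable_EFinP.
rewrite (_ : (fun x => _) = (fun x => if b x then 1 else 0 : R)); last first.
  by apply/funext => x; case: (b x).
exact: measurable_fun_ifT.
Qed.

Lemma measurable_EFin f :
  measurable_fun setT f -> measurable_fun setT (fun x => (f x)%:E).
Proof. by move=> /measurable_EFinP. Qed.

Lemma measurable_funE f :
  measurable_fun setT f -> measurable_fun setT (fun x => expR (f x)).
Proof. by move=> mf; exact: (measurableT_comp (@measurable_expR R) mf). Qed.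

Lemma measurable_invr : measurable_fun setT (fun x : R => x^-1).
Proof.
rewrite -(setUv [set 0 : R]); apply/measurable_funU => //.
  exact: measurableC.
split; first exact: measurable_fun_set1.
apply: open_continuous_measurable_fun.
  by rewrite openC; exact: closed_eq.
by move=> x; rewrite inE /= => /eqP x0; exact: inv_continuous.
Qed.

Lemma measurable_funV f :
  measurable_fun setT f -> measurable_fun setT (fun x => (f x)^-1).
Proof. by move=> mf; exact: (measurableT_comp measurable_invr mf). Qed.

Lemma measurable_funsqrt f :
  measurable_fun setT f -> measurable_fun setT (fun x => Num.sqrt (f x)).
Proof.
move=> mf; apply: (measurableT_comp _ mf).
by apply: continuous_measurable_fun => x; exact: sqrt_continuous.
Qed.

End MeasurableTools.

Section MeasurableTools2.
Context {R : realType}.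

Lemma measurable_fun_comp2 d1 d2 d3 (T1 : measurableType d1)
  (T2 : measurableType d2) (T3 : measurableType d3) (h : T2 -> T3) (g : T1 -> T2) :
  measurable_fun setT h -> measurable_fun setT g ->
  measurable_fun setT (fun x => h (g x)).
Proof. by move=> mh mg; exact: (measurableT_comp mh mg). Qed.

Lemma measurable_fun_fst d d1 d2 (T : measurableType d) (T1 : measurableType d1)
  (T2 : measurableType d2) (g : T -> T1 * T2) :
  measurable_fun setT g -> measurable_fun setT (fun x => (g x).1).
Proof. by move=> mg; exact: (measurableT_comp measurable_fst mg). Qed.

Lemma measurable_fun_snd d d1 d2 (T : measurableType d) (T1 : measurableType d1)
  (T2 : measurableType d2) (g : T -> T1 * T2) :
  measurable_fun setT g -> measurable_fun setT (fun x => (g x).2).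
Proof. by move=> mg; exact: (measurableT_comp measurable_snd mg). Qed.

Lemma measurable_section1 d1 d2 d3 (T1 : measurableType d1)
  (T2 : measurableType d2) (T3 : measurableType d3) (h : T1 -> T2 -> T3) x :
  measurable_fun setT (fun p : T1 * T2 => h p.1 p.2) -> measurable_fun setT (h x).
Proof.
move=> mh; apply: (measurable_fun_comp2 (g := fun y => (x, y)) mh).
exact: measurable_fun_pair.
Qed.

Lemma measurable_section2 d1 d2 d3 (T1 : measurableType d1)
  (T2 : measurableType d2) (T3 : measurableType d3) (h : T1 -> T2 -> T3) y :
  measurable_fun setT (fun p : T1 * T2 => h p.1 p.2) ->
  measurable_fun setT (fun x => h x y).
Proof.
move=> mh; apply: (measurable_fun_comp2 (g := fun x => (x, y)) mh).
exact: measurable_fun_pair.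
Qed.

Lemma measurable_fun_integral d (T : measurableType d) (g : T -> R -> \bar R) :
  measurable_fun setT (fun p : T * R => g p.1 p.2) ->
  (forall x y, (0 <= g x y)%E) ->
  measurable_fun setT (fun x => (\int[@lebesgue_measure R]_y g x y)%E).
Proof.
move=> mg g0.
have := @measurable_fun_fubini_tonelli_F _ _ _ _ R (@lebesgue_measure R) _ mg.
by apply => -[x y]; exact: g0.
Qed.

(** Coding the index type into [nat] turns the unordered sum into a series, to which monotone
    convergence applies; codes of no element contribute 0. *)
Lemma esum_pickle (I : countType) (a : I -> \bar R) :
  (forall i, (0 <= a i)%E) ->
  (\esum_(i in [set: I]) a i = \sum_(n <oo) oapp a 0 (pickle_inv n))%E.
Proof.
move=> a0; rewrite nneseries_esumT; last by move=> n; case: pickle_inv.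
rewrite (esumID (range (@choice.pickle I))); last by move=> n _; case: pickle_inv.
rewrite [X in (_ + X)%E]esum1 ?adde0; last first.
  move=> n [_ nr] /=; rewrite /pickle_inv; case: choice.unpickle => //= x.
  by case: eqP => //= xn; exfalso; apply: nr; exists x.
rewrite setTI esum_image; last by move=> x y _ _; exact: (pcan_inj (@choice.pickleK I)).
by apply: eq_esum => i _; rewrite choice.pickleK_inv.
Qed.

Lemma measurable_fun_esum d (T : measurableType d) (I : countType)
  (a : I -> T -> \bar R) :
  (forall i, measurable_fun setT (a i)) -> (forall i x, (0 <= a i x)%E) ->
  measurable_fun setT (fun x => \esum_(i in [set: I]) a i x)%E.
Proof.
move=> ma a0.
rewrite (_ : (fun x => _) =
    fun x => (\sum_(0 <= n <oo | n \in predT) oapp (a^~ x) 0 (pickle_inv n))%E).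
  apply: ge0_emeasurable_sum => [n x _ _|n _]; first by case: pickle_inv => //=.
  by case: (pickle_inv n) => [i|]//=; exact: measurable_cst.
by apply/funext => x; rewrite esum_pickle.
Qed.

Lemma integral_esum d (T : measurableType d) (m : {measure set T -> \bar R})
  (I : countType) (a : I -> T -> \bar R) :
  (forall i, measurable_fun setT (a i)) -> (forall i x, (0 <= a i x)%E) ->
  (\int[m]_x (\esum_(i in [set: I]) a i x) =
   \esum_(i in [set: I]) (\int[m]_x a i x))%E.
Proof.
move=> ma a0; rewrite esum_pickle; last by move=> i; exact: integral_ge0.
under eq_integral do rewrite esum_pickle//.
rewrite integral_nneseries//.
- apply: eq_eseriesr => n _; case: (pickle_inv n) => //=.
  by rewrite integral0_eq.
- by move=> n; case: (pickle_inv n) => //=; exact: measurable_cst.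
- by move=> n x _; case: (pickle_inv n) => /=.
Qed.

Lemma esumZl (I : countType) (a : I -> \bar R) (k : \bar R) :
  (0 <= k)%E -> (forall i, (0 <= a i)%E) ->
  (\esum_(i in [set: I]) (k * a i) = k * \esum_(i in [set: I]) a i)%E.
Proof.
case: k => [k k0 a0|_ a0|//].
  rewrite !esum_pickle//; last by move=> i; exact: mule_ge0.
  rewrite -nneseriesZl//; last by move=> n _; case: (pickle_inv n).
  by apply: eq_eseriesr => n _; case: (pickle_inv n) => //=; rewrite mule0.
(* For the factor [+oo], both sides are [+oo] as soon as one term is nonzero, and 0 otherwise. *)
have le_esum1 (b : I -> \bar R) i : (forall j, (0 <= b j)%E) ->
    (b i <= \esum_(j in [set: I]) b j)%E.
  move=> b0; rewrite (esumID [set i])// setTI esum_set1//.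
  by rewrite leeDl// esum_ge0.
have [/= [i ai0]|na] := pselect (exists i, a i != 0%E).
  have ai : (0 < a i)%E by rewrite lt_neqAle eq_sym ai0 a0.
  rewrite gt0_mulye; last exact: (lt_le_trans ai (le_esum1 _ i a0)).
  apply/eqP; rewrite eq_le leey /=.
  apply: le_trans (le_esum1 (fun i => +oo * a i)%E i _).
    by rewrite /= gt0_mulye.
  by move=> j; rewrite mule_ge0.
have az i : a i = 0%E by apply: contrapT => /eqP ai; apply: na; exists i.
by rewrite !esum1 ?mule0// => i _; rewrite az// mule0.
Qed.

End MeasurableTools2.

(** Measurability by recursion on the shape of the body. Facts about named functions are found in
    the context, which is why many proofs open by recording such facts. *)
Ltac mea :=
  repeat first
  [ assumption
  | lazymatch goal with
    | |- measurable_fun _ (fun x => _) => fail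
    | |- measurable_fun _ (cst _) => exact: measurable_cst
    | |- measurable_fun ?D ?f => change (measurable_fun D (fun x => f x))
    end
  | match goal with
    | |- measurable_fun _ (fun _ => ?c) => exact: measurable_cst
    | |- measurable_fun _ (fun x => x) => exact: measurable_id
    | H : measurable_fun _ ?h |- measurable_fun _ (fun x => ?h (@?g x)) =>
        apply: (measurable_fun_comp2 H)
    | H : forall i, measurable_fun _ (?h i) |- measurable_fun _ (fun x => ?h ?i (@?g x)) =>
        apply: (measurable_fun_comp2 (H i))
    | |- measurable_fun _ (fun x => (_)%:E) => apply: measurable_EFin
    | |- measurable_fun _ (fun x => ind _) => apply: measurable_ind
    | |- measurable_fun _ (fun x => (_ , _)) => apply: measurable_fun_pair
    | |- measurable_fun _ (fun x => (_ * _)%E) => apply: emeasurable_funM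
    | |- measurable_fun _ (fun x => (_ + _)%E) => apply: emeasurable_funD
    | |- measurable_fun _ (fun x => (_ * _)%R) => apply: measurable_funM
    | |- measurable_fun _ (fun x => (- _)%R) => apply: measurable_funN
    | |- measurable_fun _ (fun x => (_ + _)%R) => first [apply: measurable_funD|apply: emeasurable_funD]
    | |- measurable_fun _ (fun x => (_ ^+ _)%R) => apply: measurable_funX
    | |- measurable_fun _ (fun x => (_ ^-1)%R) => apply: measurable_funV
    | |- measurable_fun _ (fun x => expR _) => apply: measurable_funE
    | |- measurable_fun _ (fun x => Num.sqrt _) => apply: measurable_funsqrt
    | |- measurable_fun _ (fun x => `|_|%R) => apply: (measurable_fun_comp2 (@normr_measurable _ setT))
    | |- measurable_fun _ (fun x => (_ < _)%R) => apply: measurable_fun_ltr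
    | |- measurable_fun _ (fun x => (_ <= _)%R) => apply: measurable_fun_ler
    | |- measurable_fun _ (fun x => _ && _) => apply: measurable_and
    | |- measurable_fun _ (fun x => if _ then _ else _) => apply: measurable_fun_ifT
    | |- measurable_fun _ (fun x => (_).1) => apply: measurable_fun_fst
    | |- measurable_fun _ (fun x => (_).2) => apply: measurable_fun_snd
    | |- measurable_fun _ (fun x => integral _ _ _) => apply: measurable_fun_integral
    | |- measurable_fun _ (fun x => esum _ _) => apply: measurable_fun_esum => ?
    end ].

(** * Affine substitution, the measure dy/y, and sums over integer translates *)

Section Integrals.
Context {R : realType}.
Local Notation mu := (@lebesgue_measure R).
Local Open Scope ereal_scope.

Lemma integral_le (f g : R -> \bar R) :
  measurable_fun setT f -> measurable_fun setT g ->
  (forall x, 0 <= f x) -> (forall x, f x <= g x) ->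
  \int[mu]_x f x <= \int[mu]_x g x.
Proof. by move=> mf mg f0 fg; exact: ge0_le_integral. Qed.

Lemma tonelli (g : R -> R -> \bar R) :
  measurable_fun setT (fun p : R * R => g p.1 p.2) -> (forall x y, 0 <= g x y) ->
  \int[mu]_x (\int[mu]_y g x y) = \int[mu]_y (\int[mu]_x g x y).
Proof.
move=> mg g0.
by apply: (@fubini_tonelli _ _ _ _ _ mu mu _ mg) => -[x y]; exact: g0.
Qed.

Lemma lebesgue2_tonelli (f : R * R -> \bar R) :
  measurable_fun setT f -> (forall p, 0 <= f p) ->
  \int[@lebesgue2 R]_p f p = \int[mu]_y (\int[mu]_x f (x, y)).
Proof. by move=> mf f0; exact: (@fubini_tonelli2 _ _ _ _ _ mu mu _ mf f0). Qed.

(** The push-forward of Lebesgue measure under x -> a x + b, multiplied by |a|, has the right value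
    on half-open intervals, hence is Lebesgue measure by uniqueness. *)
Lemma integral_affine (f : R -> \bar R) (a b : R) : a != 0%R ->
  measurable_fun setT f -> (forall x, 0 <= f x) ->
  \int[mu]_x f (a * x + b)%R = (`|a|^-1)%:E * \int[mu]_x f x.
Proof.
move=> a0 mf f0.
have na : (0 < `|a|)%R by rewrite normr_gt0.
pose phi : measurableTypeR R -> measurableTypeR R := fun x => (a * x + b)%R.
have mphi : measurable_fun setT phi by rewrite /phi; mea.
have k0 : (0 <= `|a|)%R by exact: ltW.
pose nu0 : {measure set (measurableTypeR R) -> \bar R} :=
  mscale (NngNum k0) (pushforward mu phi).
pose nu := nu0 mphi.
suff muE : forall A, measurable A -> mu A = nu A.
  rewrite [X in _ * X](eq_measure_integral nu); last by move=> A mA _; exact: muE.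
  rewrite /nu /nu0 ge0_integral_mscale//= muleA -EFinM mulVf ?gt_eqF// mul1e.
  by rewrite (ge0_integral_pushforward mphi)// preimage_setT.
apply: lebesgue_measure_unique => _ [[u v]] _ <-.
rewrite /nu /nu0 /= /pushforward /mscale /=.
have [a_gt0|] := ltP 0%R a.
  rewrite [X in _ * mu X](_ : _ = `]((u - b) / a)%R, ((v - b) / a)%R]%classic); last first.
    apply/seteqP; split => x /=; rewrite !in_itv /= /phi ltr_pdivrMr// ler_pdivlMr// ltrBlDr lerBrDr; by rewrite mulrC.
  rewrite !lebesgue_measure_itv /= !lte_fin ltr_pM2r ?invr_gt0// ltrD2r.
  case: ifPn => uv; last by rewrite mule0.
  by rewrite -EFinB -EFinB -EFinM gtr0_norm//; congr EFin; field.
(* For a < 0 the preimage of ]u, v] is open on the right instead of the left; its length is the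
   same. *)
move=> a_le0; have {a_le0}a_lt0 : (a < 0)%R by rewrite lt_neqAle a0.
rewrite [X in _ * mu X](_ : _ = `[((v - b) / a)%R, ((u - b) / a)%R[%classic); last first.
  apply/seteqP; split => x /=; rewrite !in_itv /= /phi ler_ndivrMr// ltr_ndivlMr// ltrBlDr lerBrDr mulrC => /andP[? ?]; exact/andP.
rewrite !lebesgue_measure_itv /= !lte_fin ltr_nM2r ?invr_lt0// ltrD2r.
case: ifPn => uv; last by rewrite mule0.
by rewrite -EFinB -EFinB -EFinM ltr0_norm//; congr EFin; field.
Qed.

Lemma integralTZl (f : R -> \bar R) (k : R) :
  measurable_fun setT f -> (forall x, 0 <= f x) -> (0 <= k)%R ->
  \int[mu]_x (k%:E * f x) = k%:E * \int[mu]_x f x.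
Proof. by move=> mf f0 k0; rewrite ge0_integralZl. Qed.

Definition haar (f : R -> \bar R) : \bar R :=
  \int[mu]_y (ind (0 < y)%R * (y^-1)%:E * f y).

Lemma haar_weight_ge0 (y : R) : 0 <= ind (0 < y)%R * (y^-1)%:E.
Proof.
rewrite /ind; case: ltP => y0; last by rewrite mul0e.
by rewrite mul1e lee_fin invr_ge0 ltW.
Qed.

Lemma haar_scale (f : R -> \bar R) (a : R) : (0 < a)%R ->
  measurable_fun setT f -> (forall x, 0 <= f x) ->
  haar (fun y => f (a * y)%R) = haar f.
Proof.
move=> a0 mf f0; rewrite /haar.
transitivity (\int[mu]_y
    (a%:E * (ind (0 < a * y + 0)%R * ((a * y + 0)^-1)%:E * f (a * y + 0)%R))).
  apply: eq_integral => y _; rewrite addr0 pmulr_rgt0//.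
  rewrite !muleA [a%:E * _]muleC -!muleA; congr (_ * _); rewrite muleA -EFinM.
  by rewrite invfM mulrA divff ?gt_eqF// mul1r.
have mg : measurable_fun setT (fun y : R => ind (0 < y)%R * (y^-1)%:E * f y) by mea.
have g0 (y : R) : 0 <= ind (0 < y)%R * (y^-1)%:E * f y.
  by rewrite mule_ge0// haar_weight_ge0.
rewrite integralTZl ?ltW//; last by mea.
rewrite (@integral_affine (fun y => ind (0 < y)%R * (y^-1)%:E * f y))// ?gt_eqF//.
by rewrite gtr0_norm// muleA -EFinM divff ?gt_eqF// mul1e.
Qed.

(* Both sides are Haar measures for scaling, and they agree after averaging
   against the weight w(y) = y on ]0, 1], which has mass one. *)
Lemma haar_inv (f : R -> \bar R) (s : R) : (0 < s)%R ->
  measurable_fun setT f -> (forall x, 0 <= f x) ->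
  haar (fun y => f (s / y)%R) = haar f.
Proof.
move=> s0 mf f0.
pose w (y : R) : \bar R := (y * ((0 < y) && (y <= 1))%R%:R)%:E.
have w0 y : 0 <= w y.
  rewrite /w lee_fin; case: (ltP 0%R y) => y0 /=; last by rewrite mulr0.
  by rewrite mulr_ge0// ltW.
have mw : measurable_fun setT w.
  rewrite /w; apply: measurable_EFin; apply: measurable_funM; first by mea.
  apply/measurable_EFinP.
  by apply: (@measurable_ind R _ _ (fun y : R => (0 < y) && (y <= 1))%R); mea.
have hw : haar w = 1.
  transitivity (\int[mu]_y (\1_(`]0%R, 1%R]%classic : set R) y)%:E); last first.
    rewrite (@integral_indic _ _ _ mu setT measurableT)//.
    rewrite setIT; change (mu `]0%R, 1%R]%classic = 1); rewrite lebesgue_measure_itv /= lte_fin ltr01.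
    by rewrite sube0.
  apply: eq_integral => y _; rewrite /w /ind indicE /= mem_setE in_itv /=.
  case: (ltP 0%R y) => y0 /=; last by rewrite !mul0e.
  by rewrite mul1e -EFinM mulrA mulVf ?gt_eqF// mul1r.
have wt0 := haar_weight_ge0.
have Ez (h : R -> \bar R) (k : \bar R) : measurable_fun setT h ->
    (forall y, 0 <= h y) -> 0 <= k -> haar (fun y => k * h y) = k * haar h.
  move=> mh h0 k0; rewrite /haar -ge0_integralZl//; last first.
  - by move=> y _; rewrite mule_ge0// wt0.
  - by mea.
  by apply: eq_integral => y _; rewrite muleCA.
have Ez' (h : R -> \bar R) (k : \bar R) : measurable_fun setT h ->
    (forall y, 0 <= h y) -> 0 <= k -> haar (fun y => h y * k) = haar h * k.
  by move=> mh h0 k0; rewrite muleC -Ez//; apply: eq_integral => y _; congr (_ * _); rewrite muleC.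
have hpos (h : R -> \bar R) : (forall y, (0 < y)%R -> 0 <= h y) -> 0 <= haar h.
  move=> h0; apply: integral_ge0 => y _.
  rewrite /ind; case: ltP => y0; last by rewrite !mul0e.
  by rewrite mul1e mule_ge0// ?h0// lee_fin invr_ge0 ltW.
have heq (h h' : R -> \bar R) : (forall y, (0 < y)%R -> h y = h' y) -> haar h = haar h'.
  move=> hh; apply: eq_integral => y _.
  by rewrite /ind; case: ltP => y0; rewrite ?mul0e// hh.
have hton (h : R -> R -> \bar R) : measurable_fun setT (fun p : R * R => h p.1 p.2) ->
    (forall x y, 0 <= h x y) ->
    haar (fun x => haar (h x)) = haar (fun y => haar (h^~ y)).
  move=> mh h0; rewrite /haar.
  have mh1 x : measurable_fun setT (h x) by exact: (measurable_section1 _ mh).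
  have mh2 y : measurable_fun setT (h^~ y) by exact: (measurable_section2 _ mh).
  have mh' : measurable_fun setT (fun p : R * R => h p.1 p.2) by [].
  transitivity (\int[mu]_x (\int[mu]_y
     ((ind (0 < x)%R * (x^-1)%:E) * ((ind (0 < y)%R * (y^-1)%:E) * h x y)))).
    apply: eq_integral => x _; rewrite ge0_integralZl//.
      by mea.
    by move=> y _; rewrite mule_ge0// wt0.
  rewrite tonelli.
  - apply: eq_integral => y _.
    rewrite -ge0_integralZl//.
      by apply: eq_integral => x _; rewrite muleCA.
    by apply: emeasurable_funM; [mea|exact: mh2].
    by move=> x _; rewrite mule_ge0// wt0.
  - apply: emeasurable_funM; first by mea.
    by apply: emeasurable_funM => //; mea.
  - by move=> x y; rewrite mule_ge0// ?wt0// mule_ge0// wt0.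
have mfi (a : R) : measurable_fun setT (fun y : R => f (a / y)%R) by mea.
rewrite -[LHS]mule1 -hw -Ez' ?hpos//.
transitivity (haar (fun v => haar (fun u => f (s / v)%R * w u))).
  by apply: (heq _ _) => v v0; rewrite Ez.
rewrite hton//; last first.
- by move=> *; rewrite mule_ge0.
- by mea.
transitivity (haar (fun u => haar (fun v => f (s * u / v)%R * w u))).
  apply: (heq _ _) => u u0.
  rewrite -(@haar_scale (fun v => f (s * u / v)%R * w u) u)//; last first.
  - by move=> *; rewrite mule_ge0.
  - by mea.
  apply: (heq _ _) => v v0; congr (f _ * _).
  by field; rewrite !gt_eqF.
rewrite hton//; last first.
- by move=> *; rewrite mule_ge0.
- by mea.
transitivity (haar (fun v => haar (fun u => f u * w (v * s^-1 * u)%R))).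
  apply: (heq _ _) => v v0.
  rewrite -(@haar_scale (fun u => f (s * u / v)%R * w u) (v / s))//; last first.
  - by move=> *; rewrite mule_ge0.
  - by mea.
  - by rewrite divr_gt0.
  apply: (heq _ _) => u u0; congr (f _ * w _).
  by field; rewrite !gt_eqF.
rewrite hton//; last first.
- by move=> *; rewrite mule_ge0.
- by mea.
apply: (heq _ _) => u u0; rewrite Ez//; last by mea.
rewrite (_ : haar _ = haar (fun v => w (s^-1 * u * v)%R)); last first.
  by apply: (heq _ _) => v v0; congr (w _); ring.
by rewrite haar_scale// ?hw ?mule1// mulr_gt0// invr_gt0.
Qed.

Lemma ind_int_uniq (x : R) :
  \esum_(n in [set: int]) ind (0 <= x + n%:~R < 1)%R = 1 :> \bar R.
Proof.
rewrite (esumID [set (- Num.floor x)%R]); last by move=> n _; exact: ind_ge0.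
rewrite setTI [X in _ + X]esum1 ?adde0.
  rewrite esum_set1 ?ind_ge0// /ind; have := floor_itv x.
  rewrite intrD => /andP[h1 h2].
  by rewrite rmorphN /= subr_ge0 h1 ltrBlDr addrC h2.
move=> n [_ /= nx]; rewrite /ind.
case: (boolP (0 <= _ < 1)%R) => // /andP[h1 h2]; exfalso; apply: nx.
apply/eqP; rewrite -eqr_oppLR; apply/eqP/esym/floor_def.
by rewrite intrD rmorphN /=; apply/andP; split; lra.
Qed.

Lemma set_bij_oppz : set_bij [set: int] [set: int] (fun n => - n)%R.
Proof.
by rewrite setTT_bijective; exists (fun n => - n)%R; exact: opprK.
Qed.

Lemma ind_int_count (x : R) (N : nat) :
  \esum_(n in [set: int]) ind (0 <= x + n%:~R < N%:R)%R = N%:R%:E :> \bar R.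
Proof.
elim: N => [|N IH].
  by rewrite esum1// => n _; rewrite /ind le_lt_asym.
rewrite -natr1 EFinD -IH -[X in (_ + X)%E](ind_int_uniq (x - N%:R)) -esumD; last 2 first.
- by move=> *; exact: ind_ge0.
- by move=> *; exact: ind_ge0.
apply: eq_esum => n _; rewrite /ind -EFinD; congr (_%:E).
have N0 : (0 <= N%:R :> R)%R by [].
have [h1|h1] := leP 0%R (x + n%:~R)%R; have [h2|h2] := ltP (x + n%:~R)%R (N%:R + 1)%R;
have [h3|h3] := ltP (x + n%:~R)%R (N%:R)%R;
have [h4|h4] := leP 0%R (x - N%:R + n%:~R)%R; have [h5|h5] := ltP (x - N%:R + n%:~R)%R 1%R => /=; rewrite ?addr0 ?add0r //;
exfalso; clear IH; lra.
Qed.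

(* The fundamental interval [0, 1[ of x meets the fibre over u = c x + n in
   exactly |c| integers n. *)
Lemma integral_int_affine (f : R -> \bar R) (c : int) : c != 0%R ->
  measurable_fun setT f -> (forall x, 0 <= f x) ->
  \esum_(n in [set: int])
    (\int[mu]_x (ind (0 <= x < 1)%R * f (c%:~R * x + n%:~R)%R)) = \int[mu]_x f x.
Proof.
wlog c0 : f c / (0 < c)%R.
  move=> H c0 mf f0; have [/H->//|cle0] := ltP 0%R c.
  have c1 : (0 < - c)%R by rewrite oppr_gt0 lt_neqAle c0.
  transitivity (\int[mu]_x f (-1 * x + 0)%R); last first.
    by rewrite integral_affine// ?oppr_eq0 ?oner_eq0// normrN1 invr1 mul1e.
  have mf' : measurable_fun setT (fun x : R => f (-1 * x + 0)%R) by mea.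
  have Nc0 : (- c != 0)%R by rewrite oppr_eq0.
  rewrite -(H (fun x => f (-1 * x + 0)%R) (- c)%R c1 Nc0 mf' (fun x => f0 _)).
  rewrite (reindex_esum [set: int] setT (fun n => - n)%R).
    apply: eq_esum => n _; apply: eq_integral => x _; congr (_ * f _).
    by rewrite !rmorphN /=; ring.
  exact: set_bij_oppz.
move=> _ mf f0.
have cR0 : (0 < c%:~R :> R)%R by rewrite ltr0z.
transitivity (\esum_(n in [set: int]) ((`|c%:~R|^-1)%:E *
   \int[mu]_x (ind (0 <= c%:~R^-1 * (x - n%:~R) < 1)%R * f x))).
  apply: eq_esum => n _; rewrite -(@integral_affine _ _ n%:~R) ?gt_eqF//; last first.
  - by move=> x; rewrite mule_ge0// ind_ge0.
  - by mea.
  apply: eq_integral => x _; congr (ind _ * _).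
  rewrite addrK mulKf// gt_eqF//.
rewrite gtr0_norm// esumZl ?lee_fin ?invr_ge0 ?ltW//; last first.
  by move=> i; apply: integral_ge0 => x _; rewrite mule_ge0// ind_ge0.
rewrite -integral_esum; last first.
- by move=> *; rewrite mule_ge0// ind_ge0.
- by move=> n; mea.
rewrite -integralTZl ?invr_ge0 ?ltW//; last first.
- by move=> x; apply: esum_ge0 => *; rewrite mule_ge0// ind_ge0.
- by mea; move=> *; rewrite mule_ge0// ind_ge0.
apply: eq_integral => x _.
have [N cN] : exists N : nat, c = N by exists `|c|%N; rewrite gez0_abs// ltW.
transitivity ((c%:~R^-1)%:E * ((\esum_(n in [set: int]) ind (0 <= x + n%:~R < N%:R)%R) * f x)).
  congr (_ * _).
  transitivity (\esum_(n in [set: int]) (f x * ind (0 <= x + n%:~R < N%:R)%R)).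
    rewrite (reindex_esum [set: int] setT (fun n => - n)%R); last first.
      exact: set_bij_oppz.
    apply: eq_esum => n _; rewrite muleC; congr (_ * ind _).
    rewrite rmorphN opprK /= pmulr_rge0 ?invr_gt0//.
    by rewrite mulrC ltr_pdivrMr// mul1r cN.
  by rewrite esumZl// 1?muleC// => n; exact: ind_ge0.
rewrite ind_int_count cN muleA -EFinM mulVf ?mul1e//.
by rewrite -cN gt_eqF.
Qed.

End Integrals.

(** * Hyperbolic measure and its invariance under SL2(R) *)

Section Hyperbolic.
Context {R : realType}.
Local Notation mu := (@lebesgue_measure R).
Implicit Types (f g h : R * R -> \bar R) (p q : R * R).

Definition hyp_weight (y : R) : \bar R := (ind (0 < y)%R * ((y ^+ 2)^-1)%:E)%E.

Definition hyp f : \bar R := (\int[@lebesgue2 R]_p (hyp_weight p.2 * f p))%E.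

Lemma hyp_weight_ge0 y : (0 <= hyp_weight y)%E.
Proof. by rewrite mule_ge0 ?ind_ge0// lee_fin invr_ge0 sqr_ge0. Qed.

Lemma measurable_hyp_weight : measurable_fun setT hyp_weight.
Proof. by rewrite /hyp_weight; mea. Qed.

Lemma hyp_weightE f g p : ((0 < p.2)%R -> f p = g p) ->
  (hyp_weight p.2 * f p = hyp_weight p.2 * g p)%E.
Proof.
by rewrite /hyp_weight /ind; case: ltP => [_ ->//|_ _]; rewrite !mul0e.
Qed.

Lemma eq_hyp f g : (forall p, 0 < p.2 -> f p = g p) -> hyp f = hyp g.
Proof. by move=> fg; apply: eq_integral => p _; exact/hyp_weightE/fg. Qed.

Lemma le_hyp f g : measurable_fun setT f -> measurable_fun setT g ->
  (forall p, 0 < p.2 -> (0 <= f p)%E) ->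
  (forall p, 0 < p.2 -> (f p <= g p)%E) -> (hyp f <= hyp g)%E.
Proof.
move=> mf mg f0 fg; have mw := measurable_hyp_weight.
have E (e : R * R -> \bar R) p : ((0 < p.2)%R -> (0 <= e p)%E) ->
    (0 <= hyp_weight p.2 * e p)%E.
  rewrite /hyp_weight /ind; case: ltP => [_ e0|_ _]; last by rewrite !mul0e.
  by rewrite mul1e mule_ge0 ?e0// lee_fin invr_ge0 sqr_ge0.
apply: ge0_le_integral => //.
- by move=> p _; apply: E; exact: f0.
- by mea.
- by mea.
- move=> p _; rewrite /hyp_weight /ind; case: ltP => [p0|_]; last by rewrite !mul0e.
  by rewrite mul1e lee_wpmul2l ?fg// lee_fin invr_ge0 sqr_ge0.
Qed.

Lemma hyp_ge0 f : (forall p, (0 <= f p)%E) -> (0 <= hyp f)%E.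
Proof.
by move=> f0; apply: integral_ge0 => p _; rewrite mule_ge0// hyp_weight_ge0.
Qed.

Lemma hypZl f (k : \bar R) : measurable_fun setT f -> (forall p, (0 <= f p)%E) ->
  (0 <= k)%E -> (hyp (fun p => k * f p) = k * hyp f)%E.
Proof.
move=> mf f0 k0; rewrite /hyp -ge0_integralZl//.
- by apply: eq_integral => p _; rewrite muleCA.
- by have mw := measurable_hyp_weight; mea.
- by move=> p _; rewrite mule_ge0// hyp_weight_ge0.
Qed.

Lemma hypD f g : measurable_fun setT f -> (forall p, (0 <= f p)%E) ->
  measurable_fun setT g -> (forall p, (0 <= g p)%E) ->
  (hyp (fun p => f p + g p) = hyp f + hyp g)%E.
Proof.
move=> mf f0 mg g0; have mw := measurable_hyp_weight.
rewrite /hyp -ge0_integralD//.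
- by apply: eq_integral => p _; rewrite ge0_muleDr.
- by move=> p _; rewrite mule_ge0// hyp_weight_ge0.
- by mea.
- by move=> p _; rewrite mule_ge0// hyp_weight_ge0.
- by mea.
Qed.

Lemma hyp_esum (I : countType) (a : I -> R * R -> \bar R) :
  (forall i, measurable_fun setT (a i)) -> (forall i p, (0 <= a i p)%E) ->
  hyp (fun p => \esum_(i in [set: I]) a i p)%E = (\esum_(i in [set: I]) hyp (a i))%E.
Proof.
move=> ma a0; have mw := measurable_hyp_weight.
rewrite /hyp -integral_esum.
- by apply: eq_integral => p _; rewrite esumZl// hyp_weight_ge0.
- by move=> i; mea.
- by move=> i p; rewrite mule_ge0// hyp_weight_ge0.
Qed.

Lemma hypE f : measurable_fun setT f -> (forall p, (0 <= f p)%E) ->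
  (hyp f = \int[mu]_y (hyp_weight y * \int[mu]_x f (x, y)))%E.
Proof.
move=> mf f0; have mw := measurable_hyp_weight.
rewrite /hyp lebesgue2_tonelli.
- apply: eq_integral => y _ /=; rewrite ge0_integralZl ?hyp_weight_ge0//.
  by mea.
- by mea.
- by move=> p; rewrite mule_ge0// hyp_weight_ge0.
Qed.

(** The substitution x = t y replaces dx dy / y^2 by dt dy / y, that is, by the measure dy / y along
    each ray from the origin. *)
Lemma hyp_haar f : measurable_fun setT f -> (forall p, (0 <= f p)%E) ->
  (hyp f = \int[mu]_t haar (fun y => f ((t * y)%R, y)))%E.
Proof.
move=> mf f0; rewrite hypE// /haar tonelli; last first.
- by move=> x y; rewrite mule_ge0// haar_weight_ge0.
- by mea.
apply: eq_integral => y _.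
rewrite ge0_integralZl ?haar_weight_ge0//; last by mea.
rewrite /hyp_weight /ind; case: ltP => y0; last by rewrite !mul0e.
rewrite !mul1e.
transitivity ((y^-1)%:E * (\int[mu]_t f ((y * t + 0)%R, y)))%E; last first.
  by congr (_ * _)%E; apply: eq_integral => t _; rewrite addr0 mulrC.
rewrite (@integral_affine _ (fun x => f (x, y)))// ?gt_eqF//; last by mea.
rewrite muleA -EFinM gtr0_norm//; congr (_%:E * _)%E.
by rewrite expr2 invfM.
Qed.

Lemma hyp_translation f (b : R) : measurable_fun setT f -> (forall p, (0 <= f p)%E) ->
  hyp (fun p => f (p.1 + b, p.2)) = hyp f.
Proof.
move=> mf f0.
have mF : measurable_fun setT (fun p : R * R => f (p.1 + b, p.2)) by mea.
rewrite (hypE mF (fun p => f0 _)) (hypE mf f0).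
apply: eq_integral => y _; congr (_ * _)%E.
transitivity (\int[mu]_x f ((1 * x + b)%R, y))%E.
  by apply: eq_integral => x _; rewrite mul1r.
rewrite (@integral_affine _ (fun x => f (x, y)))// ?oner_eq0//; last by mea.
by rewrite normr1 invr1 mul1e.
Qed.

(** In the coordinates t = x / y and y, the map z -> -s / z sends t to -t and y to (s / (1 + t^2)) /
    y. Invariance of dt under reflection and of dy / y under inversion, for each fixed t, therefore
    suffices. *)
Lemma hyp_inversion f (s : R) : 0 < s ->
  measurable_fun setT f -> (forall p, (0 <= f p)%E) ->
  hyp (fun p => f (- (s * p.1 / (p.1 ^+ 2 + p.2 ^+ 2)),
                   s * p.2 / (p.1 ^+ 2 + p.2 ^+ 2))) = hyp f.
Proof.
move=> s0 mf f0.
have mF : measurable_fun setT (fun p : R * R =>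
    f (- (s * p.1 / (p.1 ^+ 2 + p.2 ^+ 2)), s * p.2 / (p.1 ^+ 2 + p.2 ^+ 2))) by mea.
rewrite (hyp_haar mF (fun p => f0 _)) (hyp_haar mf f0).
pose H t := haar (fun y => f (t * y, y)).
have mH : measurable_fun setT H.
  rewrite /H /haar; mea => x y; by rewrite mule_ge0// haar_weight_ge0.
have H0 t : (0 <= H t)%E.
  by apply: integral_ge0 => y _; rewrite mule_ge0// haar_weight_ge0.
transitivity (\int[mu]_t H (-1 * t + 0)%R)%E; last first.
  by rewrite integral_affine// ?oppr_eq0 ?oner_eq0// normrN1 invr1 mul1e.
apply: eq_integral => t _; rewrite /H.
have t1 : 0 < 1 + t ^+ 2 by rewrite ltr_pwDl// sqr_ge0.
rewrite -(@haar_inv _ (fun y => f ((-1 * t + 0) * y, y)) (s / (1 + t ^+ 2)))//; last first.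
- by mea.
- by rewrite divr_gt0.
apply: eq_integral => y _; rewrite /ind; case: ltP => y0; last by rewrite !mul0e.
congr (_ * f (_, _))%E.
  by rewrite /=; field; rewrite !gt_eqF//= (_ : _ + _ = y ^+ 2 * (1 + t ^+ 2)) ?mulr_gt0 ?exprn_gt0//; ring.
by rewrite /=; field; rewrite !gt_eqF//= (_ : _ + _ = y ^+ 2 * (1 + t ^+ 2)) ?mulr_gt0 ?exprn_gt0//; ring.
Qed.

Definition rowQ (c d : R) p : R := (c * p.1 + d) ^+ 2 + (c * p.2) ^+ 2.

(** The action on z = x + i y in real coordinates. The height y / |c z + d|^2 carries no determinant
    factor, so this is the action of the matrix when a d - b c = 1. *)
Definition mob (a b c d : R) p : R * R :=
  (((a * p.1 + b) * (c * p.1 + d) + a * c * p.2 ^+ 2) / rowQ c d p,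
   p.2 / rowQ c d p).

Lemma rowQ_gt0 c d p : 0 < p.2 -> (c != 0) || (d != 0) -> 0 < rowQ c d p.
Proof.
move=> p0; have [->|c0 _] := eqVneq c 0 => /=.
  by move=> d0; rewrite /rowQ !mul0r add0r expr0n addr0 exprn_even_gt0.
by rewrite /rowQ ltr_wpDl ?sqr_ge0// exprn_even_gt0//= mulf_neq0// gt_eqF.
Qed.

Lemma det_row (a b c d : R) : a * d - b * c = 1 -> (c != 0) || (d != 0).
Proof.
have [->|//] := eqVneq c 0; have [->|//] := eqVneq d 0.
by rewrite !mulr0 subr0 => /eqP; rewrite eq_sym oner_eq0.
Qed.

Lemma mob_im_gt0 a b c d p : a * d - b * c = 1 -> 0 < p.2 -> 0 < (mob a b c d p).2.
Proof. by move=> /det_row cd p0; rewrite divr_gt0// rowQ_gt0. Qed.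

(** Cocycle relation for |c z + d|^2 along a product of two matrices. *)
Lemma rowQ_mob a b c d c' d' p : a * d - b * c = 1 -> 0 < p.2 ->
  rowQ c' d' (mob a b c d p) =
    rowQ (c' * a + d' * c) (c' * b + d' * d) p / rowQ c d p.
Proof.
move=> D p0; have := rowQ_gt0 p0 (det_row D).
rewrite {1 2}/rowQ /mob /= => Q0.
(* Inserting the determinant into the height turns the claim into a rational identity in free
   variables. *)
have -> : p.2 / rowQ c d p = p.2 * (a * d - b * c) / rowQ c d p by rewrite D mulr1.
rewrite /rowQ in Q0 *; clear D; case: p Q0 {p0} => x y /= Q0.
by field; rewrite gt_eqF.
Qed.

Lemma mob_comp a b c d a' b' c' d' p :
  a * d - b * c = 1 -> a' * d' - b' * c' = 1 -> 0 < p.2 ->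
  mob a' b' c' d' (mob a b c d p) =
  mob (a' * a + b' * c) (a' * b + b' * d) (c' * a + d' * c) (c' * b + d' * d) p.
Proof.
move=> D D' p0; have Q0 := rowQ_gt0 p0 (det_row D).
have Q1 := rowQ_gt0 (mob_im_gt0 D p0) (det_row D').
rewrite (rowQ_mob _ _ D p0) in Q1.
have {}Q1 : 0 < rowQ (c' * a + d' * c) (c' * b + d' * d) p.
  by move: Q1; rewrite pmulr_lgt0// invr_gt0.
rewrite {1}/mob (rowQ_mob _ _ D p0) /=.
have -> : p.2 / rowQ c d p = p.2 * (a * d - b * c) / rowQ c d p by rewrite D mulr1.
rewrite [X in (_, X / _)](_ : _ = p.2 / rowQ c d p); last by rewrite D mulr1.
rewrite /mob; congr (_, _); last first.
  by field; rewrite !gt_eqF.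
move: Q0 Q1; rewrite /rowQ; clear D D'; case: p {p0} => x y /= Q0 Q1.
by field; rewrite !gt_eqF.
Qed.

Lemma mob1 p : mob 1 0 0 1 p = p.
Proof.
case: p => x y; rewrite /mob /rowQ /=.
by congr (_, _); field.
Qed.

Lemma measurable_mob a b c d : measurable_fun setT (mob a b c d).
Proof. by rewrite /mob /rowQ; mea. Qed.

(** Bruhat decomposition: for c <> 0 the action is z -> a/c - c^{-2} / (z + d/c), a translation, an
    inversion with s = c^{-2} and a translation. For c = 0, the condition d^2 = 1 makes it a
    translation by b d. *)
Lemma hyp_mob f a b c d : a * d - b * c = 1 -> (c = 0 -> d ^+ 2 = 1) ->
  measurable_fun setT f -> (forall p, (0 <= f p)%E) ->
  hyp (fun p => f (mob a b c d p)) = hyp f.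
Proof.
move=> D d1 mf f0; have [c0|c0] := eqVneq c 0.
  have dp := d1 c0; move: D; rewrite c0 mulr0 subr0 => D.
  rewrite -(hyp_translation (b * d) mf f0); apply: eq_hyp => p p0; congr f.
  rewrite /mob /rowQ !mul0r !add0r expr0n addr0 dp !divr1 mulr0 mul0r addr0.
  by rewrite mulrDl mulrAC D mul1r.
pose s := c ^- 2.
have s0 : 0 < s by rewrite invr_gt0 exprn_even_gt0.
pose g := fun p : R * R => f (p.1 + a / c, p.2).
have mg : measurable_fun setT g by rewrite /g; mea.
pose k := fun p : R * R => g (- (s * p.1 / (p.1 ^+ 2 + p.2 ^+ 2)),
                   s * p.2 / (p.1 ^+ 2 + p.2 ^+ 2)).
have mk : measurable_fun setT k by rewrite /k; mea.
rewrite -(hyp_translation (a / c) mf f0) -/g.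
rewrite -(hyp_inversion s0 mg) -/k; last by move=> p; exact: f0.
rewrite -(hyp_translation (d / c) mk); last by move=> p; exact: f0.
apply: eq_hyp => p p0; rewrite /k /g /=; congr f.
have Q0 : 0 < rowQ c d p by apply: rowQ_gt0; rewrite ?c0.
have Q1 : 0 < (p.1 + d / c) ^+ 2 + p.2 ^+ 2.
  by rewrite ltr_wpDl ?sqr_ge0// exprn_even_gt0//= gt_eqF.
have bE : b = (a * d - 1) / c by rewrite -D opprB addrCA subrr addr0 mulfK.
rewrite /mob bE; move: Q0 Q1; rewrite /rowQ /s; clear -c0; case: p => x y /= Q0 Q1.
by congr (_, _); field; rewrite c0 !gt_eqF//; nra.
Qed.

End Hyperbolic.

Ltac epos :=
  intros; cbv beta;
  repeat first
  [ assumption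
  | match goal with
    | |- is_true (Order.le _ ?t) =>
      lazymatch t with
      | ind _ => exact: ind_ge0
      | hyp_weight _ => exact: hyp_weight_ge0
      | (ind _ * (_^-1)%:E)%E => first [exact: haar_weight_ge0|apply: mule_ge0]
      | (_ * _)%E => apply: mule_ge0
      | (_ + _)%E => apply: adde_ge0
      | esum _ _ => apply: esum_ge0 => ? ?
      | hyp _ => apply: hyp_ge0 => ?
      | haar _ => apply: integral_ge0 => ? ?
      | integral _ _ _ => apply: integral_ge0 => ? ?
      end
    | H : forall p, is_true (Order.le _ (?f p)) |- is_true (Order.le _ (?f _)) => exact: H
    | H : forall i p, is_true (Order.le _ (?f i p)) |- is_true (Order.le _ (?f _ _)) => exact: H
    | H : forall i p, is_true (Order.le _ (?f i p)) |- is_true (Order.le _ (?f _ _)) => exact: H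
    end ].

(** * Rearranging and comparing unordered sums *)

Section EsumTools.
Context {R : realType}.
Local Open Scope ereal_scope.

Lemma esum_pairT (I J : choiceType) (a : I -> J -> \bar R) :
  (forall i j, 0 <= a i j) ->
  \esum_(i in [set: I]) (\esum_(j in [set: J]) a i j) =
  \esum_(k in [set: I * J]) a k.1 k.2.
Proof.
move=> a0; rewrite (@esum_esum _ _ _ setT (fun=> setT))//.
by congr esum; apply/seteqP; split.
Qed.

Lemma esum_split2 (I : choiceType) (a : I -> \bar R) i j : i != j ->
  (forall k, 0 <= a k) ->
  \esum_(k in [set: I]) a k =
  a i + (a j + \esum_(k in ~` [set i] `&` ~` [set j]) a k).
Proof.
move=> ij a0; rewrite (esumID [set i])// setTI esum_set1//; congr (_ + _).
rewrite setTI (esumID [set j])//; congr (_ + _).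
rewrite -(esum_set1 (a0 j)); congr esum; apply/seteqP; split => [k []//|k /= ->].
by split => //; apply/eqP; rewrite eq_sym.
Qed.

Lemma le_esumT (I : choiceType) (a b : I -> \bar R) :
  (forall i, a i <= b i) ->
  \esum_(i in [set: I]) a i <= \esum_(i in [set: I]) b i.
Proof. by move=> ab; apply: le_esum => i _. Qed.

Lemma le_esum_inj (I J : choiceType) (a : I -> \bar R) (b : J -> \bar R)
  (P : set I) (e : I -> J) : (forall j, 0 <= b j) ->
  (forall i i', P i -> P i' -> e i = e i' -> i = i') ->
  (forall i, P i -> a i <= b (e i)) ->
  \esum_(i in P) a i <= \esum_(j in [set: J]) b j.
Proof.
move=> b0 einj ab; apply: (@le_trans _ _ (\esum_(i in P) b (e i))).
  exact: le_esum.
rewrite -(@esum_image _ _ _ P e b); last by move=> i i' /set_mem Pi /set_mem Pi'; exact: einj.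
by rewrite [leRHS](esumID (e @` P))// setTI leeDl// esum_ge0.
Qed.

End EsumTools.

(** * Reduction theory of SL2(Z) *)

Section Reduction.
Context {R : realType}.
Implicit Types (p q : R * R) (v w : int * int) (a b c d n : int).

Definition imob a b c d p : R * R := mob a%:~R b%:~R c%:~R d%:~R p.
Definition vQ v p : R := rowQ v.1%:~R v.2%:~R p.
(** The same Bezout top row as in [gamma_cd], so that [vmob v] is the action of
    [gamma_cd v.1 v.2]. *)
Definition topa v : int := (egcdz v.1 v.2).2.
Definition topb v : int := - (egcdz v.1 v.2).1.
Definition vmob v p := imob (topa v) (topb v) v.1 v.2 p.

(** The closed domain meets every orbit, and its interior [fund0] meets an orbit at most once, up to
    sign of the matrix. The two regions have the same integrals, so a pair of one-sided counts
    replaces an exact count on the boundary. *)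
Definition fund p : bool :=
  [&& 0 < p.2, `|p.1| <= 2^-1 & 1 <= p.1 ^+ 2 + p.2 ^+ 2].
Definition fund0 p : bool :=
  [&& 0 < p.2, `|p.1| < 2^-1 & 1 < p.1 ^+ 2 + p.2 ^+ 2].

Arguments imob : simpl never.
Arguments vQ : simpl never.

Lemma toprow_det v : coprimez v.1 v.2 ->
  (topa v) * v.2 - (topb v) * v.1 = 1.
Proof.
rewrite /coprimez => /eqP <-; rewrite /topa /topb; case: egcdzP => u w /= <- _.
by rewrite mulNr opprK addrC.
Qed.

Lemma detR a b c d : a * d - b * c = 1 ->
  a%:~R * d%:~R - b%:~R * c%:~R = 1 :> R.
Proof. by move=> D; rewrite -!intrM -intrB D. Qed.

Lemma det_coprime a b c d : a * d - b * c = 1 -> coprimez c d.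
Proof.
move=> D; apply/coprimezP; exists (- b, a) => /=.
by rewrite mulNr addrC.
Qed.

Lemma det_c0 a b c d : a * d - b * c = 1 -> c = 0 ->
  (d = 1 \/ d = -1) /\ a = d.
Proof.
move=> + c0; rewrite c0 mulr0 subr0 => D.
have : (`|a| * `|d| = 1)%N by rewrite -abszM D.
move/eqP; rewrite muln_eq1 => /andP[/eqP a1 /eqP d1]; move: D; clear -a1 d1.
by case: a a1 => [[|[|?]]|[|?]]//; case: d d1 => [[|[|?]]|[|?]]// _ _ _; split; auto.
Qed.

Lemma vQ_gt0 v p : 0 < p.2 -> v != (0, 0) -> 0 < vQ v p.
Proof.
move=> p0; case: v => c d; rewrite xpair_eqE negb_and => cd.
by apply: rowQ_gt0 => //=; rewrite !intr_eq0.
Qed.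

Lemma coprime_neq0 v : coprimez v.1 v.2 -> v != (0, 0).
Proof. by apply: contraTneq => ->. Qed.

Lemma imob_im_gt0 a b c d p : a * d - b * c = 1 -> 0 < p.2 -> 0 < (imob a b c d p).2.
Proof. by move=> /detR D p0; exact: mob_im_gt0. Qed.

Lemma imob_comp a b c d a' b' c' d' p :
  a * d - b * c = 1 -> a' * d' - b' * c' = 1 -> 0 < p.2 ->
  imob a' b' c' d' (imob a b c d p) =
  imob (a' * a + b' * c) (a' * b + b' * d) (c' * a + d' * c) (c' * b + d' * d) p.
Proof.
move=> /detR D /detR D' p0; rewrite /imob mob_comp//.
by rewrite !(intrD, intrM).
Qed.

Lemma imob_inv a b c d p : a * d - b * c = 1 -> 0 < p.2 ->
  imob d (- b) (- c) a (imob a b c d p) = p.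
Proof.
move=> D p0; rewrite imob_comp//; last by rewrite -D; ring.
rewrite (_ : d * a + - b * c = 1); last by rewrite mulNr mulrC.
rewrite (_ : d * b + - b * d = 0); last by ring.
rewrite (_ : - c * a + a * c = 0); last by ring.
rewrite (_ : - c * b + a * d = 1); last by rewrite -D; ring.
exact: mob1.
Qed.

Lemma imob_invK a b c d p : a * d - b * c = 1 -> 0 < p.2 ->
  imob a b c d (imob d (- b) (- c) a p) = p.
Proof.
move=> D p0; have := @imob_inv d (- b) (- c) a p; rewrite !opprK; apply => //.
by rewrite -D; ring.
Qed.

Lemma vQ_imob a b c d c' d' p : a * d - b * c = 1 -> 0 < p.2 ->
  vQ (c', d') (imob a b c d p) = vQ (c' * a + d' * c, c' * b + d' * d) p / vQ (c, d) p.
Proof.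
move=> /detR D p0; rewrite /vQ /imob rowQ_mob//=.
by rewrite !(intrD, intrM).
Qed.

Lemma seq_min (T : eqType) (F : T -> R) (s : seq T) x0 : x0 \in s ->
  exists2 x, x \in s & forall y, y \in s -> F x <= F y.
Proof.
elim: s x0 => [//|x s IH] x0 _.
case: s IH => [_|y s IH]; first by exists x; rewrite ?mem_head// => y; rewrite inE => /eqP ->.
have [z zs zmin] := IH y (mem_head _ _).
have [xz|zx] := leP (F x) (F z).
  exists x; first exact: mem_head.
  by move=> t; rewrite inE => /orP[/eqP->//|/zmin]; exact: le_trans.
exists z; first by rewrite inE zs orbT.
by move=> t; rewrite inE => /orP[/eqP->|/zmin//]; exact: ltW.
Qed.

(** A vector with |c z + d|^2 < 1 lies in a finite box, while (0, 1) has value 1. The minimum over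
    the nonzero vectors of the box is therefore a global one. *)
Lemma vQ_min p : 0 < p.2 ->
  exists2 v : int * int, v != (0, 0) & forall w, w != (0, 0) -> vQ v p <= vQ w p.
Proof.
(* When |c z + d| < 1, the imaginary part gives |c| <= 1 / y, and then the real part gives |d| <= 1
   + |x| / y. *)
move=> p0; set B := p.2^-1 + `|p.1| / p.2 + 1.
have B0 : 0 <= B by rewrite !addr_ge0// ?divr_ge0 ?invr_ge0// ltW.
have [N BN] : exists N : nat, B <= N%:R.
  by exists (Num.Def.archi_bound B); exact/ltW/archi_boundP.
have [rng rngP] : exists rng : seq int, forall z : int, `|z%:~R| <= N%:R :> R -> z \in rng.
  exists [seq (i%:Z - N%:Z) | i <- iota 0 (2 * N).+1] => z.
  rewrite -intr_norm (_ : N%:R = (N%:Z)%:~R)// ler_int => zN.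
  apply/mapP; exists (absz (z + N%:Z)).
    by rewrite mem_iota; lia.
  by lia.
pose s := [seq v <- [seq (c, d) | c <- rng, d <- rng] | v != (0, 0)].
have s1 : (0, 1) \in s.
  rewrite mem_filter; apply/andP; split => //; apply: allpairs_f.
    by apply: rngP; rewrite normr0.
  apply: rngP; rewrite normr1; apply: le_trans BN.
  by rewrite lerDr addr_ge0// ?divr_ge0 ?invr_ge0// ltW.
have [v vs vmin] := seq_min (vQ ^~ p) s1.
exists v; first by move: vs; rewrite mem_filter => /andP[].
move=> [c d] w0; have [/vmin//|ws] := boolP ((c, d) \in s).
have v1 : vQ v p <= 1.
  by rewrite (le_trans (vmin _ s1))// /vQ /rowQ /= !mul0r add0r expr1n expr0n addr0.
apply: (le_trans v1); rewrite leNgt; apply/negP => Q1; move/negP: ws; apply.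
rewrite mem_filter w0 andTb; move: Q1; rewrite /vQ /rowQ /= => Q1.
have h1 : `|c%:~R * p.2| < 1.
  rewrite -(@expr_lt1 _ 2)// -normrX ger0_norm ?sqr_ge0//.
  by apply: le_lt_trans Q1; rewrite lerDr sqr_ge0.
have h2 : `|c%:~R * p.1 + d%:~R| < 1.
  rewrite -(@expr_lt1 _ 2)// -normrX ger0_norm ?sqr_ge0//.
  by apply: le_lt_trans Q1; rewrite lerDl sqr_ge0.
have hc : `|c%:~R| <= p.2^-1 :> R.
  by move: h1; rewrite normrM (gtr0_norm p0) -ltr_pdivlMr// mul1r => /ltW.
have hd : `|d%:~R| <= 1 + `|p.1| / p.2 :> R.
  rewrite -[d%:~R](addKr (c%:~R * p.1)) addrC.
  rewrite (le_trans (ler_normB _ _))//; apply: lerD; first exact: ltW.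
  by rewrite normrM mulrC ler_wpM2l.
have q0 : 0 <= p.2^-1 by rewrite invr_ge0 ltW.
have q1 : 0 <= `|p.1| / p.2 by rewrite mulr_ge0.
by apply: allpairs_f; apply: rngP; apply: le_trans BN; rewrite /B; lra.
Qed.

(** Dividing a vector by its gcd g divides the value by g^2, so a minimal vector has g = 1. *)
Lemma vQ_min_coprime v p : 0 < p.2 -> v != (0, 0) ->
  (forall w, w != (0, 0) -> vQ v p <= vQ w p) -> coprimez v.1 v.2.
Proof.
case: v => c d p0 v0 vmin /=.
have /dvdzP[c' cE] := dvdz_gcdl c d; have /dvdzP[d' dE] := dvdz_gcdr c d.
set g := gcdz c d in cE dE.
have w0 : (c', d') != (0, 0).
  by apply: contraNneq v0 => -[c0 d0]; rewrite cE dE c0 d0 !mul0r.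
have := vmin _ w0.
have -> : vQ (c, d) p = g%:~R ^+ 2 * vQ (c', d') p.
  by rewrite /vQ /rowQ /= cE dE !intrM; ring.
rewrite ger_pMl ?vQ_gt0// => g1.
have g0 : g != 0 by apply: contraNneq v0 => g0; rewrite cE dE g0 !mulr0.
have : `|g%:~R| <= 1 :> R by rewrite -(@expr_le1 _ 2)// -normrX ger0_norm ?sqr_ge0.
rewrite -intr_norm -[1]/(1%:~R) ler_int.
rewrite /coprimez -/g; have : 0 <= g by []. 
by move: g0; case: (g) => [[|[|?]]|].
Qed.

(** A minimal vector as bottom row gives the highest point of the orbit. A translation brings its
    real part into [-1/2, 1/2], and |w|^2 for the image w is the quotient of the values at the top
    and bottom rows, hence at least 1 by minimality. *)
Lemma fund_reduction p : 0 < p.2 ->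
  exists a b c d, a * d - b * c = 1 /\ fund (imob a b c d p).
Proof.
move=> p0; have [[c d] v0 vmin] := vQ_min p0.
have cop := vQ_min_coprime p0 v0 vmin.
have D := toprow_det cop; rewrite /= in D.
set a := (topa (c, d)) in D; set b := (topb (c, d)) in D.
pose n := - Num.floor ((imob a b c d p).1 + 2^-1).
have D' : (a + n * c) * d - (b + n * d) * c = 1 by rewrite -D; ring.
exists (a + n * c), (b + n * d), c, d; split => //.
have Q0 := vQ_gt0 p0 v0.
have E : imob (a + n * c) (b + n * d) c d p = ((imob a b c d p).1 + n%:~R, (imob a b c d p).2).
  rewrite /imob /mob /= !intrD !intrM; congr (_, _).
  by move: Q0; rewrite /vQ /rowQ /= => Q0; field; rewrite gt_eqF.
apply/and3P; split; first exact: imob_im_gt0.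
  rewrite E /n; set X := (imob a b c d p).1.
  change (`|X + (- Num.floor (X + 2^-1))%:~R| <= 2^-1).
  have := floor_itv (X + 2^-1).
  rewrite rmorphN intrD /= => /andP[h1 h2].
  by rewrite ler_norml; apply/andP; split; lra.
(* |w|^2 is the value of the form of w at (1, 0). *)
have := @vQ_imob (a + n * c) (b + n * d) c d 1 0 p D' p0.
rewrite !mul1r !mul0r !addr0 {1}/vQ /rowQ /= !mul1r addr0 => ->.
rewrite ler_pdivlMr// mul1r; apply: vmin; apply/eqP => -[a0 b0].
by move: D'; rewrite a0 b0 !mul0r subr0.
Qed.

(** |c w + d|^2 equals c^2 (|w|^2 - 1) plus the combination of c^2 - c d + d^2 and c^2 + c d + d^2
    with weights 1/2 - x and 1/2 + x. The weights are positive with sum 1, and both forms take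
    integer values at least 1. *)
Lemma fund0_rowQ_gt1 c d (w : R * R) : fund0 w -> c != 0 -> 1 < vQ (c, d) w.
Proof.
move=> /and3P[w0 x2 n1] c0; rewrite /vQ /rowQ /=.
have c2 : 0 < c%:~R ^+ 2 :> R by rewrite exprn_even_gt0//= intr_eq0.
have zpos (e : int) : 1 <= c ^+ 2 + e * (c * d) + d ^+ 2 -> 
  1 <= c%:~R ^+ 2 + e%:~R * (c%:~R * d%:~R) + d%:~R ^+ 2 :> R.
  by move=> h; rewrite -[leLHS]/(1%:~R) -!(rmorphXn, intrM, intrD) ler_int.
have h1 := zpos 1; have h2 := zpos (-1).
have zquad (e : int) : e ^+ 2 = 1 -> 1 <= c ^+ 2 + e * (c * d) + d ^+ 2.
  move=> e1; rewrite -gtz0_ge1 -(pmulr_rgt0 _ (isT : 0 < 4 :> int)).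
  rewrite (_ : 4 * _ = (2 * d + e * c) ^+ 2 + (4 - e ^+ 2) * c ^+ 2); last by ring.
  by rewrite e1 ltr_wpDl ?sqr_ge0// mulr_gt0// exprn_even_gt0.
have {}h1 : 1 <= c%:~R ^+ 2 + (c%:~R * d%:~R) + d%:~R ^+ 2 :> R.
  by move: h1; rewrite !mul1r; apply; by have := zquad 1 erefl; rewrite mul1r.
have {}h2 : 1 <= c%:~R ^+ 2 - (c%:~R * d%:~R) + d%:~R ^+ 2 :> R.
  by move: h2; rewrite !mulrN1z !mulN1r; apply; by have := zquad (-1) erefl; rewrite mulN1r.
move: x2; rewrite ltr_norml => /andP[x1 x2].
set C := c%:~R in c2 h1 h2 *; set D := d%:~R in h1 h2 *.
case: w w0 n1 x1 x2 => x y /= w0 n1 x1 x2.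
have -> : (C * x + D) ^+ 2 + (C * y) ^+ 2 =
  C ^+ 2 * (x ^+ 2 + y ^+ 2 - 1) +
  ((2^-1 - x) * (C ^+ 2 - C * D + D ^+ 2) + (2^-1 + x) * (C ^+ 2 + C * D + D ^+ 2)).
  by field.
have e1 : 0 < C ^+ 2 * (x ^+ 2 + y ^+ 2 - 1) by rewrite mulr_gt0// subr_gt0.
have e2 : (2^-1 - x) <= (2^-1 - x) * (C ^+ 2 - C * D + D ^+ 2) by rewrite ler_peMr//; lra.
have e3 : (2^-1 + x) <= (2^-1 + x) * (C ^+ 2 + C * D + D ^+ 2) by rewrite ler_peMr//; lra.
by lra.
Qed.

(** If c <> 0, then |c w + d|^2 > 1, and the inverse matrix at the image point gives 1 / |c w + d|^2
    > 1 as well. If c = 0, the matrix acts as an integer translation between two points with |x| <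
    1/2, so it is trivial. *)
Lemma fund0_uniq a b c d (w : R * R) : a * d - b * c = 1 -> fund0 w -> fund0 (imob a b c d w) ->
  [/\ c = 0, b = 0, a = d & d = 1 \/ d = -1].
Proof.
move=> D fw fw'; have w0 : 0 < w.2 by case/and3P: fw.
have c0 : c = 0.
  apply: contrapT => /eqP c0.
  have Q1 := fund0_rowQ_gt1 d fw c0.
  have := @fund0_rowQ_gt1 (- c) a _ fw'; rewrite oppr_eq0 => /(_ c0).
  rewrite vQ_imob// (_ : - c * a + a * c = 0); last by ring.
  rewrite (_ : - c * b + a * d = 1); last by rewrite -D; ring.
  rewrite {1}/vQ /rowQ /= !mul0r add0r expr1n expr0n addr0 mul1r.
  by rewrite invf_gt1// ?(lt_trans _ Q1)// => /(lt_trans Q1); rewrite ltxx.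
have [d1 ad] := det_c0 D c0.
split => //.
case/and3P: fw => _ /ltr_normlP[x1 x2] _; case/and3P: fw' => _ + _.
rewrite /imob /mob /rowQ /= c0 !mulr0z !mul0r !add0r expr0n addr0 mulr0 mul0r addr0.
have dd : d%:~R ^+ 2 = 1 :> R by case: d1 => ->; rewrite ?mulrN1z ?sqrrN expr1n.
have da : a%:~R * d%:~R = 1 :> R by rewrite ad -expr2.
rewrite dd divr1 mulrDl mulrAC da mul1r => /ltr_normlP[x3 x4].
have bd : `|b%:~R * d%:~R| < 1 :> R by rewrite ltr_norml; apply/andP; split; lra.
move: bd; rewrite -intrM -intr_norm -[ltRHS]/(1%:~R) ltr_int.
by clear -d1; case: d1 => ->; lia.
Qed.

(** Matrices with the same bottom row differ by a left factor T^n, where n is the determinant of the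
    two top rows. *)
Lemma toprow_uniq a b a' b' c d : a * d - b * c = 1 -> a' * d - b' * c = 1 ->
  a' = a + (a * b' - b * a') * c /\ b' = b + (a * b' - b * a') * d.
Proof.
move=> D D'; split.
  have -> : a + (a * b' - b * a') * c = a * (1 + b' * c) - a' * (b * c) by ring.
  have -> : 1 + b' * c = a' * d by rewrite -D'; ring.
  have -> : b * c = a * d - 1 by rewrite -D; ring.
  by ring.
have -> : b + (a * b' - b * a') * d = b' * (a * d) - b * (a' * d - 1) by ring.
have -> : a' * d - 1 = b' * c by rewrite -D'; ring.
have -> : a * d = 1 + b * c by rewrite -D; ring.
by ring.
Qed.

(* The matrix T^n g_v as a quadruple, and the test that its inverse maps q to
   the region phi. *)
Definition cosa (s : int * int * int) : int := topa s.1 + s.2 * s.1.1.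
Definition cosb (s : int * int * int) : int := topb s.1 + s.2 * s.1.2.

Definition coset_hit (phi : R * R -> bool) q (s : int * int * int) : bool :=
  coprimez s.1.1 s.1.2 &&
  phi (imob s.1.2 (- (cosb s)) (- s.1.1) (cosa s) q).

Lemma cosetA_det s : coprimez s.1.1 s.1.2 ->
  (cosa s) * s.1.2 - (cosb s) * s.1.1 = 1.
Proof. by move=> /toprow_det D; rewrite /cosa /cosb /= -D; ring. Qed.

Lemma coset_hit_of (phi : R * R -> bool) a b c d q :
  a * d - b * c = 1 -> phi (imob a b c d q) ->
  exists n, coset_hit phi q ((- c, a), n).
Proof.
move=> D h.
have cop : coprimez (- c) a.
  by apply: (@det_coprime d (- b)); rewrite -D; ring.
have D1 := @toprow_det (- c, a) cop; rewrite /= in D1.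
have D2 : d * a - (- b) * (- c) = 1 by rewrite -D; ring.
have [e1 e2] := toprow_uniq D1 D2.
exists ((topa (- c, a)) * - b - (topb (- c, a)) * d).
by rewrite /coset_hit /cosa /cosb /= cop -e1 -e2 !opprK.
Qed.

(** A reducing matrix and its negative act alike, but their inverses have opposite bottom rows,
    hence yield two distinct triples. *)
Lemma coset_hit_ge2 q : 0 < q.2 ->
  (2%:E <= \esum_(s in [set: int * int * int]) @ind R (coset_hit fund q s))%E.
Proof.
move=> q0; have [a [b [c [d [D h]]]]] := fund_reduction q0.
have [n hn] := coset_hit_of D h.
have D' : (- a) * (- d) - (- b) * (- c) = 1 by rewrite !mulrNN.
have h' : fund (imob (- a) (- b) (- c) (- d) q).
  rewrite (_ : imob _ _ _ _ _ = imob a b c d q)//.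
  rewrite /imob /mob /rowQ !mulrNz; congr (_, _).
    congr (_ / _); ring.
  congr (_ / _); ring.
have [n' hn'] := coset_hit_of D' h'.
rewrite opprK in hn'.
have ne : ((- c, a), n) != ((c, - a), n').
  apply/eqP => -[e1 e2 _].
  have c0 : c = 0 by move: e1; clear; lia.
  have a0 : a = 0 by move: e2; clear; lia.
  by move: D; rewrite c0 a0 mulr0 mul0r subr0.
rewrite (esum_split2 ne); last by move=> k; exact: ind_ge0.
rewrite hn hn' {1 2}/ind addeA -EFinD (_ : true%:R + true%:R = 2)//.
by rewrite leeDl// esum_ge0// => *; exact: ind_ge0.
Qed.

(** The two image points lie in the open domain and are related by the product of one inverse with
    the other matrix; [fund0_uniq] makes this product plus or minus the identity. *)
Lemma coset_hit_uniq q s s' : 0 < q.2 ->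
  coset_hit fund0 q s -> coset_hit fund0 q s' ->
  (s'.1 = s.1 \/ s'.1 = (- s.1.1, - s.1.2)) /\ (s'.1 = s.1 -> s' = s).
Proof.
move=> q0 /andP[cop h] /andP[cop' h'].
have D := cosetA_det cop; have D' := cosetA_det cop'.
case: s cop h D => -[c d] n /= cop h D; case: s' cop' h' D' => -[c' d'] n' /= cop' h' D'.
set a := (cosa (c, d, n)) in h D; set b := (cosb (c, d, n)) in h D.
set a' := (cosa (c', d', n')) in h' D'; set b' := (cosb (c', d', n')) in h' D'.
pose w := imob d (- b) (- c) a q.
have Di : d * a - (- b) * (- c) = 1 by rewrite -D; ring.
have Di' : d' * a' - (- b') * (- c') = 1 by rewrite -D'; ring.
have w0 : 0 < w.2 by exact: imob_im_gt0.
have qE : q = imob a b c d w by rewrite /w imob_invK.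
have h2 : fund0 (imob d' (- b') (- c') a' (imob a b c d w)) by rewrite -qE.
rewrite imob_comp// in h2.
have Dc : (d' * a + - b' * c) * (- c' * b + a' * d) - (d' * b + - b' * d) * (- c' * a + a' * c) = 1.
  rewrite -[RHS]mul1r -[in X in _ = X * _]D -[in X in _ = _ * X]D'; ring.
have [e1 e2 e3 e4] := fund0_uniq Dc h h2.
have key : (d' = d /\ c' = c) \/ (d' = - d /\ c' = - c).
  set e := - c' * b + a' * d in e3 e4.
  have Ed : d' = e * d.
    have -> : d' = d' * (a * d - b * c) by rewrite D mulr1.
    have -> : d' * (a * d - b * c) = (d' * a + - b' * c) * d - c * (d' * b + - b' * d) by ring.
    by rewrite e3 e2; ring.
  have Ec : c' = e * c.
    have -> : c' = c' * (a * d - b * c) by rewrite D mulr1.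
    have -> : c' * (a * d - b * c) = - (- c' * a + a' * c) * d + c * (- c' * b + a' * d) by ring.
    by rewrite e1 -/e; ring.
  by case: e4 => e_; rewrite Ed Ec e_ ?mul1r ?mulN1r; [left|right].
split; first by case: key => -[-> ->]; [left|right].
move=> [ec ed]; subst c' d'; congr (_, _).
have : - c * a + a' * c = 0 by [].
have : d * b + - b' * d = 0 by [].
rewrite /a /b /a' /b' /cosa /cosb /= => f1 f2.
have g1 : (n' - n) * (c * c) = 0 by rewrite -[RHS]f2; ring.
have g2 : (n' - n) * (d * d) = 0 by rewrite -[RHS]oppr0 -[X in _ = - X]f1; ring.
have cd0 : (c, d) != (0, 0) by exact: (@coprime_neq0 (c, d)).
apply/eqP; rewrite -subr_eq0.
move/eqP: g1; rewrite !mulf_eq0 => /orP[//|cc]; move/eqP: g2; rewrite !mulf_eq0 => /orP[//|dd].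
by move: cd0; rewrite xpair_eqE; rewrite orbb in cc; rewrite orbb in dd; rewrite cc dd.
Qed.

Lemma coset_hit_le2 q : 0 < q.2 ->
  (\esum_(s in [set: int * int * int]) @ind R (coset_hit fund0 q s) <= 2%:E)%E.
Proof.
move=> q0.
have [[s hs]|no] := pselect (exists s, coset_hit fund0 q s); last first.
  rewrite esum1 ?lee_fin// => s _; rewrite /ind; case: (boolP (coset_hit _ _ _)) => // hs.
  by exfalso; apply: no; exists s.
have [[s' [ss' hs']]|no] := pselect (exists s', s != s' /\ coset_hit fund0 q s').
  rewrite (esum_split2 ss'); last by move=> k; exact: ind_ge0.
  rewrite esum1 ?adde0; first by rewrite hs hs' /ind -EFinD lee_fin.
  move=> t [/= ts ts']; rewrite /ind; case: (boolP (coset_hit _ _ _)) => // ht; exfalso.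
  have [h1 k1] := coset_hit_uniq q0 hs ht; have [h2 k2] := coset_hit_uniq q0 hs' ht.
  have [h3 k3] := coset_hit_uniq q0 hs hs'.
  case: h3 => [/k3 e|e3]; first by rewrite e eqxx in ss'.
  case: h1 => [/k1//|e1]; apply: ts'; apply: k2; by rewrite e1 e3.
rewrite (esumID [set s]); last by move=> *; exact: ind_ge0.
rewrite setTI esum_set1 ?ind_ge0// [X in (_ + X)%E]esum1 ?adde0.
  by rewrite /ind hs lee_fin ler1n.
move=> t [_ /= ts]; rewrite /ind; case: (boolP (coset_hit _ _ _)) => // ht; exfalso.
by apply: no; exists t; split => //; apply/eqP => e; apply: ts.
Qed.

End Reduction.

(** * Unfolding over the modular surface *)

Section Unfolding.
Context {R : realType}.
Local Notation mu := (@lebesgue_measure R).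
Implicit Types (p q : R * R).
Local Open Scope ereal_scope.

Lemma measurable_fund : measurable_fun setT (@fund R).
Proof. by rewrite /fund; mea. Qed.

Lemma measurable_fund0 : measurable_fun setT (@fund0 R).
Proof. by rewrite /fund0; mea. Qed.

Lemma measurable_imob a b c d : measurable_fun setT (@imob R a b c d).
Proof. exact: measurable_mob. Qed.

Lemma hyp_imob (f : R * R -> \bar R) a b c d : (a * d - b * c = 1)%R ->
  measurable_fun setT f -> (forall p, 0 <= f p) ->
  hyp (fun p => f (imob a b c d p)) = hyp f.
Proof.
move=> D mf f0; rewrite /imob hyp_mob//; first exact: detR.
move=> /eqP; rewrite intr_eq0 => /eqP c0; have [+ _] := det_c0 D c0.
by case => ->; rewrite ?mulrN1z ?sqrrN expr1n.
Qed.

(* The regions differ by the sides |x| = 1/2 and the arc x^2 + y^2 = 1, which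
   meet each horizontal line in at most four points. *)
Lemma hyp_fund_fund0 (f : R * R -> \bar R) :
  measurable_fun setT f -> (forall p, 0 <= f p) ->
  hyp (fun p => ind (fund p) * f p) = hyp (fun p => ind (fund0 p) * f p).
Proof.
move=> mf f0; have m1 := measurable_fund; have m2 := measurable_fund0.
rewrite !hypE; last 4 first.
- by mea.
- by move=> p; rewrite mule_ge0// ind_ge0.
- by mea.
- by move=> p; rewrite mule_ge0// ind_ge0.
apply: eq_integral => y _; congr (_ * _).
apply: ge0_ae_eq_integral => //.
- by mea.
- by mea.
- by move=> x _; rewrite mule_ge0// ind_ge0.
- by move=> x _; rewrite mule_ge0// ind_ge0.
pose s := Num.sqrt (1 - y ^+ 2)%R.
exists [set (2^-1)%R; (- 2^-1)%R; s; (- s)%R]; split.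
- by do !apply: measurableU; exact: measurable_set1.
- apply: countable_lebesgue_measure0; apply: finite_set_countable.
  by rewrite !finite_setU; do !split; exact: finite_set1.
- move=> x /= H; apply: contrapT => H'; apply: H => _.
  have x1 : (`|x| != 2^-1)%R.
    apply/eqP => xE; apply: H'; case: (ger0P x) xE => _ xE; first by left; left; left.
    by left; left; right; rewrite -xE opprK.
  have x2 : (x ^+ 2 + y ^+ 2 != 1)%R.
    apply/eqP => xE; apply: H'.
    have : `|x|%R = s by rewrite /s -xE addrK sqrtr_sqr.
    by case: (ger0P x) => _ <-; [left; right|right; rewrite opprK].
  congr (ind _ * _); rewrite /fund /fund0 /=.
  by rewrite [(`|x| < _)%R]lt_neqAle x1 [(1 < _)%R]lt_neqAle [(1 == _)%R]eq_sym x2.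
Qed.

Lemma imob_shift n v p : coprimez v.1 v.2 -> (0 < p.2)%R ->
  imob (cosa (v, n)) (cosb (v, n)) v.1 v.2 p =
  ((vmob v p).1 + n%:~R, (vmob v p).2)%R :> R * R.
Proof.
case: v => c d cop p0; rewrite /vmob /cosa /cosb /imob /mob /= !intrD !intrM; congr (_, _).
have := vQ_gt0 p0 (coprime_neq0 cop).
by rewrite /vQ /rowQ /= => Q0; field; rewrite gt_eqF.
Qed.

Lemma vmob_im_gt0 v p : coprimez v.1 v.2 -> (0 < p.2)%R -> (0 < (vmob v p).2)%R.
Proof. by move=> /toprow_det D p0; exact: imob_im_gt0. Qed.

(** For each v, exactly one translate T^n g_v p falls into the strip 0 <= x < 1. Inserting the sum
    over n and substituting q = T^n g_v p turns the sum over v into one integral over the strip,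
    weighted by the number of triples whose inverse matrix maps q into the region. *)
Lemma unfold_region (phi : R * R -> bool) (h : R * R -> \bar R) :
  measurable_fun setT phi -> measurable_fun setT h -> (forall p, 0 <= h p) ->
  (forall p (n : int), h (p.1 + n%:~R, p.2)%R = h p) ->
  \esum_(v in [set: int * int])
     (ind (coprimez v.1 v.2) * hyp (fun p => ind (phi p) * h (vmob v p))) =
  hyp (fun q => (ind (0 <= q.1 < 1)%R * h q) *
     \esum_(s in [set: int * int * int]) ind (coset_hit phi q s)).
Proof.
move=> mphi mh h0 hper.
have mi := @measurable_imob.
have mv v : measurable_fun setT (@vmob R v) by exact: measurable_imob.
transitivity (\esum_(v in [set: int * int]) \esum_(n in [set: int])
   hyp (fun q => (ind (0 <= q.1 < 1)%R * h q) * ind (coset_hit phi q (v, n)))).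
  apply: eq_esum => v _; rewrite /coset_hit /=.
  have [cop|ncop] := boolP (coprimez _ _); last first.
    rewrite mul0e esum1// => n _; rewrite /hyp integral0_eq// => q _.
    by rewrite andFb /ind !mule0.
  rewrite mul1e.
  have mA n : measurable_fun setT (fun p => ind (phi p) *
      (ind (0 <= (imob (cosa (v, n)) (cosb (v, n)) v.1 v.2 p).1 < 1)%R
      * h (imob (cosa (v, n)) (cosb (v, n)) v.1 v.2 p))).
    have mj : measurable_fun setT (@imob R (cosa (v, n)) (cosb (v, n)) v.1 v.2).
      exact: measurable_imob.
    by mea.
  transitivity (hyp (fun p => \esum_(n in [set: int]) (ind (phi p) *
      (ind (0 <= (imob (cosa (v, n)) (cosb (v, n)) v.1 v.2 p).1 < 1)%R
      * h (imob (cosa (v, n)) (cosb (v, n)) v.1 v.2 p))))).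
    apply: eq_hyp => p p0.
    transitivity (ind (phi p) * (h (vmob v p) *
        \esum_(n in [set: int]) ind (0 <= (vmob v p).1 + n%:~R < 1)%R)).
      by rewrite ind_int_uniq mule1.
    rewrite -[X in _ * X]esumZl; [|by epos|by move=> *; epos].
    rewrite -esumZl; [|by epos|by move=> *; epos].
    apply: eq_esum => n _; rewrite imob_shift// hper; congr (_ * _).
    by rewrite muleC.
  rewrite (hyp_esum mA); last by move=> *; epos.
  apply: eq_esum => n _.
  have D := @cosetA_det (v, n) cop; rewrite /= in D.
  have D' : (v.2 * (cosa (v, n)) - - (cosb (v, n)) * - v.1 = 1)%R by rewrite -[RHS]D; ring.
  have mj : measurable_fun setT (@imob R v.2 (- (cosb (v, n))) (- v.1) (cosa (v, n))).
    exact: measurable_imob.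
  rewrite -(@hyp_imob (fun q => (ind (0 <= q.1 < 1)%R * h q) *
     ind (phi (imob v.2 (- (cosb (v, n))) (- v.1) (cosa (v, n)) q))) _ _ _ _ D).
  - apply: eq_hyp => p p0; rewrite imob_inv//.
    by rewrite muleC.
  - by mea.
  - by move=> *; epos.
have mhit s : measurable_fun setT (fun q : R * R => coset_hit phi q s).
  have mj : measurable_fun setT (@imob R s.1.2 (- (cosb s)) (- s.1.1) (cosa s)).
    exact: measurable_imob.
  by rewrite /coset_hit; mea.
rewrite esum_pairT; last by move=> *; epos.
rewrite -hyp_esum; last 2 first.
- by move=> [v n] /=; mea.
- by move=> *; epos.
apply: eq_hyp => q q0; rewrite esumZl; [|by epos|by move=> *; epos].
by congr (_ * _); apply: eq_esum => -[].
Qed.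

(** The weight is at least 2 for the closed domain and at most 2 for the open one. Both domains give
    the same left-hand side, so the two inequalities pinch it. *)
Theorem unfolding (h : R * R -> \bar R) :
  measurable_fun setT h -> (forall p, 0 <= h p) ->
  (forall p (n : int), h (p.1 + n%:~R, p.2)%R = h p) ->
  \esum_(v in [set: int * int])
     (ind (coprimez v.1 v.2) * hyp (fun p => ind (fund p) * h (vmob v p))) =
  2%:E * hyp (fun q => ind (0 <= q.1 < 1)%R * h q).
Proof.
move=> mh h0 hper; have m1 := measurable_fund; have m2 := measurable_fund0.
have mv v : measurable_fun setT (@vmob R v) by exact: measurable_imob.
have mS (phi : R * R -> bool) : measurable_fun setT phi -> measurable_fun setT
    (fun q : R * R => \esum_(s in [set: int * int * int]) ind (coset_hit phi q s) : \bar R).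
  move=> mphi; apply: measurable_fun_esum => [s|*]; last exact: ind_ge0.
  have mj : measurable_fun setT (@imob R s.1.2 (- (cosb s)) (- s.1.1) (cosa s)).
    exact: measurable_imob.
  by rewrite /coset_hit; mea.
have mf1 := mS _ m1; have mf2 := mS _ m2.
have S0 (phi : R * R -> bool) q : 0 <= \esum_(s in [set: int * int * int]) @ind R (coset_hit phi q s).
  by apply: esum_ge0 => *; exact: ind_ge0.
have msh : measurable_fun setT (fun q : R * R => ind (0 <= q.1 < 1)%R * h q) by mea.
rewrite -(hypZl msh); [|by move=> *; epos|by rewrite lee_fin].
apply/eqP; rewrite eq_le; apply/andP; split.
  rewrite [leLHS](_ : _ = \esum_(v in [set: int * int])
     (ind (coprimez v.1 v.2) * hyp (fun p => ind (fund0 p) * h (vmob v p)))).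
    rewrite (unfold_region m2 mh h0 hper); apply: le_hyp.
    - by mea.
    - by mea.
    - by move=> p p0; epos.
    - move=> p p0; rewrite muleC; apply: lee_wpmul2r; first by epos.
      exact: coset_hit_le2.
  apply: eq_esum => v _; rewrite hyp_fund_fund0//.
  by have mvv := mv v; mea.
rewrite (unfold_region m1 mh h0 hper); apply: le_hyp.
- by mea.
- by mea.
- by move=> p p0; epos; rewrite lee_fin.
- move=> p p0; rewrite muleC; apply: lee_wpmul2l; first by epos.
  exact: coset_hit_ge2.
Qed.

End Unfolding.

(** * Explicit integrals in one variable *)

Section CalculusTools.
Context {R : realType}.
Local Notation mu := (@lebesgue_measure R).

Lemma integral_itvcy (a : R) (g : R -> \bar R) :
  (\int[mu]_(x in `[a, +oo[) g x = \int[mu]_x (ind (a <= x)%R * g x))%E.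
Proof.
rewrite integral_mkcond; apply: eq_integral => x _.
rewrite patchE mem_setE in_itv /= andbT /ind.
by case: ifPn => _; rewrite ?mul1e ?mul0e.
Qed.

Lemma integral_FTCy (f F : R -> R) (a b l : R) : b < a ->
  (forall x, b < x -> is_derive x (1 : R) F (f x)) ->
  (forall x, b < x -> {for x, continuous f}) ->
  (forall x, a <= x -> 0 <= f x) -> F x @[x --> +oo] --> l ->
  (\int[mu]_x (ind (a <= x)%R * (f x)%:E) = (l - F a)%:E)%E.
Proof.
move=> ba dF cf f0 Fl; rewrite -integral_itvcy.
rewrite (@ge0_continuous_FTC2y _ f F a l)//.
- apply/continuous_within_itvcyP; split.
    by move=> x; rewrite in_itv /= andbT => ax; apply: cf; exact: lt_trans ax.
  by apply: cvg_at_right_filter; exact: cf.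
- by move=> x ax; have [] := dF x (lt_trans ba ax).
- apply: cvg_at_right_filter; apply: differentiable_continuous.
  by apply/derivable1_diffP; have [] := dF a ba.
- move=> x; rewrite in_itv /= andbT => ax; rewrite derive1E.
  by have := dF x (lt_trans ba ax) => -[_].
Qed.

Lemma continuous_inv_sqr (x : R) : 0 < x ->
  {for x, continuous (fun y : R => (y ^+ 2)^-1)}.
Proof.
move=> x0; apply: cvgV; first by rewrite expf_neq0// gt_eqF.
exact: exprn_continuous.
Qed.

Lemma integral_ind_ge (e : R) : 0 < e ->
  (\int[mu]_y (hyp_weight y * ind (e <= y)%R) = (e^-1)%:E)%E.
Proof.
move=> e0.
transitivity (\int[mu]_y (ind (e <= y)%R * ((y ^+ 2)^-1)%:E))%E.
  apply: eq_integral => y _; rewrite /hyp_weight /ind.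
  case: (leP e y) => ey; last by rewrite mule0 mul0e.
  by rewrite (lt_le_trans e0 ey) mul1e mule1.
have dF (x : R) : 0 < x -> is_derive x (1 : R) (fun y : R => - y^-1) ((x ^+ 2)^-1).
  move=> x0; have x1 : x != 0 by rewrite gt_eqF.
  have h : is_derive x (1 : R) (fun y : R => y^-1) (- x ^- 2 *: (1 : R)).
    exact: is_deriveV.
  by have := is_deriveN h; rewrite /GRing.scale /= mulr1 opprK.
have cf (x : R) : 0 < x -> {for x, continuous (fun y : R => (y ^+ 2)^-1)}.
  exact: continuous_inv_sqr.
have f0 (x : R) : e <= x -> 0 <= (x ^+ 2)^-1 by move=> _; rewrite invr_ge0 sqr_ge0.
have Fl : - x^-1 @[x --> +oo] --> (0 : R).
  rewrite -[X in _ --> X]oppr0; apply: cvgN.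
  apply/gtr0_cvgV0; last exact: cvg_id.
  by exists 0; split => // x.
by rewrite (integral_FTCy e0 dF cf f0 Fl) opprK add0r.
Qed.

Lemma integral_sqrt_weight :
  (\int[mu]_y (hyp_weight y * (ind (2^-1 <= y)%R * (Num.sqrt y)%:E)) =
   (2 / Num.sqrt 2^-1)%:E)%E.
Proof.
transitivity (\int[mu]_y (ind (2^-1 <= y)%R * ((y ^+ 2)^-1 * Num.sqrt y)%:E))%E.
  apply: eq_integral => y _; rewrite /hyp_weight /ind.
  case: (leP _ y) => ey; last by rewrite !mul0e mule0.
  by rewrite (lt_le_trans _ ey)// mul1e mul1e EFinM mul1e.
have dF (x : R) : 0 < x -> is_derive x (1 : R)
    (fun y : R => - (2 * (Num.sqrt y)^-1)) ((x ^+ 2)^-1 * Num.sqrt x).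
  move=> x0; have s0 : 0 < Num.sqrt x by rewrite sqrtr_gt0.
  have h1 := is_derive1_sqrt x0.
  have h : is_derive x (1 : R) (fun y : R => (Num.sqrt y)^-1)
     (- (Num.sqrt x) ^- 2 *: (2 * Num.sqrt x)^-1).
    by apply: is_deriveV => //; rewrite gt_eqF.
  have h2 := is_deriveN (is_deriveZ 2 h).
  apply: is_derive_eq; rewrite /GRing.scale /=.
  have xE : Num.sqrt x ^+ 2 = x by rewrite sqr_sqrtr// ltW.
  rewrite -[in RHS]xE sqrtr_sqr gtr0_norm//.
  by field; rewrite gt_eqF.
have cf (x : R) : 0 < x -> {for x, continuous (fun y : R => (y ^+ 2)^-1 * Num.sqrt y)}.
  move=> x0; apply: cvgM; last exact: sqrt_continuous.
  exact: continuous_inv_sqr.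
have f0 (x : R) : 2^-1 <= x -> 0 <= (x ^+ 2)^-1 * Num.sqrt x.
  by move=> _; rewrite mulr_ge0// ?invr_ge0 ?sqr_ge0// sqrtr_ge0.
have Fl : - (2 * (Num.sqrt x)^-1) @[x --> +oo] --> (0 : R).
  rewrite -[X in _ --> X]oppr0; apply: cvgN; rewrite -[X in _ --> X](mulr0 2).
  apply: cvgM; first exact: cvg_cst.
  apply/gtr0_cvgV0; first by exists 0; split => // x x0; rewrite sqrtr_gt0.
  apply/cvgryPge => A; exists (A ^+ 2); split => [|x Ax]; first exact: num_real.
  by rewrite (le_trans (ler_norm A))// -sqrtr_sqr ler_wsqrtr// ltW.
have h0 : 0 < 2^-1 :> R by [].
by rewrite (integral_FTCy h0 dF cf f0 Fl) opprK add0r.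
Qed.

Lemma integral_ind_itv (a b : R) : a <= b ->
  (\int[mu]_x ind (a <= x <= b)%R = (b - a)%:E)%E.
Proof.
move=> ab; transitivity (\int[mu]_x (\1_(`[a, b]%classic : set R) x)%:E)%E.
  by apply: eq_integral => x _; rewrite indicE mem_setE in_itv.
rewrite (@integral_indic _ _ _ mu setT measurableT)// setIT.
change (mu `[a, b]%classic = (b - a)%:E); rewrite lebesgue_measure_itv /= lte_fin.
by move: ab; rewrite le_eqVlt => /predU1P[->|->//]; rewrite ltxx subrr.
Qed.

Lemma integral_ind_unit (k : \bar R) : (0 <= k)%E ->
  (\int[mu]_x (ind (0 <= x < 1)%R * k) = k)%E.
Proof.
move=> k0; transitivity (\int[mu]_x (k * ind (0 <= x < 1)%R))%E.
  by apply: eq_integral => x _; rewrite muleC.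
rewrite ge0_integralZl//; [|by mea|by epos]; rewrite -[RHS]mule1; congr (_ * _)%E.
transitivity (\int[mu]_x (\1_(`[0, 1[%classic : set R) x)%:E)%E.
  by apply: eq_integral => x _; rewrite indicE mem_setE in_itv.
rewrite (@integral_indic _ _ _ mu setT measurableT)// setIT.
change (mu `[0, 1[%classic = 1%E); rewrite lebesgue_measure_itv /= lte_fin ltr01.
by rewrite sube0.
Qed.

End CalculusTools.

(** * Points of the lattice Z z + Z in a disc *)

Section LatticeCount.
Context {R : realType}.
Local Notation mu := (@lebesgue_measure R).
Implicit Types p : R * R.
Local Open Scope ereal_scope.

Lemma tiling (g : R -> \bar R) : measurable_fun setT g -> (forall x, 0 <= g x) ->
  \esum_(n in [set: int]) (\int[mu]_x (ind (0 <= x < 1)%R * g (x + n%:~R)%R)) =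
  \int[mu]_x g x.
Proof.
move=> mg g0; rewrite -(@integral_int_affine R g 1 isT mg g0).
by apply: eq_esum => n _; apply: eq_integral => x _; rewrite mul1r.
Qed.

Lemma tiling2 (g : R -> R -> \bar R) :
  measurable_fun setT (fun p : R * R => g p.1 p.2) -> (forall x y, 0 <= g x y) ->
  \esum_(v in [set: int * int]) (\int[mu]_s \int[mu]_t
    (ind (0 <= s < 1)%R * (ind (0 <= t < 1)%R * g (s + v.1%:~R)%R (t + v.2%:~R)%R))) =
  \int[mu]_s \int[mu]_t g s t.
Proof.
move=> mg g0.
have mg1 x : measurable_fun setT (g x) by exact: (measurable_section1 _ mg).
pose g' (p : R * R) := g p.1 p.2.
have mg' : measurable_fun setT g' by [].
have mG : measurable_fun setT (fun s => \int[mu]_t g s t).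
  exact: measurable_fun_integral.
rewrite -(tiling mG); last by epos.
rewrite -(@esum_pairT R int int (fun v1 v2 => \int[mu]_s \int[mu]_t
    (ind (0 <= s < 1)%R * (ind (0 <= t < 1)%R * g (s + v1%:~R)%R (t + v2%:~R)%R)))); last by epos.
apply: eq_esum => c _; rewrite -integral_esum; last 2 first.
- move=> d; apply: measurable_fun_integral; last by epos.
  change (measurable_fun setT (fun p : R * R => ind (0 <= p.1 < 1)%R *
    (ind (0 <= p.2 < 1)%R * g' ((p.1 + c%:~R)%R, (p.2 + d%:~R)%R)))); by mea.
- by epos.
apply: eq_integral => s _.
rewrite -[X in ind _ * X]tiling; [|exact: mg1|by epos].
rewrite -esumZl; [|by epos|by epos].
apply: eq_esum => d _; rewrite ge0_integralZl//; [|by epos|by epos].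
have mgs := mg1 (s + c%:~R)%R; by mea.
Qed.

Definition kappa : \bar R := \int[mu]_s \int[mu]_t ind (t ^+ 2 + s ^+ 2 <= 1)%R.

Lemma kappa_fin : kappa \is a fin_num.
Proof.
rewrite ge0_fin_numE; last by rewrite /kappa; epos.
apply: (@le_lt_trans _ _ (\int[mu]_s \int[mu]_t
   (ind (-1 <= s <= 1)%R * ind (-1 <= t <= 1)%R))).
  apply: integral_le.
  - by apply: measurable_fun_integral; [mea|epos].
  - by apply: measurable_fun_integral; [mea|epos].
  - by epos.
  move=> s; apply: integral_le; [by mea|by mea|by epos|move=> t].
  rewrite /ind -EFinM lee_fin -natrM mulnb ler_nat.
  case: (leP _ 1%R) => //= h; rewrite lt0b -!ler_norml.
  have := sqr_ge0 t; have := sqr_ge0 s => h1 h2.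
  by rewrite -(@expr_le1 _ 2)// -(@expr_le1 _ 2 `|t|%R)// -!normrX !ger0_norm//; apply/andP; split; lra.
have i2 : \int[mu]_t ind (-1 <= t <= 1)%R = 2%:E :> \bar R.
  by rewrite integral_ind_itv; [congr (_%:E); lra|lra].
rewrite [ltLHS](_ : _ = \int[mu]_s (2%:E * ind (-1 <= s <= 1)%R)); last first.
  apply: eq_integral => s _; rewrite ge0_integralZl; [|by []|by mea|by epos|by epos].
  by rewrite i2 muleC.
by rewrite integralTZl ?i2 ?ltry//; [mea|epos].
Qed.

(** The linear map (s, t) -> s z + t has determinant y up to sign; after scaling by r the region
    becomes the unit disc, one coordinate at a time. *)
Lemma disc_area (r : R) p : (0 < r)%R -> (0 < p.2)%R ->
  \int[mu]_s \int[mu]_t ind (rowQ s t p <= r ^+ 2)%R = (r ^+ 2 / p.2)%:E * kappa.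
Proof.
move=> r0 p0.
have mK (u : R) : measurable_fun setT (fun t : R => @ind R (t ^+ 2 + u ^+ 2 <= 1)%R) by mea.
transitivity (\int[mu]_s (r%:E * (\int[mu]_t ind (t ^+ 2 + (p.2 / r * s + 0) ^+ 2 <= 1)%R))).
  apply: eq_integral => s _.
  transitivity (\int[mu]_t (fun t : R => ind (t ^+ 2 + (p.2 / r * s + 0) ^+ 2 <= 1)%R)
     (r^-1 * t + r^-1 * (s * p.1))%R).
    apply: eq_integral => t _; congr ind; rewrite /rowQ.
    rewrite -[in RHS](ler_pM2r (exprn_gt0 2 r0)) mul1r; congr (_ <= _)%R.
    by field; rewrite gt_eqF.
  rewrite (integral_affine _ _ (mK _)); [|by rewrite invr_eq0 gt_eqF|by epos].
  by rewrite gtr0_norm ?invr_gt0// invrK.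
have mL : measurable_fun setT (fun u : R => \int[mu]_t @ind R (t ^+ 2 + u ^+ 2 <= 1)%R).
  by apply: measurable_fun_integral; [mea|epos].
rewrite integralTZl; last 3 first.
- by apply: (measurable_fun_comp2 (g := fun s : R => (p.2 / r * s + 0)%R) mL); mea.
- by epos.
- exact: ltW.
rewrite (@integral_affine _ (fun u : R => \int[mu]_t ind (t ^+ 2 + u ^+ 2 <= 1)%R) (p.2 / r) 0) //.
- rewrite muleA -EFinM gtr0_norm ?divr_gt0//; congr (_%:E * _).
  by field; rewrite !gt_eqF.
- by rewrite gt_eqF// divr_gt0.
- by epos.
Qed.

(** Triangle inequality in the plane, kept in squared form; the cross term is handled by
    Cauchy-Schwarz. *)
Lemma sqr_norm_add (a b a' b' r d : R) : (0 <= r -> 0 <= d ->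
  a ^+ 2 + b ^+ 2 <= r ^+ 2 -> a' ^+ 2 + b' ^+ 2 <= d ^+ 2 ->
  (a + a') ^+ 2 + (b + b') ^+ 2 <= (r + d) ^+ 2)%R.
Proof.
move=> r0 d0 h1 h2.
suff h : (a * a' + b * b' <= r * d)%R.
  have -> : ((a + a') ^+ 2 + (b + b') ^+ 2 = (a ^+ 2 + b ^+ 2) + (a' ^+ 2 + b' ^+ 2)
     + 2 * (a * a' + b * b'))%R by ring.
  by rewrite sqrrD; lra.
rewrite leNgt; apply/negP => h.
have rd0 : (0 <= r * d)%R by exact: mulr_ge0.
have h3 : ((r * d) ^+ 2 < (a * a' + b * b') ^+ 2)%R by rewrite ltrXn2r// nnegrE// ltW// (le_lt_trans rd0).
have h4 : ((a * a' + b * b') ^+ 2 <= (a ^+ 2 + b ^+ 2) * (a' ^+ 2 + b' ^+ 2))%R.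
  rewrite -subr_ge0 (_ : _ - _ = (a * b' - a' * b) ^+ 2)%R ?sqr_ge0//; ring.
have h5 : ((a ^+ 2 + b ^+ 2) * (a' ^+ 2 + b' ^+ 2) <= r ^+ 2 * d ^+ 2)%R.
  by apply: ler_pM => //; rewrite addr_ge0 ?sqr_ge0.
by move: h3; rewrite exprMn ltNge (le_trans h4).
Qed.

(** A bound for |s z + t| over the unit square of (s, t), that is, for the size of one cell of the
    lattice. *)
Definition cell_diam p : R := (`|p.1| + 1 + p.2)%R.

Lemma rowQ_cell s t p : (0 < p.2 -> 0 <= s < 1 -> 0 <= t < 1 ->
  rowQ s t p <= (cell_diam p) ^+ 2)%R.
Proof.
move=> p0 /andP[s0 s1] /andP[t0 t1]; rewrite /rowQ /cell_diam.
have h1 : (`|s * p.1 + t| <= `|p.1| + 1)%R.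
  rewrite (le_trans (ler_normD _ _))// lerD//; last by rewrite ger0_norm// ltW.
  by rewrite normrM ger0_norm// ler_piMl// ltW.
have h2 : ((s * p.1 + t) ^+ 2 <= (`|p.1| + 1) ^+ 2)%R.
  by rewrite -[leLHS]ger0_norm ?sqr_ge0// normrX lerXn2r// nnegrE// addr_ge0.
have h3 : ((s * p.2) ^+ 2 <= p.2 ^+ 2)%R.
  by rewrite exprMn ler_piMl ?sqr_ge0// expr_le1// ltW.
have h4 : (0 <= (`|p.1| + 1) * p.2)%R by rewrite mulr_ge0 ?addr_ge0// ltW.
by rewrite sqrrD; lra.
Qed.

Lemma vQ_shift (v : int * int) s t p : (0 < p.2 -> 0 <= s < 1 -> 0 <= t < 1 ->
  forall r, 0 <= r ->
  (vQ v p <= r ^+ 2 -> rowQ (s + v.1%:~R) (t + v.2%:~R) p <= (r + cell_diam p) ^+ 2) /\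
  (rowQ (s + v.1%:~R) (t + v.2%:~R) p <= r ^+ 2 -> vQ v p <= (r + cell_diam p) ^+ 2))%R.
Proof.
move=> p0 s01 t01 r r0; have c0 : (0 <= cell_diam p)%R.
  by rewrite /cell_diam !addr_ge0// ltW.
have := rowQ_cell p0 s01 t01; rewrite /vQ /rowQ => h; split => h'.
  have -> : ((s + v.1%:~R) * p.1 + (t + v.2%:~R) = (v.1%:~R * p.1 + v.2%:~R) + (s * p.1 + t))%R by ring.
  have -> : ((s + v.1%:~R) * p.2 = v.1%:~R * p.2 + s * p.2)%R by ring.
  exact: sqr_norm_add.
have -> : (v.1%:~R * p.1 + v.2%:~R = ((s + v.1%:~R) * p.1 + (t + v.2%:~R)) + (- (s * p.1 + t)))%R by ring.
have -> : (v.1%:~R * p.2 = (s + v.1%:~R) * p.2 + - (s * p.2))%R by ring.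
by apply: sqr_norm_add => //; rewrite !sqrrN.
Qed.

Definition latt (r : R) p : \bar R :=
  \esum_(v in [set: int * int]) ind (vQ v p <= r ^+ 2)%R.

(** The unit squares attached to the counted vectors are disjoint and lie inside the region of the
    disc with radius r + [cell_diam p]; areas are compared. *)
Lemma latt_le r p : (0 <= r)%R -> (0 < p.2)%R ->
  latt r p <= ((r + cell_diam p) ^+ 2 / p.2)%:E * kappa.
Proof.
move=> r0 p0; have c0 : (0 < cell_diam p)%R by rewrite /cell_diam ltr_wpDl// addr_ge0.
rewrite -disc_area//; last by rewrite ltr_wpDl.
rewrite -tiling2; [|by rewrite /rowQ; mea|by epos].
apply: le_esumT => v.
rewrite -[leLHS]integral_ind_unit; last by epos.
apply: integral_le; [by mea| |by epos|move=> s].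
  by apply: measurable_fun_integral; [rewrite /rowQ; mea|epos].
rewrite -[X in ind _ * X <= _]integral_ind_unit; last by epos.
rewrite -ge0_integralZl//; [|by mea|by epos|by epos].
apply: integral_le; [by mea|by rewrite /rowQ; mea|by epos|move=> t].
rewrite /ind; case: (boolP (0 <= s < 1)%R) => hs; last by rewrite !mul0e.
case: (boolP (0 <= t < 1)%R) => ht; last by rewrite !mul0e.
rewrite !mul1e lee_fin ler_nat; case: (boolP (vQ _ _ <= _)%R) => // hv.
by have [/(_ hv) -> _] := vQ_shift v p0 hs ht r0.
Qed.

(** Conversely, the squares attached to the counted vectors cover the disc of radius r -
    [cell_diam p]. *)
Lemma latt_ge r p : (cell_diam p < r)%R -> (0 < p.2)%R ->
  ((r - cell_diam p) ^+ 2 / p.2)%:E * kappa <= latt r p.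
Proof.
move=> r0 p0; have rc : (0 < r - cell_diam p)%R by rewrite subr_gt0.
rewrite -disc_area//.
rewrite -tiling2; [|by rewrite /rowQ; mea|by epos].
apply: le_esumT => v.
rewrite -[leRHS]integral_ind_unit; last by epos.
apply: integral_le; [|by mea|by epos|move=> s].
  by apply: measurable_fun_integral; [rewrite /rowQ; mea|epos].
rewrite -[X in _ <= ind _ * X]integral_ind_unit; last by epos.
rewrite -ge0_integralZl//; [|by mea|by epos|by epos].
apply: integral_le; [by rewrite /rowQ; mea|by mea|by epos|move=> t].
rewrite /ind; case: (boolP (0 <= s < 1)%R) => hs; last by rewrite !mul0e.
case: (boolP (0 <= t < 1)%R) => ht; last by rewrite !mul0e.
rewrite !mul1e lee_fin ler_nat; case: (boolP (rowQ _ _ _ <= _)%R) => // hv.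
by have [_ /(_ hv)] := vQ_shift v p0 hs ht (ltW rc); rewrite subrK => ->.
Qed.

End LatticeCount.

(** * Area of the fundamental domain and integrability of the square root of the height *)

Section FundamentalVolume.
Context {R : realType}.
Local Notation mu := (@lebesgue_measure R).
Implicit Types p : R * R.

Lemma fund_y_ge p : fund p -> 2^-1 <= p.2.
Proof.
case/and3P => y0 x2 n1; rewrite leNgt; apply/negP => y2.
have : p.1 ^+ 2 <= 4^-1.
  rewrite -[leLHS]ger0_norm ?sqr_ge0// normrX (_ : 4^-1 = 2^-1 ^+ 2); last by field.
  by rewrite lerXn2r// nnegrE.
have : p.2 ^+ 2 < 4^-1.
  by clear n1; nra.
by lra.
Qed.

(** By the double angle formula, s = sin(pi/6) satisfies s = 1 - 2 s^2, whose only positive root is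
    1/2. *)
Lemma sin_pi6 : sin (pi / 6) = 2^-1 :> R.
Proof.
have p0 := pi_gt0 R.
have h1 : cos (pi / 3) = sin (pi / 6) :> R.
  rewrite (_ : pi / 3 = pi / 2 - pi / 6); last by field.
  by rewrite cosB cos_pihalf sin_pihalf mul0r mul1r add0r.
have h2 : cos (pi / 3) = 1 - 2 * (sin (pi / 6)) ^+ 2 :> R.
  rewrite (_ : pi / 3 = pi / 6 + pi / 6); last by field.
  by rewrite cosD -!expr2 cos2sin2; ring.
have s0 : 0 < sin (pi / 6) :> R by apply: sin_gt0_pi; apply/andP; split; lra.
move: h2; rewrite h1; set s := sin _ in s0 *; move=> h2.
by nra.
Qed.

(** Integrating over y first leaves 1 / sqrt(1 - x^2) on [-1/2, 1/2], with primitive arcsin. *)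
Lemma hyp_fund : hyp (fun p => ind (fund p)) = (pi / 3)%:E :> \bar R.
Proof.
have mw := @measurable_hyp_weight R; have mf := @measurable_fund R.
have -> : hyp (fun p => ind (fund p)) =
    (\int[mu]_x \int[mu]_y (hyp_weight y * ind (fund (x, y))))%E.
  rewrite /hyp /lebesgue2 fubini_tonelli1//; first by mea.
  by epos.
transitivity (\int[mu]_x (ind (- 2^-1 <= x <= 2^-1)%R * ((Num.sqrt (1 - x ^+ 2))^-1)%:E))%E.
  apply: eq_integral => x _; rewrite {2}/ind.
  case: (boolP (- 2^-1 <= x <= 2^-1)) => hx; last first.
    rewrite mul0e integral0_eq// => y _; rewrite /fund /= ler_norml (negbTE hx) andbF.
    by rewrite /ind mule0.
  rewrite mul1e.
  have x1 : x ^+ 2 <= 4^-1.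
    rewrite -[leLHS]ger0_norm ?sqr_ge0// normrX (_ : 4^-1 = 2^-1 ^+ 2); last by field.
    by rewrite lerXn2r// ?nnegrE// ler_norml.
  have s0 : 0 < Num.sqrt (1 - x ^+ 2) by rewrite sqrtr_gt0; lra.
  rewrite -integral_ind_ge//; apply: eq_integral => y _.
  rewrite /hyp_weight /ind; case: (ltP 0 y) => y0; last by rewrite !mul0e.
  congr (_ * _%:R%:E)%E; rewrite /fund /= y0 ler_norml hx /=; congr nat_of_bool.
  rewrite -[y in RHS]gtr0_norm// -sqrtr_sqr ler_sqrt ?sqr_ge0//.
  by rewrite lerBlDl.
transitivity (\int[mu]_(x in `[(- 2^-1)%R, 2^-1%R]) ((Num.sqrt (1 - x ^+ 2))^-1)%:E)%E.
  rewrite [RHS]integral_mkcond; apply: eq_integral => x _.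
  rewrite patchE mem_setE in_itv /= /ind.
  by case: ifPn => _; rewrite ?mul1e ?mul0e.
have sp (x : R) : -1 < x < 1 -> 0 < Num.sqrt (1 - x ^+ 2).
  by move=> /andP[? ?]; rewrite sqrtr_gt0; nra.
have cs (x : R) : -1 < x < 1 -> {for x, continuous (fun x : R => (Num.sqrt (1 - x ^+ 2))^-1)}.
  move=> x1; apply: (@continuous_comp _ _ _ (fun x : R => Num.sqrt (1 - x ^+ 2)) GRing.inv); last first.
    by apply: inv_continuous; rewrite gt_eqF// sp.
  apply: (@continuous_comp _ _ _ (fun x : R => 1 - x ^+ 2) Num.sqrt); last exact: sqrt_continuous.
  by apply: cvgB; [exact: cvg_cst|exact: exprn_continuous].
have lt2 : (- 2^-1 < 2^-1 :> R)%R by lra.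
rewrite (@continuous_FTC2 _ _ (@asin R)) //.
- have a1 : asin 2^-1 = pi / 6 :> R.
    by rewrite -sin_pi6 sinK// in_itv /=; have p0 := pi_gt0 R; apply/andP; split; lra.
  have a2 : asin (- 2^-1) = - (pi / 6) :> R.
    rewrite -sin_pi6 -sinN sinK// in_itv /=; have p0 := pi_gt0 R; apply/andP; split; lra.
  by rewrite a1 a2 -EFinB; congr (_%:E); field.
- apply/continuous_within_itvP => //; split.
  + by move=> x; rewrite in_itv /= => /andP[? ?]; apply: cs; apply/andP; split; lra.
  + by apply: cvg_at_right_filter; apply: cs; apply/andP; split; lra.
  + by apply: cvg_at_left_filter; apply: cs; apply/andP; split; lra.
- split.
  + move=> x; rewrite in_itv /= => /andP[? ?].
    have x1 : -1 < x < 1 by apply/andP; split; lra.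
    by have [] := is_derive1_asin x1.
  + by apply: cvg_at_right_filter; apply: continuous_asin; apply/andP; split; lra.
  + by apply: cvg_at_left_filter; apply: continuous_asin; apply/andP; split; lra.
- move=> x; rewrite in_itv /= => /andP[? ?].
  have x1 : -1 < x < 1 by apply/andP; split; lra.
  by rewrite derive1E; have [_] := is_derive1_asin x1.
Qed.

(** The lattice count errs by a multiple of sqrt(y / e); this makes the error integrable up to the
    cusp. *)
Lemma hyp_fund_sqrt :
  (hyp (fun p => ind (fund p) * (Num.sqrt p.2)%:E) \is a fin_num)%E.
Proof.
have mw := @measurable_hyp_weight R; have mf := @measurable_fund R.
have s0 (x : R) : (0 <= (Num.sqrt x)%:E)%E by rewrite lee_fin sqrtr_ge0.
rewrite ge0_fin_numE; last by epos.
apply: (@le_lt_trans _ _ (hyp (fun p => ind (- 2^-1 <= p.1 <= 2^-1)%R *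
    (ind (2^-1 <= p.2)%R * (Num.sqrt p.2)%:E)))%E).
  apply: le_hyp; [by mea|by mea|by epos|move=> p p0].
  rewrite {1}/ind; case: (boolP (fund p)) => fp; last by rewrite mul0e; epos.
  rewrite /ind fund_y_ge//; case/and3P: fp => _ + _; rewrite ler_norml => ->.
  by rewrite !mul1e.
rewrite hypE; [|by mea|by epos].
rewrite [ltLHS](_ : _ =
   \int[mu]_y (hyp_weight y * (ind (2^-1 <= y)%R * (Num.sqrt y)%:E)))%E.
  by rewrite integral_sqrt_weight ltry.
apply: eq_integral => y _; congr (_ * _)%E.
transitivity (\int[mu]_x ((ind (2^-1 <= y)%R * (Num.sqrt y)%:E) * ind (- 2^-1 <= x <= 2^-1)%R))%E.
  by apply: eq_integral => x _; rewrite /= muleC.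
rewrite ge0_integralZl; [|by []|by mea|by epos|by epos].
rewrite integral_ind_itv; last by lra.
by rewrite (_ : 2^-1 - - 2^-1 = 1 :> R) ?mule1//; field.
Qed.

End FundamentalVolume.

(** * All lattice vectors versus primitive ones *)

Section PrimitiveDecomposition.
Context {R : realType}.
Implicit Types p : R * R.
Local Open Scope ereal_scope.

Lemma esum_ind (I : choiceType) (b : I -> bool) (a : I -> \bar R) :
  \esum_(i in [set: I]) (ind (b i) * a i) = \esum_(i in [set i | b i]) a i.
Proof.
rewrite [RHS]esum_mkcond; apply: eq_esum => i _; rewrite mem_setE /ind.
by rewrite unfold_in /=; case: (b i); rewrite ?mul1e ?mul0e.
Qed.

(** A nonzero vector is its gcd times a primitive vector, in one way; the index n stands for the gcd
    n + 1. *)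
Lemma lattice_primitive (G : int * int -> \bar R) : (forall v, 0 <= G v) ->
  \esum_(v in [set: int * int]) (ind (v != (0, 0)%R) * G v) =
  \esum_(n in [set: nat]) (\esum_(v in [set: int * int])
     (ind (coprimez v.1 v.2) * G (n.+1%:Z * v.1, n.+1%:Z * v.2)%R)).
Proof.
move=> G0; rewrite esum_pairT; last by epos.
rewrite (@esum_ind _ (fun k : nat * (int * int) => coprimez k.2.1 k.2.2)) esum_ind.
apply: reindex_esum; split.
- move=> [n [c d]] /= cop; apply/eqP => -[/eqP + /eqP].
  rewrite !mulf_eq0 /= => /eqP c0 /eqP d0.
  by move: cop; rewrite c0 d0.
- move=> [n [c d]] [n' [c' d']]; rewrite !inE /= => cop cop' [ec ed].
  have gE (k : nat) (a b : int) : coprimez a b -> gcdz (k.+1%:Z * a)%R (k.+1%:Z * b)%R = k.+1%:Z.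
    by move=> /eqP g1; rewrite -mulz_gcdr g1 mulr1.
  have nn : n = n'.
    by have := gE n _ _ cop; rewrite ec ed gE// => -[].
  subst n'; congr (_, (_, _)).
    by move/mulfI: ec; apply.
  by move/mulfI: ed; apply.
- move=> [c d] /= v0.
  have /dvdzP[c' cE] := dvdz_gcdl c d; have /dvdzP[d' dE] := dvdz_gcdr c d.
  have g0 : gcdz c d != 0%R.
    by apply: contraNneq v0 => /eqP; rewrite gcdz_eq0 => /andP[/eqP-> /eqP->].
  have [n gE] : exists n : nat, gcdz c d = n.+1%:Z.
    have : (0 <= gcdz c d)%R by [].
    by case: (gcdz c d) g0 => [[|n]|]// _ _; exists n.
  exists (n, (c', d')); last by rewrite /= -gE mulrC -cE mulrC -dE.
  rewrite /= /coprimez; apply/eqP.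
  have : (gcdz c d * gcdz c' d' = gcdz c d)%R.
    have -> : (gcdz c d * gcdz c' d' = gcdz (gcdz c d * c') (gcdz c d * d'))%R.
      by rewrite -mulz_gcdr gE.
    by rewrite ![(gcdz c d * _)%R]mulrC -cE -dE.
  by rewrite -[RHS]mulr1 => /mulfI; apply.
Qed.

(** The condition says that y / |c z + d|^2 is at least e; for a primitive vector this is the height
    of the image point. *)
Definition Nall (e : R) p : \bar R :=
  \esum_(v in [set: int * int]) (ind (v != (0, 0)%R) * ind (e * vQ v p <= p.2)%R).

Lemma latt_Nall (e : R) p : (0 < e)%R -> (0 < p.2)%R ->
  latt (Num.sqrt (p.2 / e)) p = 1 + Nall e p.
Proof.
move=> e0 p0; rewrite /latt sqr_sqrtr ?divr_ge0 ?ltW//.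
rewrite (esumID [set (0, 0)%R])//; last by epos.
rewrite setTI esum_set1 ?ind_ge0// /ind.
rewrite {1}/vQ /rowQ /= !mul0r addr0 expr0n addr0 divr_ge0 ?ltW//; congr (_ + _).
rewrite /Nall esum_ind setTI; congr esum; last first.
  by apply/funext => v; rewrite /ind ler_pdivlMr// mulrC.
by apply/seteqP; split => v /= /eqP.
Qed.

(** With r = sqrt(y / e) the area term is kappa r^2 / y = kappa / e. Cells have size at most 4 y, so
    the boundary contributes O(r) while y <= r. Higher up in the cusp only vectors with c = 0 are
    counted, and these are O(r) in number. *)
Lemma lattice_count : exists2 C : R, (0 <= C)%R &
  forall (e : R) p, (0 < e <= 1)%R -> fund p ->
    Nall e p <= (fine (@kappa R) / e + C * Num.sqrt (p.2 / e))%:E /\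
    (fine (@kappa R) / e)%:E <= Nall e p + (C * Num.sqrt (p.2 / e))%:E.
Proof.
set K := fine (@kappa R).
have KE : @kappa R = K%:E by rewrite /K fineK// kappa_fin.
have K0 : (0 <= K)%R by rewrite -lee_fin -KE /kappa; epos.
(* (r + 4 y)^2 / y exceeds r^2 / y by 8 r + 16 y, at most 24 r when y <= r; in the cusp at most 2 r
   + 1 <= 4 r vectors are counted, since r >= 1/2. *)
exists (24 * K + 4)%R; first by lra.
move=> e p /andP[e0 e1] fp; have y2 := fund_y_ge fp.
have p0 : (0 < p.2)%R by lra.
set r := Num.sqrt (p.2 / e).
have r2 : (r ^+ 2 = p.2 / e)%R by rewrite sqr_sqrtr// divr_ge0// ltW.
have r0 : (0 <= r)%R by exact: sqrtr_ge0.
have ye : (p.2 <= p.2 / e)%R by apply: ler_peMr; [exact: ltW|rewrite invf_ge1].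
have r1 : (2^-1 <= r)%R.
  rewrite leNgt; apply/negP => h; have : (r ^+ 2 < 2^-1 ^+ 2)%R by rewrite ltrXn2r// ?nnegrE.
  by rewrite r2; lra.
have d1 : (cell_diam p <= 4 * p.2)%R.
  by rewrite /cell_diam; case/and3P: fp => _ + _; lra.
have d0 : (0 < cell_diam p)%R by rewrite /cell_diam ltr_wpDl// addr_ge0.
have Ke : (K / e = K * (r ^+ 2 / p.2))%R by rewrite r2; field; rewrite !gt_eqF.
have NN := latt_Nall e0 p0; rewrite -/r in NN.
have N0 : 0 <= Nall e p by rewrite /Nall; epos.
split; last first.
  have [rd|rd] := leP r (cell_diam p).
    apply: (@le_trans _ _ ((24 * K + 4) * r)%:E); last by rewrite leeDr.
    rewrite lee_fin Ke.
    have h : (r ^+ 2 / p.2 <= 4 * r)%R.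
      by rewrite ler_pdivrMr// expr2 -mulrA mulrCA ler_wpM2l//; lra.
    have : (K * (r ^+ 2 / p.2) <= K * (4 * r))%R by rewrite ler_wpM2l.
    by have := mulr_ge0 K0 r0; lra.
  have := latt_ge rd p0; rewrite NN KE -EFinM => h.
  have h' : (K / e - 8 * K * r)%:E <= 1 + Nall e p.
    apply: le_trans h; rewrite lee_fin Ke.
    have -> : (K * (r ^+ 2 / p.2) - 8 * K * r = (r ^+ 2 - 2 * r * (4 * p.2)) / p.2 * K)%R.
      by field; rewrite gt_eqF.
    rewrite ler_wpM2r// ler_wpM2r ?invr_ge0 ?(ltW p0)//.
    have -> : ((r - cell_diam p) ^+ 2 = r ^+ 2 - 2 * (r * cell_diam p) + cell_diam p ^+ 2)%R by ring.
    have : (r * cell_diam p <= r * (4 * p.2))%R by rewrite ler_wpM2l.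
    by have := sqr_ge0 (cell_diam p); lra.
  move: h'; case: (Nall e p) N0 => [n n0|_ _|//]; last by rewrite leey.
  rewrite -!EFinD !lee_fin => h'.
  by have := mulr_ge0 K0 r0; lra.
(* The condition y e <= 1 is y <= r, since r^2 = y / e. *)
have [yX|yX] := leP (p.2 * e)%R 1%R.
  have yr : (p.2 <= r)%R.
    rewrite leNgt; apply/negP => h; have : (r ^+ 2 < p.2 ^+ 2)%R by rewrite ltrXn2r// ?nnegrE// ltW.
    rewrite r2 ltr_pdivrMr// expr2 -mulrA => h'.
    by have : (p.2 * (p.2 * e) <= p.2 * 1)%R; [rewrite ler_wpM2l// ltW|lra].
  have := latt_le r0 p0; rewrite NN KE -EFinM => h.
  apply: (@le_trans _ _ (1 + Nall e p)); first by rewrite leeDr.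
  apply: (le_trans h); rewrite lee_fin Ke.
  apply: (@le_trans _ _ ((r + 4 * p.2) ^+ 2 / p.2 * K)%R).
    apply: ler_wpM2r => //; apply: ler_wpM2r; first by rewrite invr_ge0 ltW.
    by rewrite lerXn2r ?nnegrE//; lra.
  have -> : ((r + 4 * p.2) ^+ 2 / p.2 * K = K * (r ^+ 2 / p.2) + K * (8 * r + 16 * p.2))%R.
    by field; rewrite gt_eqF.
  have : (K * (8 * r + 16 * p.2) <= K * (24 * r))%R by rewrite ler_wpM2l//; lra.
  by lra.
apply: (@le_trans _ _ (4 * r)%:E); last first.
  rewrite lee_fin; have := mulr_ge0 K0 r0.
  by have : (0 <= K / e)%R; [rewrite divr_ge0// ltW|lra].
(* When y e > 1, a vector with c <> 0 has e |c z + d|^2 >= e y^2 > y. For the vectors (0, d), |d| <=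
   r puts r + d into [0, N[ because N > 2 r. *)
have [N /andP[N1 N2]] : exists N : nat, (2 * r < N%:R <= 2 * r + 1)%R.
  exists (Num.truncn (2 * r)).+1.
  have r20 : (0 <= 2 * r)%R by lra.
  by have /andP[h1 h2] := truncn_itv r20; rewrite h2 -natr1 lerD2r.
apply: (@le_trans _ _ N%:R%:E); last by rewrite lee_fin; lra.
rewrite -(ind_int_count r N) /Nall esum_ind.
apply: (@le_trans _ _ (\esum_(v in [set v : int * int | v.1 == 0%R]) ind (e * vQ v p <= p.2)%R)).
  rewrite -!esum_ind; apply: le_esumT => -[c d] /=.
  have [->|c0] := eqVneq c 0%R.
    by rewrite /ind mul1e; case: (_ != _); rewrite ?mul1e// mul0e lee_fin.
  rewrite [leRHS](_ : _ = 0); last by rewrite /ind mul0e.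
  rewrite [X in _ * X](_ : _ = ind false); [by rewrite /ind mule0|congr ind].
  apply/negbTE; rewrite -ltNge /vQ /rowQ /=.
  have c1 : (1 <= (c%:~R : R) ^+ 2)%R.
    rewrite -rmorphXn /= -[leLHS]/(1%:~R) ler_int.
    by rewrite -gtz0_ge1 exprn_even_gt0.
  apply: (@lt_le_trans _ _ (e * (p.2 ^+ 2))%R).
    by rewrite expr2 mulrA -[ltLHS]mul1r ltr_pM2r// mulrC.
  apply: ler_wpM2l; first exact: ltW.
  rewrite exprMn; apply: ler_wpDl; first exact: sqr_ge0.
  by rewrite ler_peMl ?sqr_ge0.
apply: (@le_esum_inj _ _ _ _ _ _ (fun v : int * int => v.2)); first by epos.
  by move=> [c d] [c' d'] /= /eqP -> /eqP -> ->.
move=> [c d] /= /eqP ->; rewrite /ind lee_fin ler_nat.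
case: (boolP (_ <= p.2)%R) => // h; rewrite lt0b.
have : (`|d%:~R : R| <= r)%R.
  rewrite leNgt; apply/negP => h'; have : (r ^+ 2 < `|d%:~R| ^+ 2)%R by rewrite ltrXn2r// ?nnegrE.
  move: h; rewrite /vQ /rowQ /= !mul0r add0r expr0n addr0 -normrX ger0_norm ?sqr_ge0//.
  by rewrite mulrC -ler_pdivlMr// r2 => h; rewrite ltNge h.
by rewrite ler_norml => /andP[h1 h2]; apply/andP; split; lra.
Qed.

End PrimitiveDecomposition.

(** * Inverting a sum over dilations by a contraction *)

Section Contraction.
Context {R : realType}.

Lemma inv_sqr_telescope (x : R) : 0 < x -> ((x + 1) ^+ 2)^-1 <= x^-1 - (x + 1)^-1.
Proof.
move=> x0; have x1 : 0 < x + 1 by lra.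
rewrite -subr_ge0 (_ : _ - _ = (x * (x + 1) ^+ 2)^-1); last by field; rewrite !gt_eqF.
by rewrite invr_ge0 mulr_ge0 ?sqr_ge0 ?ltW.
Qed.

Lemma sum_inv_sqr (N : nat) : \sum_(i < N) (i.+2%:R ^+ 2)^-1 <= 3 / 4 :> R.
Proof.
case: N => [|N]; first by rewrite big_ord0; lra.
(* The subtracted reciprocal lets the induction telescope; it starts from the equality 1/4 = 3/4 -
   1/2. *)
suff : \sum_(i < N.+1) (i.+2%:R ^+ 2)^-1 <= 3 / 4 - N.+2%:R^-1 :> R.
  by move/le_trans; apply; rewrite gerBl invr_ge0.
elim: N => [|N IH]; first by rewrite big_ord1 /=; lra.
rewrite big_ord_recr /=.
have := @inv_sqr_telescope N.+2%:R (ltr0Sn _ _); rewrite natr1 => h'.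
by rewrite (le_trans (lerD IH h'))// addrA subrK.
Qed.

(* The n = 0 term dominates the rest because the sum of 1/n^2 over n >= 2 is at
   most 3/4, so an eventual bound on D improves by a factor 4/5. *)
Lemma contraction_limit (D : R -> R) (B C : R) : 0 <= B -> 0 <= C ->
  (forall e, 0 < e -> `|D e| <= B) ->
  (forall (N : nat) (e : R), (0 < N)%N -> 0 < e <= 1 ->
    `|\sum_(n < N) (n.+1%:R ^+ 2)^-1 * D (e * n.+1%:R ^+ 2)| <=
      C * Num.sqrt e + B / N%:R) ->
  forall eta : R, 0 < eta -> exists2 e0 : R, 0 < e0 & forall e : R, 0 < e < e0 -> `|D e| <= eta.
Proof.
move=> B0 C0 DB Dsum.
have step (b : R) : 0 < b -> (exists2 e0 : R, 0 < e0 & forall e : R, 0 < e < e0 -> `|D e| <= b) ->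
    exists2 e0 : R, 0 < e0 & forall e : R, 0 < e < e0 -> `|D e| <= 4 / 5 * b.
  move=> b0 [e0 e00 He0].
  (* The constant 40 leaves b/40 for each of the two error terms, and 3/4 + 1/40 + 1/40 = 4/5. *)
  pose N := (Num.Def.archi_bound (40 * B / b)).+1.
  have N0 : 0 < N%:R :> R by rewrite ltr0n.
  have NB : B / N%:R <= b / 40.
    rewrite ler_pdivrMr// mulrC -ler_pdivrMr ?divr_gt0//.
    apply: (@le_trans _ _ (40 * B / b)); first by rewrite le_eqVlt; apply/orP; left; apply/eqP; field; rewrite gt_eqF.
    apply/ltW; apply: lt_le_trans (archi_boundP _) _; last by rewrite /N ler_nat.
    by rewrite divr_ge0 ?mulr_ge0// ltW.
  pose e1 := (b / (40 * (C + 1))) ^+ 2.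
  have C1 : 0 < C + 1 by lra.
  have e10 : 0 < e1 by rewrite exprn_gt0// divr_gt0// mulr_gt0.
  exists (Num.min 1 (Num.min e1 (e0 / N%:R ^+ 2))).
    by rewrite !lt_min ltr01 e10 divr_gt0 ?exprn_gt0.
  move=> e; rewrite !lt_min => /andP[ep /and3P[h1 h2 h3]].
  pose S := \sum_(i < N.-1) (i.+2%:R ^+ 2)^-1 * D (e * i.+2%:R ^+ 2).
  have hs : `|D e + S| <= C * Num.sqrt e + B / N%:R.
    have := Dsum N e isT; rewrite ep (ltW h1) => /(_ isT).
    by rewrite {1}/N big_ord_recl /= expr1n invr1 mul1r mulr1.
  have sq : C * Num.sqrt e <= b / 40.
    have : Num.sqrt e <= b / (40 * (C + 1)).
      rewrite -[leRHS]ger0_norm; last by rewrite divr_ge0 ?mulr_ge0 ?ltW.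
      by rewrite -sqrtr_sqr ler_wsqrtr// ltW.
    move=> h; apply: (@le_trans _ _ ((C + 1) * Num.sqrt e)).
      by rewrite ler_wpM2r ?sqrtr_ge0//; lra.
    rewrite mulrC -ler_pdivlMr//; apply: (le_trans h).
    by rewrite le_eqVlt; apply/orP; left; apply/eqP; field; rewrite gt_eqF.
  have rest : `|S| <= 3 / 4 * b.
    apply: le_trans (ler_norm_sum _ _ _) _.
    apply: (@le_trans _ _ (\sum_(i < N.-1) (i.+2%:R ^+ 2)^-1 * b)).
      apply: ler_sum => i _; rewrite normrM.
      rewrite [X in X * _ <= _]ger0_norm ?invr_ge0 ?sqr_ge0//.
      rewrite ler_wpM2l ?invr_ge0 ?sqr_ge0//; apply: He0.
      rewrite mulr_gt0 ?exprn_gt0//=.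
      move: h3; rewrite ltr_pdivlMr ?exprn_gt0// => h3; apply: le_lt_trans h3.
      rewrite ler_wpM2l ?(ltW ep)// lerXn2r ?nnegrE//.
      by rewrite ler_nat; have := ltn_ord i; rewrite /N /=.
    by rewrite -mulr_suml ler_wpM2r ?sum_inv_sqr// ltW.
  have := ler_normB (D e + S) S; rewrite addrK.
  by move: hs rest sq NB; clear; lra.
have iter (j : nat) : exists2 e0 : R, 0 < e0 & forall e : R, 0 < e < e0 -> `|D e| <= (4 / 5) ^+ j * (B + 1).
  elim: j => [|j [e0 e00 H]].
    exists 1 => // e /andP[e0 _]; rewrite expr0 mul1r (le_trans (DB _ e0))//; lra.
  rewrite exprS -mulrA; apply: step; last by exists e0.
  by rewrite mulr_gt0 ?exprn_gt0//; lra.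
move=> eta eta0.
have : (4 / 5) ^+ j @[j --> \oo] --> (0 : R).
  by apply: cvg_expr; rewrite ger0_norm; lra.
move/cvgrPdist_lt => /(_ (eta / (B + 1))) [|j _ Hj]; first by rewrite divr_gt0//; lra.
have [e0 e00 H] := iter j; exists e0 => // e he; apply: (le_trans (H e he)).
have h45 : 0 <= 4 / 5 :> R by lra.
have B1 : 0 < B + 1 by lra.
have := Hj j (leqnn j); rewrite /= sub0r normrN ger0_norm ?exprn_ge0//.
by rewrite ltr_pdivlMr// => /ltW.
Qed.

End Contraction.

(** * Equidistribution of closed horocycles *)

Section Horocycle.
Context {R : realType}.
Local Notation mu := (@lebesgue_measure R).
Implicit Types p : R * R.
Local Open Scope ereal_scope.

Lemma adde_injr (z x y : \bar R) : z \is a fin_num -> x + z = y + z -> x = y.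
Proof. by move=> zf h; rewrite -(addeK x zf) h addeK. Qed.

Definition automorphic (f : R * R -> R) : Prop :=
  forall (a b c d : int) p, (a * d - b * c = 1)%R -> (0 < p.2)%R ->
    f (imob a b c d p) = f p.

(* Incomplete Eisenstein series, summed over both signs of (c, d). *)
Definition eis (g : R -> \bar R) p : \bar R :=
  \esum_(v in [set: int * int]) (ind (coprimez v.1 v.2) * g (p.2 / vQ v p)%R).

Definition horo (f : R * R -> R) (y : R) : \bar R :=
  \int[mu]_x (ind (0 <= x < 1)%R * (f (x, y))%:E).

Lemma measurable_vQ v : measurable_fun setT (@vQ R v).
Proof. by rewrite /vQ /rowQ; mea. Qed.

Lemma measurable_eis g : measurable_fun setT g -> (forall y, 0 <= g y) ->
  measurable_fun setT (eis g).
Proof.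
move=> mg g0; apply: measurable_fun_esum => [v|]; last by epos.
by have mq := measurable_vQ v; mea.
Qed.

Lemma eis_ge0 g p : (forall y, 0 <= g y) -> 0 <= eis g p.
Proof. by move=> g0; rewrite /eis; epos. Qed.

Section fixed.
Variables (f : R * R -> R) (B : R).
Hypotheses (mf : measurable_fun setT f) (f0 : forall p, (0 <= f p)%R)
  (fB : forall p, (f p <= B)%R) (fA : automorphic f).

Let fE0 p : 0 <= (f p)%:E. Proof. by rewrite lee_fin. Qed.

Let B0 : (0 <= B)%R. Proof. exact: (le_trans (f0 (0%R, 0%R)) (fB (0%R, 0%R))). Qed.

Lemma measurable_horo : measurable_fun setT (horo f).
Proof. by apply: measurable_fun_integral; [mea|epos]. Qed.

Lemma horo_ge0 y : 0 <= horo f y. Proof. by rewrite /horo; epos. Qed.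

Lemma horo_le y : horo f y <= B%:E.
Proof.
rewrite /horo -[leRHS]integral_ind_unit ?lee_fin//; apply: integral_le; [by mea|by mea|by epos|].
by move=> x; apply: lee_wpmul2l; [epos|rewrite lee_fin].
Qed.

Lemma horo_fin y : horo f y = (fine (horo f y))%:E.
Proof.
by rewrite fineK// ge0_fin_numE ?horo_ge0// (le_lt_trans (horo_le y))// ltry.
Qed.

(** By automorphy f may be evaluated at [vmob v p], so each summand depends on that point alone, and
    periodically. Unfolding leaves the strip, where the integral over x is [horo]. *)
Lemma unfold_eis (g : R -> \bar R) : measurable_fun setT g -> (forall y, 0 <= g y) ->
  hyp (fun p => ind (fund p) * ((f p)%:E * eis g p)) =
  2%:E * \int[mu]_y (hyp_weight y * (g y * horo f y)).
Proof.
move=> mg g0; have mF := @measurable_fund R.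
pose h p := ind (0 < p.2)%R * ((f p)%:E * g p.2).
have mh : measurable_fun setT h by rewrite /h; mea.
have h0 p : 0 <= h p by rewrite /h; epos.
have hper p (n : int) : h (p.1 + n%:~R, p.2)%R = h p.
  rewrite /h /=; rewrite /ind; case: ltP => p0; last by rewrite !mul0e.
  congr (_ * (_%:E * _)); rewrite -[RHS](@fA 1%R n 0%R 1%R p); [|by ring|by []].
  congr (f _); rewrite /imob /mob /rowQ /=; by congr (_, _); field.
transitivity (\esum_(v in [set: int * int])
     (ind (coprimez v.1 v.2) * hyp (fun p => ind (fund p) * h (vmob v p)))).
  have mt (v : int * int) : measurable_fun setT (fun p : R * R =>
      ind (fund p) * ((f p)%:E * (ind (coprimez v.1 v.2) * g (p.2 / vQ v p)%R))).
    by have mq := measurable_vQ v; mea.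
  transitivity (hyp (fun p => \esum_(v in [set: int * int])
      (ind (fund p) * ((f p)%:E * (ind (coprimez v.1 v.2) * g (p.2 / vQ v p)%R))))).
    apply: eq_hyp => p p0; rewrite esumZl; [|by epos|by epos].
    by rewrite esumZl; [|by epos|by epos].
  rewrite (hyp_esum mt); last by epos.
  apply: eq_esum => v _; rewrite -hypZl; last 3 first.
  - by have mv := @measurable_imob R (topa v) (topb v) v.1 v.2; rewrite /vmob; mea.
  - by epos.
  - by epos.
  apply: eq_hyp => p p0; rewrite /ind; case: (boolP (coprimez _ _)) => cop; last first.
    by rewrite !mul0e !mule0.
  rewrite !mul1e; congr (_ * _); rewrite /h /ind vmob_im_gt0// mul1e.
  by rewrite {1}/vmob fA// ; exact: toprow_det.
rewrite (unfolding mh h0 hper); congr (_ * _).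
rewrite hypE; [|by mea|by epos].
apply: eq_integral => y _; rewrite /hyp_weight {1 3}/ind.
case: (ltP 0%R y) => y0; last by rewrite !mul0e.
congr (_ * _); rewrite /horo -ge0_integralZl; [|by []|by mea|by epos|by epos].
by apply: eq_integral => x _; rewrite /h /= {2}/ind y0 mul1e [(f _)%:E * _]muleC muleCA.
Qed.

Definition tail_mass (e : R) : \bar R :=
  \int[mu]_y (hyp_weight y * (ind (e <= y)%R * horo f y)).

Lemma tail_mass_le e : (0 < e)%R -> tail_mass e <= (B / e)%:E.
Proof.
move=> e0; have mw := @measurable_hyp_weight R; have mh := measurable_horo.
have hw0 := horo_ge0; have hwB := horo_le.
rewrite EFinM -integral_ind_ge// -integralTZl; [|by mea|by epos|exact: B0].
apply: integral_le; [by mea|by mea|by epos|move=> y].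
by rewrite muleA [leRHS]muleC; apply: lee_wpmul2l; [epos|exact: hwB].
Qed.

(** Multiplying a primitive vector by n + 1 divides y / |c z + d|^2 by (n + 1)^2. The primitive
    counts with thresholds e (n + 1)^2 thus add up to the count of all nonzero vectors. *)
Lemma tail_mass_sum e : (0 < e)%R ->
  \esum_(n in [set: nat]) (2%:E * tail_mass (e * n.+1%:R ^+ 2)%R) =
  hyp (fun p => ind (fund p) * ((f p)%:E * Nall e p)).
Proof.
move=> e0; have mF := @measurable_fund R.
have mg (a : R) : measurable_fun setT (fun y : R => @ind R (a <= y)%R) by mea.
have me (n : nat) : measurable_fun setT (fun p : R * R => ind (fund p) *
    ((f p)%:E * eis (fun y => ind (e * n.+1%:R ^+ 2 <= y)%R) p)).
  have mE : measurable_fun setT (eis (fun y => ind (e * n.+1%:R ^+ 2 <= y)%R)).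
    by apply: measurable_eis => // y; exact: ind_ge0.
  by mea.
have e00 n p : 0 <= eis (fun y => ind (e * n.+1%:R ^+ 2 <= y)%R) p.
  by apply: eis_ge0 => y; exact: ind_ge0.
transitivity (\esum_(n in [set: nat]) hyp (fun p => ind (fund p) *
    ((f p)%:E * eis (fun y => ind (e * n.+1%:R ^+ 2 <= y)%R) p))).
  by apply: eq_esum => n _; rewrite unfold_eis//; epos.
rewrite -(hyp_esum me); last by move=> n p; apply: mule_ge0; [epos|apply: mule_ge0; [epos|exact: e00]].
apply: eq_hyp => p p0; rewrite esumZl; [|by epos|by move=> n; apply: mule_ge0; [epos|exact: e00]].
rewrite esumZl; [|by epos|by move=> n; exact: e00].
congr (_ * (_ * _)); rewrite /Nall lattice_primitive; last by epos.
apply: eq_esum => n _; apply: eq_esum => v _; rewrite /ind.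
case: (boolP (coprimez _ _)) => cop; last by rewrite !mul0e.
congr (_ * _%:R%:E); congr nat_of_bool.
rewrite ler_pdivlMr ?vQ_gt0 ?coprime_neq0//; congr (_ <= _)%R.
by rewrite /vQ /rowQ /= !intrM /= -pmulrn; ring.
Qed.

Definition mass : \bar R := hyp (fun p => ind (fund p) * (f p)%:E).

Lemma mass_fin : mass = (fine mass)%:E /\ (0 <= fine mass)%R.
Proof.
have mF := @measurable_fund R.
have m0 : 0 <= mass by rewrite /mass; epos.
have mE : mass \is a fin_num.
  rewrite ge0_fin_numE//; apply: (@le_lt_trans _ _ (B%:E * (pi / 3)%:E)); last first.
    by rewrite -EFinM ltry.
  rewrite -hyp_fund -hypZl; [|by mea|by epos|by rewrite lee_fin].
  apply: le_hyp; [by mea|by mea|by epos|move=> p p0].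
  by rewrite muleC; apply: lee_wpmul2r; [epos|rewrite lee_fin].
by rewrite fineK//; split => //; exact: fine_ge0.
Qed.

Lemma Nall_mass : exists2 C : R, (0 <= C)%R & forall e, (0 < e <= 1)%R ->
  hyp (fun p => ind (fund p) * ((f p)%:E * Nall e p)) <=
    (fine (@kappa R) / e * fine mass + C * Num.sqrt e^-1)%:E /\
  (fine (@kappa R) / e * fine mass)%:E <=
    hyp (fun p => ind (fund p) * ((f p)%:E * Nall e p)) + (C * Num.sqrt e^-1)%:E.
Proof.
have [C C0 HC] := @lattice_count R; have mF := @measurable_fund R.
set J := hyp (fun p : R * R => ind (fund p) * (Num.sqrt p.2)%:E).
have JE : J = (fine J)%:E by rewrite fineK// hyp_fund_sqrt.
have s0 (x : R) : 0 <= (Num.sqrt x)%:E by rewrite lee_fin sqrtr_ge0.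
have J0 : (0 <= fine J)%R by rewrite fine_ge0// /J; epos.
have [mE m0] := mass_fin.
set K := fine (@kappa R) in HC *.
have K0 : (0 <= K)%R by rewrite /K fine_ge0// /kappa; epos.
exists (C * B * fine J)%R; first by rewrite !mulr_ge0.
move=> e /andP[e0 e1].
have N0 p : 0 <= Nall e p by rewrite /Nall; epos.
have mN : measurable_fun setT (Nall e).
  apply: measurable_fun_esum => [v|]; last by epos.
  by have mq := measurable_vQ v; mea.
have X0 : (0 <= C * B * Num.sqrt e^-1)%R by rewrite !mulr_ge0 ?sqrtr_ge0.
have Ke0 : (0 <= K / e)%R by rewrite divr_ge0// ltW.
have errE : (C * B * fine J * Num.sqrt e^-1)%:E =
   hyp (fun p : R * R => (C * B * Num.sqrt e^-1)%:E * (ind (fund p) * (Num.sqrt p.2)%:E)).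
  rewrite hypZl; [|by mea|by epos|by rewrite lee_fin].
  by rewrite -/J JE -EFinM; congr (_%:E); ring.
have mainE : (K / e * fine mass)%:E =
   hyp (fun p : R * R => (K / e)%:E * (ind (fund p) * (f p)%:E)).
  by rewrite hypZl; [rewrite -/mass [in RHS]mE EFinM|by mea|by epos|by rewrite lee_fin].
have sq p : (0 < p.2)%R -> (f p * (C * Num.sqrt (p.2 / e)) <= C * B * Num.sqrt e^-1 * Num.sqrt p.2)%R.
  move=> p0; rewrite sqrtrM ?(ltW p0)//.
  rewrite (_ : C * B * _ * _ = B * (C * (Num.sqrt p.2 * Num.sqrt e^-1)))%R; last by ring.
  by apply: ler_wpM2r => //; rewrite !mulr_ge0 ?sqrtr_ge0.
have c0 : 0 <= (C * B * Num.sqrt e^-1)%:E by rewrite lee_fin.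
have k0 : 0 <= (K / e)%:E by rewrite lee_fin.
rewrite EFinD mainE errE; split.
  rewrite -hypD; [|by mea|by epos|by mea|by epos].
  apply: le_hyp; [by mea|by mea|by epos|move=> p p0].
  rewrite /ind; case: (boolP (fund p)) => fp; last by rewrite !mul0e !mule0 adde0.
  have [h _] := HC e p (introT andP (conj e0 e1)) fp; rewrite !mul1e.
  apply: le_trans (lee_wpmul2l (fE0 p) h) _; rewrite -!EFinM -EFinD lee_fin mulrDr.
  by rewrite lerD ?sq// mulrC.
rewrite -hypD; [|by mea|by epos|by mea|by epos].
apply: le_hyp; [by mea|by mea|by epos|move=> p p0].
rewrite /ind; case: (boolP (fund p)) => fp; last by rewrite !mul0e !mule0 adde0.
have [_ h] := HC e p (introT andP (conj e0 e1)) fp; rewrite !mul1e.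
rewrite muleC; apply: le_trans (lee_wpmul2l (fE0 p) h) _.
rewrite ge0_muleDr//; last by rewrite lee_fin mulr_ge0// sqrtr_ge0.
by apply: leeD => //; rewrite -!EFinM lee_fin sq.
Qed.

Lemma tail_inv_sqr (N : nat) : (0 < N)%N ->
  \sum_(N <= n <oo) ((n.+1%:R ^+ 2)^-1 : R)%:E <= (N%:R^-1)%:E.
Proof.
move=> N0; apply: lime_le.
  by apply: is_cvg_nneseries => n _ _; rewrite lee_fin invr_ge0 sqr_ge0.
apply: nearW => k; rewrite sumEFin lee_fin.
have [kN|Nk] := leqP k N; first by rewrite big_geq// invr_ge0.
suff : (\sum_(N <= n < k) (n.+1%:R ^+ 2)^-1 <= N%:R^-1 - k%:R^-1 :> R)%R.
  by move/le_trans; apply; rewrite gerBl invr_ge0.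
have [d ->] : exists d, k = (N + d)%N by exists (k - N)%N; rewrite subnKC// ltnW.
elim: d => [|d IH]; first by rewrite addn0 big_geq// subrr.
rewrite addnS big_nat_recr ?leq_addr//=.
have x0 : (0 < (N + d)%:R :> R)%R by rewrite ltr0n addn_gt0 N0.
have h := inv_sqr_telescope x0.
by rewrite -natr1; apply: (le_trans (lerD IH h)); rewrite addrA subrK.
Qed.

(** The factor e normalizes the tail of the constant function 1 to 1 at every height e > 0. *)
Definition scaled_tail (e : R) : R := (e * fine (tail_mass e))%R.

Lemma tail_mass_fin e : (0 < e)%R ->
  tail_mass e = (fine (tail_mass e))%:E /\ (0 <= fine (tail_mass e))%R.
Proof.
move=> e0; have h0 := horo_ge0.
have t0 : 0 <= tail_mass e by rewrite /tail_mass; epos.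
split; last exact: fine_ge0.
by rewrite fineK// ge0_fin_numE// (le_lt_trans (tail_mass_le e0))// ltry.
Qed.

(** The identity for all vectors is multiplied by e / 2 and cut after N terms. The omitted terms are
    nonnegative, and at most B times the sum of 1/n^2 over n > N, hence at most B / N. The factor e
    turns the lattice error sqrt(1 / e) into sqrt(e). *)
Lemma scaled_tail_sum : exists2 C : R, (0 <= C)%R & forall (N : nat) e, (0 < N)%N ->
  (0 < e <= 1)%R ->
  (\sum_(n < N) (n.+1%:R ^+ 2)^-1 * scaled_tail (e * n.+1%:R ^+ 2) <=
     fine (@kappa R) / 2 * fine mass + C * Num.sqrt e)%R /\
  (fine (@kappa R) / 2 * fine mass <=
     \sum_(n < N) (n.+1%:R ^+ 2)^-1 * scaled_tail (e * n.+1%:R ^+ 2) + B / N%:R + C * Num.sqrt e)%R.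
Proof.
have [C C0 HC] := Nall_mass; exists (C / 2)%R; first by lra.
move=> N e N0 e01; have /andP[e0 e1] := e01; have [h1 h2] := HC e e01.
set K := fine (@kappa R) in h1 h2 *; set M := fine mass in h1 h2 *.
have en (n : nat) : (0 < e * n.+1%:R ^+ 2)%R by rewrite mulr_gt0// exprn_gt0.
have t0 n : 0 <= 2%:E * tail_mass (e * n.+1%:R ^+ 2)%R.
  by have [-> ?] := tail_mass_fin (en n); rewrite -EFinM lee_fin mulr_ge0.
rewrite -tail_mass_sum// -nneseries_esumT// (@nneseries_split _ _ 0%N N)// add0n in h1 h2.
have finE : \sum_(0 <= k < N) (2%:E * tail_mass (e * k.+1%:R ^+ 2)%R) =
   (2 / e * \sum_(n < N) (n.+1%:R ^+ 2)^-1 * scaled_tail (e * n.+1%:R ^+ 2))%:E.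
  rewrite big_mkord mulr_sumr -sumEFin; apply: eq_bigr => n _.
  rewrite /scaled_tail; have [tE _] := tail_mass_fin (en n).
  rewrite {1}tE -EFinM; congr (_%:E).
  have n0 : (n.+1%:R != 0 :> R)%R by [].
  by move: (fine (tail_mass (e * n.+1%:R ^+ 2)%R)) (n.+1%:R : R) n0 => t w w0; field; rewrite w0 gt_eqF.
rewrite finE in h1 h2.
set S := (\sum_(n < N) _)%R in h1 h2 finE *.
set T := \sum_(N <= k <oo) _ in h1 h2.
have T0 : 0 <= T by apply: nneseries_ge0 => n _ _; exact: t0.
have TB : T <= (2 * B / (e * N%:R))%:E.
  apply: (@le_trans _ _ (\sum_(N <= k <oo) ((2 * B / e)%:E * ((k.+1%:R ^+ 2)^-1)%:E))).
    apply: lee_nneseries => // n _.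
    apply: (@le_trans _ _ (2%:E * (B / (e * n.+1%:R ^+ 2))%:E)).
      by rewrite lee_wpmul2l// ?lee_fin// tail_mass_le.
    rewrite -!EFinM lee_fin le_eqVlt; apply/orP; left; apply/eqP.
    have n0 : (n.+1%:R != 0 :> R)%R by [].
    by move: (n.+1%:R : R) n0 => w w0; field; rewrite w0 gt_eqF.
  rewrite nneseriesZl; last by move=> n _; rewrite lee_fin invr_ge0 sqr_ge0.
  apply: (@le_trans _ _ ((2 * B / e)%:E * (N%:R^-1)%:E)).
    by apply: lee_wpmul2l; [rewrite lee_fin divr_ge0 ?mulr_ge0 ?(ltW e0)|exact: tail_inv_sqr].
  by rewrite -EFinM lee_fin invfM mulrA.
have se : (e * Num.sqrt e^-1 = Num.sqrt e)%R.
  have h := sqr_sqrtr (ltW e0); have s0 : (0 < Num.sqrt e)%R by rewrite sqrtr_gt0.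
  by rewrite sqrtrV ?ltW// -{1}h expr2 -mulrA divff ?mulr1// gt_eqF.
have e2 : (0 < e / 2)%R by rewrite divr_gt0.
split.
  have : ((2 / e * S)%:E <= (K / e * M + C * Num.sqrt e^-1)%:E).
    by apply: le_trans h1; rewrite leeDl.
  rewrite lee_fin -(ler_pM2l e2) => h.
  have -> : S = (e / 2 * (2 / e * S))%R by field; rewrite gt_eqF.
  apply: (le_trans h); rewrite -se le_eqVlt; apply/orP; left; apply/eqP.
  by field; rewrite gt_eqF.
have : ((K / e * M)%:E <= (2 / e * S + 2 * B / (e * N%:R) + C * Num.sqrt e^-1)%:E).
  by apply: (le_trans h2); rewrite !EFinD leeD2r// leeD2l.
rewrite lee_fin -(ler_pM2l e2) => h.
have Nn0 : (N%:R != 0 :> R)%R by rewrite pnatr_eq0 -lt0n.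
have -> : (K / 2 * M = e / 2 * (K / e * M))%R by field; rewrite gt_eqF.
apply: (le_trans h); rewrite -se le_eqVlt; apply/orP; left; apply/eqP.
by field; rewrite Nn0 gt_eqF.
Qed.

End fixed.

Lemma tail_mass1 e : (0 < e)%R -> tail_mass (fun=> 1%R) e = (e^-1)%:E.
Proof.
move=> e0; rewrite -integral_ind_ge//; apply: eq_integral => y _; congr (_ * _).
by rewrite /horo integral_ind_unit ?lee_fin// mule1.
Qed.

Section equidistribution.
Variables (f : R * R -> R) (B : R).
Hypotheses (mf : measurable_fun setT f) (f0 : forall p, (0 <= f p)%R)
  (fB : forall p, (f p <= B)%R) (fA : automorphic f).

Let B0 : (0 <= B)%R. Proof. exact: (le_trans (f0 (0%R, 0%R)) (fB (0%R, 0%R))). Qed.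

Definition average : R := (3 / pi * fine (mass f))%R.

Lemma average_bounds : (0 <= average <= B)%R.
Proof.
have [mE m0] := mass_fin mf f0 fB; have p0 := pi_gt0 R.
have mF := @measurable_fund R.
rewrite /average; apply/andP; split; first by rewrite mulr_ge0// divr_ge0// ltW.
suff : (fine (mass f) <= B * (pi / 3))%R.
  move=> h; rewrite mulrAC ler_pdivrMr// mulrC; lra.
have fE0 p : 0 <= (f p)%:E by rewrite lee_fin.
rewrite -lee_fin -mE EFinM -hyp_fund -hypZl; [|by mea|by epos|by rewrite lee_fin].
apply: le_hyp; [by mea|by mea|by epos|move=> p p0'].
by rewrite muleC; apply: lee_wpmul2r; [epos|rewrite lee_fin].
Qed.

(** The sums for f and for the constant function 1 tend to the same unknown constant up to the
    factor [average]. Subtracting [average] times the second from the first leaves the deviation of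
    [scaled_tail f] from [average], with errors only, in the form required by
    [contraction_limit]. *)
Lemma scaled_tail_limit (eta : R) : (0 < eta)%R ->
  exists2 e0 : R, (0 < e0)%R & forall e : R, (0 < e < e0)%R ->
    (`|scaled_tail f e - average| <= eta)%R.
Proof.
have [C C0 HC] := scaled_tail_sum mf f0 fB fA.
have [C1 C10 HC1] : exists2 C : R, (0 <= C)%R & forall (N : nat) e, (0 < N)%N ->
  (0 < e <= 1)%R ->
  (\sum_(n < N) (n.+1%:R ^+ 2)^-1 <= fine (@kappa R) / 2 * (pi / 3) + C * Num.sqrt e)%R /\
  (fine (@kappa R) / 2 * (pi / 3) <=
     \sum_(n < N) (n.+1%:R ^+ 2)^-1 + 1 / N%:R + C * Num.sqrt e)%R.
  have [||||C1 C10 HC1] := @scaled_tail_sum (fun=> 1%R) 1%R.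
  - exact: measurable_cst.
  - by move=> *; exact: ler01.
  - by move=> *; exact: lexx.
  - by [].
  exists C1 => // N e N0 e01; have := HC1 N e N0 e01.
  have -> : mass (fun=> 1%R) = (pi / 3)%:E.
    by rewrite /mass -hyp_fund; apply: eq_hyp => p _; rewrite mule1.
  rewrite /=; have /andP[e0 e1] := e01.
  rewrite (_ : (\sum_(n < N) _ * _ = \sum_(n < N) (n.+1%:R ^+ 2)^-1)%R)//.
  apply: eq_bigr => n _; rewrite /scaled_tail tail_mass1 ?mulr_gt0 ?exprn_gt0//=.
  by rewrite divff ?mulr1// gt_eqF// mulr_gt0// exprn_gt0.
have /andP[a0 aB] := average_bounds; have p0 := pi_gt0 R.
have KM : (fine (@kappa R) / 2 * fine (mass f) = average * (fine (@kappa R) / 2 * (pi / 3)))%R.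
  rewrite /average; move: (fine (@kappa R)) (fine (mass f)) (@pi R) p0 => K M P P0.
  by field; rewrite gt_eqF.
apply: (@contraction_limit _ (fun e => scaled_tail f e - average)%R B (C + B * C1)%R) => //.
- by rewrite addr_ge0// mulr_ge0.
- move=> e e0; have [tE t0] := tail_mass_fin mf f0 fB e0.
  have s0 : (0 <= scaled_tail f e)%R by rewrite mulr_ge0// ltW.
  have sB : (scaled_tail f e <= B)%R.
    rewrite /scaled_tail mulrC -ler_pdivlMr// -lee_fin -tE.
    exact: (tail_mass_le mf f0 fB).
  by rewrite ler_norml; apply/andP; split; lra.
move=> N e N0 e01; have [u1 u2] := HC N e N0 e01; have [v1 v2] := HC1 N e N0 e01.
rewrite (eq_bigr (fun n : 'I_N => (n.+1%:R ^+ 2)^-1 * scaled_tail f (e * n.+1%:R ^+ 2)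
   - average * (n.+1%:R ^+ 2)^-1))%R; last by move=> n _; rewrite mulrBr [(average * _)%R]mulrC.
rewrite sumrB -mulr_sumr.
set S := (\sum_(n < N) _ * scaled_tail _ _)%R in u1 u2 *; set Z := (\sum_(n < N) _)%R in v1 v2 *.
rewrite KM in u1 u2; set W := (fine _ / 2 * (pi / 3))%R in u1 u2 v1 v2.
set q := Num.sqrt e in u1 u2 v1 v2 *; have q0 : (0 <= q)%R by exact: sqrtr_ge0.
have Ni : (0 <= N%:R^-1 :> R)%R by rewrite invr_ge0.
(* Z >= W up to the tail, and Z <= W up to C1 q *)
have w1 : (average * Z <= average * W + B * (C1 * q))%R.
  apply: (@le_trans _ _ (average * (W + C1 * q))%R); first by rewrite ler_wpM2l.
  by rewrite mulrDr lerD2l ler_wpM2r// mulr_ge0.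
have w2 : (average * W <= average * Z + B / N%:R + B * (C1 * q))%R.
  apply: (@le_trans _ _ (average * (Z + 1 / N%:R + C1 * q))%R); first by rewrite ler_wpM2l.
  rewrite !mulrDr -!addrA lerD2l; apply: lerD.
    by rewrite mul1r ler_wpM2r.
  by rewrite ler_wpM2r// mulr_ge0.
have e3 : (B * (C1 * q) = B * C1 * q)%R by rewrite mulrA.
rewrite ler_norml; apply/andP; split; rewrite mulrDl -e3; lra.
Qed.

Hypothesis f_slow : forall e : R, (0 < e)%R -> exists2 d : R, (0 < d)%R &
  forall x y y' : R, (0 < y -> y <= y' -> y' <= (1 + d) * y -> `|f (x, y') - f (x, y)| <= e)%R.

Lemma horo_slow (e : R) : (0 < e)%R -> exists2 d : R, (0 < d)%R &
  forall y y' : R, (0 < y -> y <= y' -> y' <= (1 + d) * y ->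
    `|fine (horo f y') - fine (horo f y)| <= e)%R.
Proof.
move=> e0; have [d d0 H] := f_slow e0; exists d => // y y' y0 yy' y'd.
have fE0 p : 0 <= (f p)%:E by rewrite lee_fin.
have key (u u' : R) : (forall x, `|f (x, u') - f (x, u)| <= e)%R ->
    (fine (horo f u') <= fine (horo f u) + e)%R.
  move=> h; rewrite -lee_fin EFinD -!(horo_fin mf f0 fB).
  have ee : 0 <= e%:E by rewrite lee_fin ltW.
  rewrite /horo -[X in _ + X]integral_ind_unit; last by [].
  rewrite -ge0_integralD; [|by []|by epos|by mea|by epos|by mea].
  apply: integral_le; [by mea|by apply: emeasurable_funD; mea|by epos|move=> x].
  rewrite -ge0_muleDr//; apply: lee_wpmul2l; first by epos.
  by rewrite -EFinD lee_fin; have := h x; rewrite ler_norml => /andP[]; lra.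
have h1 := key y y' (fun x => H x y y' y0 yy' y'd).
have h2 : (fine (horo f y) <= fine (horo f y') + e)%R.
  by apply: key => x; rewrite distrC; exact: H.
by rewrite ler_norml; apply/andP; split; lra.
Qed.

(** The mass between the heights y and y' = (1 + d) y is a difference of two tails, and by slow
    variation it is horo(y) (1/y - 1/y') up to a small relative error. Since y (1/y - 1/y') = d / (1
    + d) is a fixed number, the limit of the tails passes to [horo]. *)
Theorem horocycle_equidistribution (eta : R) : (0 < eta)%R ->
  exists2 y0 : R, (0 < y0)%R & forall y : R, (0 < y < y0)%R ->
    (`|fine (horo f y) - average| <= eta)%R.
Proof.
move=> eta0; have eta2 : (0 < eta / 2)%R by rewrite divr_gt0.
have [d d0 Hd] := horo_slow eta2.
(* The two tails cost at most 2 z = (eta / 2) d / (1 + d), and slow variation costs the other half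
   of eta d / (1 + d). *)
pose z := (eta / 4 * (d / (1 + d)))%R.
have d1 : (0 < 1 + d)%R by lra.
have z0 : (0 < z)%R by rewrite !mulr_gt0 ?invr_gt0.
have [e0 e00 He0] := scaled_tail_limit z0.
exists (e0 / (1 + d))%R; first by rewrite divr_gt0.
move=> y /andP[yp ye]; set y' := ((1 + d) * y)%R.
have yy' : (y < y')%R by rewrite /y' ltr_pMl//; lra.
have y'p : (0 < y')%R by exact: lt_trans yy'.
have y'e : (y' < e0)%R by rewrite /y' mulrC -ltr_pdivlMr.
have t1 := He0 y (introT andP (conj yp (lt_trans yy' y'e))).
have t2 := He0 y' (introT andP (conj y'p y'e)).
set h := fine (horo f y).
have hE := horo_fin mf f0 fB; have h0 := horo_ge0 f0; have mh := measurable_horo mf f0.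
have mw := @measurable_hyp_weight R.
have hh : (0 <= h)%R by exact: fine_ge0.
(* The mass between heights y and y' is h times 1/y - 1/y', up to eta/2. *)
pose mid := \int[mu]_t (hyp_weight t * (ind (y <= t < y')%R * horo f t)).
have midE : tail_mass f y = mid + tail_mass f y'.
  rewrite /mid /tail_mass -ge0_integralD; [|by []|by epos|by mea|by epos|by mea].
  apply: eq_integral => t _; rewrite -ge0_muleDr; [|by epos|by epos].
  rewrite -ge0_muleDl; [|by epos|by epos]; congr (_ * (_ * _)).
  rewrite /ind -EFinD; congr (_%:E).
  have [h1|h1] := leP y t; have [h2|h2] := ltP t y' => /=; rewrite ?add0r ?addr0//; lra.
have wE : \int[mu]_t (hyp_weight t * ind (y <= t < y')%R) = (y^-1 - y'^-1)%:E.
  apply: (@adde_injr (y'^-1)%:E) => //; rewrite -EFinD subrK.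
  rewrite -(integral_ind_ge yp) -(integral_ind_ge y'p).
  rewrite -ge0_integralD; [|by []|by epos|by mea|by epos|by mea].
  apply: eq_integral => t _; rewrite -ge0_muleDr; [|by epos|by epos]; congr (_ * _).
  rewrite /ind -EFinD; congr (_%:E).
  have [h1|h1] := leP y t; have [h2|h2] := ltP t y' => /=; rewrite ?add0r ?addr0//; lra.
have w0 : (0 <= y^-1 - y'^-1)%R by rewrite subr_ge0 lef_pV2 ?posrE// ltW.
have slow t : (y <= t < y')%R -> (`|fine (horo f t) - h| <= eta / 2)%R.
  by move=> /andP[yt ty']; apply: Hd => //; exact: ltW.
have mid_le : mid <= ((h + eta / 2) * (y^-1 - y'^-1))%:E.
  rewrite EFinM -wE -integralTZl; [|by mea|by epos|by lra].
  apply: integral_le; [by mea|by mea|by epos|move=> t].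
  rewrite [leRHS]muleC -[leRHS]muleA; apply: lee_wpmul2l; first by epos.
  rewrite /ind; case: (boolP (y <= t < y')%R) => ht; last by rewrite !mul0e.
  by rewrite !mul1e hE lee_fin; have := slow t ht; rewrite ler_norml; lra.
have mid_ge : (h * (y^-1 - y'^-1))%:E <= mid + (eta / 2 * (y^-1 - y'^-1))%:E.
  have e2 : 0 <= (eta / 2)%:E by rewrite lee_fin ltW.
  rewrite !EFinM -wE -!integralTZl; [|by mea|by epos|by lra|by mea|by epos|by lra].
  rewrite -ge0_integralD; [|by []|by epos|by mea|by epos|by mea].
  apply: integral_le; [by mea|by apply: emeasurable_funD; mea|by epos; rewrite lee_fin|move=> t].
  rewrite [leLHS]muleC -[leLHS]muleA [X in _ + X]muleC -[X in _ + X]muleA -ge0_muleDr; [|by epos|by epos].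
  apply: lee_wpmul2l; first by epos.
  rewrite /ind; case: (boolP (y <= t < y')%R) => ht; last by rewrite !mul0e adde0.
  by rewrite !mul1e hE -EFinD lee_fin; have := slow t ht; rewrite ler_norml; lra.
have [T1 _] := tail_mass_fin mf f0 fB yp; have [T2 _] := tail_mass_fin mf f0 fB y'p.
have midfin : mid = (fine (tail_mass f y) - fine (tail_mass f y'))%:E.
  apply: (@adde_injr (tail_mass f y')); first by rewrite T2.
  by rewrite -midE T2 -EFinD subrK -T1.
rewrite midfin lee_fin in mid_le; rewrite midfin -EFinD lee_fin in mid_ge.
have E1 : (y * (y^-1 - y'^-1) = d / (1 + d))%R.
  by rewrite /y'; field; rewrite !gt_eqF.
have E2 : (y * fine (tail_mass f y') = (1 + d)^-1 * scaled_tail f y')%R.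
  by rewrite /scaled_tail /y'; field; rewrite gt_eqF.
move: mid_le; rewrite -(ler_pM2l yp) mulrBr E2 [leRHS]mulrCA E1 -/(scaled_tail f y) => g1.
move: mid_ge; rewrite -(ler_pM2l yp) [leRHS]mulrDr [X in (_ <= X + _)%R]mulrBr E2 [leLHS]mulrCA [X in (_ <= _ + X)%R]mulrCA E1 -/(scaled_tail f y) => g2.
move: t1 t2; rewrite !ler_norml => /andP[t11 t12] /andP[t21 t22].
have zE : (z = eta / 4 * (d / (1 + d)))%R by [].
clearbody z.
set r := (d / (1 + d))%R in g1 g2 zE.
have r0 : (0 < r)%R by rewrite divr_gt0.
have rE : ((1 + d)^-1 = 1 - r)%R by rewrite /r; field; rewrite gt_eqF.
have r1 : (r < 1)%R by rewrite /r ltr_pdivrMr//; lra.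
rewrite rE in g1 g2.
set A := scaled_tail f y in t11 t12 g1 g2; set A' := scaled_tail f y' in t21 t22 g1 g2.
have k1 : ((1 - r) * A' <= (1 - r) * (average + z))%R by rewrite ler_wpM2l; lra.
have k2 : ((1 - r) * (average - z) <= (1 - r) * A')%R by rewrite ler_wpM2l; lra.
have rz : (0 <= r * z)%R by rewrite mulr_ge0 ?ltW.
have b1 : (r * h <= r * (average + eta))%R by nra.
have b2 : (r * (average - eta) <= r * h)%R by nra.
by apply/andP; split; [move: b2|move: b1]; rewrite ler_pM2l//; lra.
Qed.

End equidistribution.
End Horocycle.

(** * Substitution, oscillation and parity in one variable *)

Section Calculus.
Context {R : realType}.
Local Notation mu := (@lebesgue_measure R).

Lemma integral_substitutiony (F f G : R -> R) (a b l : R) : b < a ->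
  (forall x, b < x -> is_derive x (1 : R) F (f x)) ->
  (forall x, b < x -> {for x, continuous f}) -> (forall x, b < x -> 0 < f x) ->
  {in `[a, +oo[ &, {homo F : x y / x < y}} ->
  f x @[x --> +oo] --> l -> F x @[x --> +oo] --> +oo ->
  continuous G -> (forall x, 0 <= G x) ->
  (\int[mu]_x (ind (F a <= x)%R * (G x)%:E) =
   \int[mu]_x (ind (a <= x)%R * (G (F x) * f x)%:E))%E.
Proof.
move=> ba dF cf f0 hF fl Fy cG G0.
have FE x : b < x -> derive1 F x = f x.
  by move=> bx; rewrite derive1E; have [_] := dF x bx.
have nE x : b < x -> \forall y \near x, f y = derive1 F y.
  move=> bx; near=> y; rewrite FE//; near: y; exact: lt_nbhsr.
have cF x : b < x -> {for x, continuous (derive1 F)}.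
  move=> bx; rewrite /prop_for /continuous_at FE//.
  by apply: cvg_trans (cf x bx); apply: near_eq_cvg; exact: nE.
rewrite -integral_itvcy (@increasing_ge0_integration_by_substitutiony _ F G a) //.
- rewrite -integral_itvcy; apply: eq_integral => x; rewrite inE /= in_itv /= andbT => ax.
  by rewrite /= !fctE FE// (lt_le_trans ba).
- by move=> x; rewrite in_itv /= andbT => ax; apply: cF; exact: lt_trans ax.
- apply/cvg_ex; exists (f a); apply: cvg_at_right_filter.
  by have := cF a ba; rewrite /prop_for /continuous_at FE.
- apply/cvg_ex; exists l; apply: cvg_trans fl; apply: near_eq_cvg.
  by near=> y; rewrite FE//; near: y; apply: nbhs_pinfty_gt; exact: num_real.
- split; first by move=> x; rewrite in_itv /= andbT => ax; have [] := dF x (lt_trans ba ax).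
  apply: cvg_at_right_filter; apply: differentiable_continuous.
  by apply/derivable1_diffP; have [] := dF a ba.
- exact: continuous_subspaceT.
Unshelve. all: by end_near. Qed.

Lemma oscillation_le (F f : R -> R) (a b : R) : a <= b ->
  (forall x, a <= x -> is_derive x (1 : R) F (f x)) ->
  (forall x, a <= x -> {for x, continuous f}) -> measurable_fun setT f ->
  ((`|F b - F a|)%:E <= \int[mu]_x (ind (a <= x <= b)%R * (`|f x|)%:E))%E.
Proof.
move=> ab dF cf mf; have [->|ab'] := eqVneq a b.
  by rewrite subrr normr0; apply: integral_ge0 => x _; rewrite mule_ge0 ?ind_ge0 ?lee_fin.
have {ab'}ab : a < b by rewrite lt_neqAle ab'.
have cF x : a <= x -> {for x, continuous F}.
  move=> ax; apply: differentiable_continuous.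
  by apply/derivable1_diffP; have [] := dF x ax.
have -> : (\int[mu]_x (ind (a <= x <= b)%R * (`|f x|)%:E) =
    \int[mu]_(x in `[a, b]) `|(f x)%:E|)%E.
  rewrite [RHS]integral_mkcond; apply: eq_integral => x _.
  by rewrite patchE mem_setE in_itv /= /ind; case: ifPn => _; rewrite ?mul1e ?mul0e.
have := @le_abse_integral _ _ R mu `[a, b]%classic (fun x => (f x)%:E) (measurable_itv _).
rewrite (@continuous_FTC2 _ f F a b)//; first apply.
- by apply/measurable_EFinP; exact: measurable_funTS.
- apply/continuous_within_itvP => //; split.
  + by move=> x; rewrite in_itv /= => /andP[? ?]; apply: cf; exact: ltW.
  + by apply: cvg_at_right_filter; apply: cf.
  + by apply: cvg_at_left_filter; apply: cf; exact: ltW.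
- split.
  + by move=> x; rewrite in_itv /= => /andP[? ?]; have [] := dF x (ltW _).
  + by apply: cvg_at_right_filter; apply: cF.
  + by apply: cvg_at_left_filter; apply: cF; exact: ltW.
- move=> x; rewrite in_itv /= => /andP[ax ?].
  by rewrite derive1E; have [_] := dF x (ltW ax).
Qed.

Lemma is_derive_exprn n (x : R) :
  is_derive x (1 : R) (fun y : R => y ^+ n) (n%:R * x ^+ n.-1).
Proof.
have := @is_deriveX _ _ id n x 1 _ (is_derive_id x (1 : R)); rewrite exprfctE => h.
by apply: is_derive_eq; rewrite /GRing.scale /= mulr1.
Qed.

Lemma integral_even_le (f : R -> \bar R) : measurable_fun setT f -> (forall x, 0 <= f x)%E ->
  (forall x, f (- x)%R = f x) ->
  (\int[mu]_x f x <= 2%:E * \int[mu]_x (ind (0 <= x)%R * f x))%E.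
Proof.
move=> mf f0 fN.
have h : (\int[mu]_x (ind (0 <= - x)%R * f x) = \int[mu]_x (ind (0 <= x)%R * f x))%E.
  have N1 : (-1 != 0 :> R) by rewrite oppr_eq0 oner_neq0.
  have mg : measurable_fun setT (fun x : R => ind (0 <= x)%R * f x)%E by mea.
  have := @integral_affine R (fun x => ind (0 <= x)%R * f x)%E (-1) 0 N1 mg.
  rewrite normrN1 invr1 mul1e => <-; last by epos.
  by apply: eq_integral => x _; rewrite mulN1r addr0 fN.
rewrite (_ : 2%:E = 1 + 1)%E; last by rewrite -EFinD.
rewrite ge0_muleDl ?mul1e ?lee_fin//.
rewrite -{2}h -ge0_integralD; [|by []|by epos|by mea|by epos|by mea].
apply: integral_le; [by mea|by mea|by epos|move=> x].
rewrite -ge0_muleDl; [|by epos|by epos]; rewrite -[leLHS]mul1e; apply: lee_wpmul2r => //.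
rewrite /ind -EFinD lee_fin oppr_ge0; have [h1|h1] := leP 0 x => /=.
  by rewrite lerDl.
by rewrite (ltW h1) /= lerDr.
Qed.

End Calculus.

(** * Gamma moments and the functions a^{-j} e^{-M/a} *)

Section Gamma.
Context {R : realType}.
Local Notation mu := (@lebesgue_measure R).
Variable M : R.
Hypothesis M0 : 0 < M.

(** This is x <= e^x at x = M y / (n + 1), raised to the power n + 1. *)
Lemma poly_exp_bound n (y : R) : 0 < y ->
  y ^+ n * expR (- (M * y)) <= (n.+1%:R / M) ^+ n.+1 / y.
Proof.
move=> y0; have n0 : 0 < n.+1%:R :> R by [].
pose x := M * y / n.+1%:R.
have x0 : 0 < x by rewrite divr_gt0// mulr_gt0.
have -> : M * y = n.+1%:R * x by rewrite /x [RHS]mulrC divfK// gt_eqF.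
rewrite expRN expRM_natl.
have h : x ^+ n.+1 <= expR x ^+ n.+1.
  rewrite lerXn2r ?nnegrE ?expR_ge0 ?(ltW x0)//.
  by apply: le_trans (expR_ge1Dx x); rewrite lerDr.
apply: (@le_trans _ _ (y ^+ n * (x ^+ n.+1)^-1)).
  apply: ler_wpM2l; first by rewrite exprn_ge0// ltW.
  by rewrite lef_pV2// posrE exprn_gt0// expR_gt0.
rewrite le_eqVlt; apply/orP; left; apply/eqP.
rewrite /x !expr_div_n exprMn [in y ^+ n.+1]exprS.
have A : y ^+ n != 0 by rewrite expf_neq0// gt_eqF.
have B : M ^+ n.+1 != 0 by rewrite expf_neq0// gt_eqF.
have C : (n.+1%:R : R) ^+ n.+1 != 0 by rewrite expf_neq0.
move: (y ^+ n) (M ^+ n.+1) ((n.+1%:R : R) ^+ n.+1) A B C => u v w A B C.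
by field; rewrite A B C gt_eqF.
Qed.

Lemma cvg_poly_exp n : y ^+ n * expR (- (M * y)) @[y --> +oo] --> (0 : R).
Proof.
apply/cvgrPdist_le => e e0; near=> y.
have y0 : 0 < y by near: y; exact: nbhs_pinfty_gt.
rewrite sub0r normrN ger0_norm; last by rewrite mulr_ge0 ?expR_ge0// exprn_ge0// ltW.
apply: (le_trans (poly_exp_bound n y0)).
by rewrite ler_pdivrMr// -ler_pdivrMl//; near: y.
Unshelve. all: by end_near. Qed.

(** Repeated integration by parts yields this primitive of y^n e^{-M y} that vanishes at
    infinity. *)
Fixpoint gamma_prim n (y : R) : R :=
  if n is n'.+1 then (n%:R * gamma_prim n' y - y ^+ n * expR (- (M * y))) / M
  else - (expR (- (M * y)) / M).

Definition gamma_int n : R := n`!%:R / M ^+ n.+1.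

Lemma gamma_int_gt0 n : 0 < gamma_int n.
Proof. by rewrite divr_gt0 ?exprn_gt0// ltr0n fact_gt0. Qed.

Lemma gamma_intS n : M * gamma_int n.+1 = n.+1%:R * gamma_int n.
Proof.
rewrite /gamma_int factS natrM [M ^+ n.+2]exprS.
have B : M ^+ n.+1 != 0 by rewrite expf_neq0// gt_eqF.
move: (M ^+ n.+1) (n`!%:R : R) (n.+1%:R : R) B => u v w B.
by field; rewrite B gt_eqF.
Qed.

Lemma is_derive_exp_lin (y : R) :
  is_derive y (1 : R) (fun y : R => expR (- (M * y))) (- M * expR (- (M * y))).
Proof.
have h : is_derive y (1 : R) (fun y : R => - (M * y)) (- M).
  apply: is_derive_eq; by rewrite /GRing.scale /= mulr1.
have := @is_derive1_comp R expR (fun y : R => - (M * y)) y _ _ (is_derive_expR _) h.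
by rewrite mulrC.
Qed.

Lemma is_derive_gamma_prim n (y : R) :
  is_derive y (1 : R) (gamma_prim n) (y ^+ n * expR (- (M * y))).
Proof.
have M1 : M != 0 by rewrite gt_eqF.
have dE := is_derive_exp_lin.
elim: n => [|n IH] /=.
  have h := is_deriveN (is_deriveZ M^-1 (dE y)).
  rewrite (_ : (fun y0 => _) = - (M^-1 *: (fun y : R => expR (- (M * y))))).
    by apply: is_derive_eq; rewrite /GRing.scale /= expr0; field.
  by apply/funext => z; rewrite !fctE /GRing.scale /= mulrC.
have dX : is_derive y (1 : R) (fun y : R => y ^+ n.+1) (n.+1%:R * y ^+ n).
  exact: is_derive_exprn.
have h := is_deriveZ M^-1 (is_deriveB (is_deriveZ n.+1%:R IH) (is_deriveM dX (dE y))).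
rewrite (_ : (fun y0 => _) = (M^-1 *: (n.+1%:R *: gamma_prim n -
    (fun y : R => y ^+ n.+1) * (fun y : R => expR (- (M * y)))))).
  apply: is_derive_eq; rewrite /GRing.scale /=.
  move: (y ^+ n.+1) (y ^+ n) (expR _) (n.+1%:R : R) => u v w t.
  by field.
by apply/funext => z; rewrite !fctE /GRing.scale /= mulrC.
Qed.

Lemma cvg_gamma_prim n : gamma_prim n y @[y --> +oo] --> (0 : R).
Proof.
elim: n => [|n IH] /=.
  rewrite (_ : 0 = - (0 / M)); last by rewrite mul0r oppr0.
  apply: cvgN; apply: cvgM; last exact: cvg_cst.
  have := @cvg_poly_exp 0; apply: cvg_trans; apply: near_eq_cvg; near=> y.
  by rewrite expr0 mul1r.
rewrite (_ : 0 = (n.+1%:R * 0 - 0) / M); last by rewrite mulr0 subr0 mul0r.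
apply: cvgM; last exact: cvg_cst.
by apply: cvgB; [apply: cvgM; [exact: cvg_cst|exact: IH]|exact: cvg_poly_exp].
Unshelve. all: by end_near. Qed.

Lemma gamma_prim0 n : gamma_prim n 0 = - gamma_int n.
Proof.
have M1 : M != 0 by rewrite gt_eqF.
elim: n => [|n IH] /=.
  by rewrite /gamma_int fact0 expr1 mulr0 oppr0 expR0.
rewrite IH expr0n /= mul0r subr0.
by apply: (mulfI M1); rewrite mulrC divfK// mulrN mulrN gamma_intS.
Qed.

Lemma integral_gamma n :
  (\int[mu]_y (ind (0 < y)%R * (y ^+ n * expR (- (M * y)))%:E) = (gamma_int n)%:E)%E.
Proof.
transitivity (\int[mu]_y (ind (0 <= y)%R * (y ^+ n * expR (- (M * y)))%:E))%E.
  apply: ae_eq_integral => //.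
  - by mea.
  - by mea.
  - exists [set 0]; split => //; first exact: lebesgue_measure_set1.
    move=> y /= h; apply: contrapT => y0; apply: h => _.
    by rewrite lt_neqAle eq_sym (introN eqP y0).
have N1 : -1 < 0 :> R by rewrite ltrN10.
have dF (x : R) : -1 < x -> is_derive x (1 : R) (gamma_prim n) (x ^+ n * expR (- (M * x))).
  by move=> _; exact: is_derive_gamma_prim.
have cf (x : R) : -1 < x -> {for x, continuous (fun y : R => y ^+ n * expR (- (M * y)))}.
  move=> _; have ce : {for x, continuous (fun y : R => expR (- (M * y)))}.
    apply: differentiable_continuous; apply/derivable1_diffP.
    by have [] := is_derive_exp_lin x.
  by apply: cvgM; [exact: exprn_continuous|exact: ce].
have f0 (x : R) : 0 <= x -> 0 <= x ^+ n * expR (- (M * x)).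
  by move=> x0; rewrite mulr_ge0 ?expR_ge0// exprn_ge0.
by rewrite (integral_FTCy N1 dF cf f0 (cvg_gamma_prim n)) sub0r gamma_prim0 opprK.
Qed.

Definition phi j (a : R) : R := expR (- (M / a)) / a ^+ j.

Lemma phi_ge0 j a : 0 <= a -> 0 <= phi j a.
Proof. by move=> a0; rewrite divr_ge0 ?expR_ge0// exprn_ge0. Qed.

Lemma phiS j a : 0 < a -> phi j a = a * phi j.+1 a.
Proof.
move=> a0; rewrite /phi exprS invfM mulrCA; congr (_ * _).
by rewrite mulrA divff ?mul1r// gt_eqF.
Qed.

Lemma measurable_phi j : measurable_fun setT (phi j).
Proof. by rewrite /phi; mea. Qed.

(** The inversion a = 1 / y turns the integral into a Gamma moment; da = dy / y^2 accounts for the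
    shift by 2. *)
Lemma integral_phi j :
  (\int[mu]_a (ind (0 < a)%R * (phi j.+2 a)%:E) = (gamma_int j)%:E)%E.
Proof.
pose g (y : R) : \bar R := (ind (0 < y)%R * (y ^+ j.+1 * expR (- (M * y)))%:E)%E.
have mg : measurable_fun setT g by rewrite /g; mea.
have g0 y : (0 <= g y)%E.
  rewrite /g /ind; case: ltP => y0; last by rewrite mul0e.
  by rewrite mul1e lee_fin mulr_ge0 ?expR_ge0// exprn_ge0// ltW.
transitivity (haar (fun a => g (1 / a)%R)).
  apply: eq_integral => a _; rewrite /g /ind.
  case: (ltP 0 a) => a0; last by rewrite !mul0e.
  rewrite divr_gt0// !mul1e -EFinM; congr (_%:E).
  have A : a ^+ j.+1 != 0 by rewrite expf_neq0// gt_eqF.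
  rewrite /phi div1r exprVn [a ^+ j.+2]exprS.
  move: (expR _) (a ^+ j.+1) A => u v A.
  by field; rewrite A gt_eqF.
rewrite haar_inv// -integral_gamma; apply: eq_integral => y _; rewrite /g /ind.
case: (ltP 0 y) => y0; last by rewrite !mul0e.
by rewrite !mul1e -EFinM exprS !mulrA mulVf ?mul1r// gt_eqF.
Qed.

Definition dphi j (a : R) : R := (M / a - j%:R) * phi j.+1 a.

Lemma is_derive_phi j (a : R) : 0 < a -> is_derive a (1 : R) (phi j) (dphi j a).
Proof.
move=> a0; have a1 : a != 0 by rewrite gt_eqF.
have hV : is_derive a (1 : R) (fun y : R => y^-1) (- a ^- 2 *: (1 : R)) by exact: is_deriveV.
have hE := @is_derive1_comp R expR (- (M *: (fun y : R => y^-1))) a _ _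
  (is_derive_expR _) (is_deriveN (is_deriveZ M hV)).
have dX : is_derive a (1 : R) (fun y : R => y ^+ j) (j%:R * a ^+ j.-1).
  exact: is_derive_exprn.
have Xj : a ^+ j != 0 by rewrite expf_neq0.
have hX : is_derive a (1 : R) (fun y : R => (y ^+ j)^-1) (- (a ^+ j) ^- 2 *: (j%:R * a ^+ j.-1)).
  exact: is_deriveV.
have h := is_deriveM hE hX.
rewrite (_ : phi j = (expR \o - (M *: (fun y : R => y^-1))) * (fun y : R => (y ^+ j)^-1)); last first.
  by apply/funext => y; rewrite /phi !fctE /=.
apply: is_derive_eq; rewrite /GRing.scale /= /dphi /phi [a ^+ j.+1]exprS.
have -> : j%:R * a ^+ j.-1 = j%:R * a ^+ j / a.
  case: (j) => [|i]; first by rewrite !mul0r.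
  by rewrite /= exprSr mulrA mulfK.
rewrite !fctE /= /GRing.scale /=.
move: (expR _) (a ^+ j) (j%:R : R) Xj => u v w Xj.
by field; rewrite Xj a1.
Qed.

Lemma measurable_dphi j : measurable_fun setT (dphi j).
Proof. by have mp := measurable_phi; rewrite /dphi; mea. Qed.

Lemma continuous_phi j (a : R) : 0 < a -> {for a, continuous (phi j)}.
Proof.
move=> a0; apply: differentiable_continuous; apply/derivable1_diffP.
by have [] := is_derive_phi j a0.
Qed.

Lemma continuous_dphi j (a : R) : 0 < a -> {for a, continuous (dphi j)}.
Proof.
move=> a0; apply: cvgM; last exact: continuous_phi.
apply: cvgB; last exact: cvg_cst.
apply: cvgM; first exact: cvg_cst.
by apply: cvgV; [rewrite gt_eqF|exact: cvg_id].
Qed.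

(** [phi] is not monotone, so a value is compared with the mean over a unit interval: phi(x) is at
    most phi(y) plus the total variation, and this is averaged over y. *)
Lemma phi_cell j (c x : R) : 0 < c -> c <= x <= c + 1 ->
  ((phi j x)%:E <= \int[mu]_y (ind (c <= y <= c + 1)%R * (phi j y + `|dphi j y|)%:E))%E.
Proof.
move=> c0 /andP[cx xc]; have mp := measurable_phi; have md := measurable_dphi.
set K := (\int[mu]_y (ind (c <= y <= c + 1)%R * (`|dphi j y|)%:E))%E.
have n0 (y : R) : (0 <= (`|dphi j y|)%:E)%E by rewrite lee_fin.
have K0 : (0 <= K)%E by rewrite /K; epos.
have sub (a b : R) : c <= a -> a <= b -> b <= c + 1 -> ((`|phi j b - phi j a|)%:E <= K)%E.
  move=> ca ab bc; have a0 := lt_le_trans c0 ca.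
  apply: (@le_trans _ _ (\int[mu]_y (ind (a <= y <= b)%R * (`|dphi j y|)%:E))%E).
    apply: oscillation_le => // z az; have z0 := lt_le_trans a0 az.
      exact: is_derive_phi.
    exact: continuous_dphi.
  apply: integral_le; [by mea|by mea|by epos|move=> y].
  apply: lee_wpmul2r => //; rewrite /ind lee_fin ler_nat.
  case: (boolP (a <= y <= b)) => //= /andP[ay yb].
  by rewrite (le_trans ca ay) (le_trans yb bc).
have h (y : R) : c <= y <= c + 1 -> ((phi j x)%:E <= (phi j y)%:E + K)%E.
  move=> /andP[cy yc]; have : ((`|phi j x - phi j y|)%:E <= K)%E.
    by have [xy|yx] := leP x y; [rewrite distrC; apply: sub|apply: sub => //; exact: ltW].
  move=> hK; apply: (@le_trans _ _ ((phi j y)%:E + (`|phi j x - phi j y|)%:E)%E).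
    by rewrite -EFinD lee_fin -lerBlDl ler_norm.
  by rewrite leeD2l.
have p0 (y : R) : (0 <= ind (c <= y <= c + 1)%R * (phi j y)%:E)%E.
  rewrite /ind; case: (boolP (c <= y <= c + 1)) => [/andP[cy _]|_]; last by rewrite mul0e.
  by rewrite mul1e lee_fin phi_ge0// (le_trans (ltW c0)).
have cc : c <= c + 1 by rewrite lerDl.
have -> : (\int[mu]_y (ind (c <= y <= c + 1)%R * (phi j y + `|dphi j y|)%:E) =
    \int[mu]_y (ind (c <= y <= c + 1)%R * (phi j y)%:E) + K)%E.
  rewrite /K -ge0_integralD; [|by []|by move=> y _; exact: p0|by mea|by epos|by mea].
  by apply: eq_integral => y _; rewrite EFinD /ind; case: (c <= y <= c + 1); rewrite ?mul1e ?mul0e ?adde0.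
have len : (\int[mu]_y ind (c <= y <= c + 1)%R = 1)%E.
  by rewrite integral_ind_itv// addrC addKr.
have e1 (k : \bar R) : (0 <= k)%E -> (\int[mu]_y (k * ind (c <= y <= c + 1)%R) = k)%E.
  by move=> k0; rewrite ge0_integralZl; [rewrite len mule1|by []|by mea|by epos|by []].
have px : (0 <= (phi j x)%:E)%E by rewrite lee_fin phi_ge0// (le_trans (ltW c0)).
rewrite -{1}(e1 _ px) -{1}(e1 _ K0) -ge0_integralD; [|by []|by move=> y _; exact: p0|by mea|by epos|by mea].
apply: integral_le; [by mea|by mea|by epos|move=> y].
rewrite /ind; case: (boolP (c <= y <= c + 1)) => hy; last by rewrite !mule0 mul0e adde0.
by rewrite !mule1 mul1e; exact: h.
Qed.

End Gamma.

(** * Overlap of two waves, and sums over annuli *)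

Section Annuli.
Context {R : realType}.
Local Notation mu := (@lebesgue_measure R).
Variable M : R.
Hypothesis M0 : 0 < M.
Local Open Scope ereal_scope.

Lemma haarD (f g : R -> \bar R) : measurable_fun setT f -> (forall x, 0 <= f x) ->
  measurable_fun setT g -> (forall x, 0 <= g x) ->
  haar (fun y => f y + g y) = haar f + haar g.
Proof.
move=> mf f0 mg g0; have w0 := @haar_weight_ge0 R.
rewrite /haar -ge0_integralD; [|by []|by epos|by mea|by epos|by mea].
by apply: eq_integral => y _; rewrite ge0_muleDr.
Qed.

Lemma haarZl (f : R -> \bar R) (k : \bar R) : measurable_fun setT f -> (forall x, 0 <= f x) ->
  0 <= k -> haar (fun y => k * f y) = k * haar f.
Proof.
move=> mf f0 k0; have w0 := @haar_weight_ge0 R.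
rewrite /haar -ge0_integralZl; [|by []|by mea|by epos|by []].
by apply: eq_integral => y _; rewrite muleCA.
Qed.

Lemma le_haar (f g : R -> \bar R) : measurable_fun setT f -> (forall x, 0 <= f x) ->
  measurable_fun setT g -> (forall x, (0 < x)%R -> f x <= g x) -> haar f <= haar g.
Proof.
move=> mf f0 mg fg; have w0 := @haar_weight_ge0 R.
apply: integral_le; [by mea|by mea|by epos|move=> y].
have := w0 y; have [y0 wy|y0 _] := ltP 0%R y; last by rewrite /ind !mul0e.
by apply: lee_wpmul2l => //; exact: fg.
Qed.

(** For x = sqrt(b) (v - 1) >= 0 one has 1 / (1 + x^2) <= 2 / (1 + x)^2, and the affine substitution
    u = 1 + x reduces the latter to the integral of 1 / u^2 over u >= 1. *)
Lemma integral_cauchy_le (b : R) : (0 < b)%R ->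
  \int[mu]_v (ind (1 <= v)%R * ((1 + b * (v - 1) ^+ 2)^-1)%:E) <= (2 / Num.sqrt b)%:E.
Proof.
move=> b0; set q := Num.sqrt b; have q0 : (0 < q)%R by rewrite sqrtr_gt0.
have qb : (q ^+ 2 = b)%R by rewrite sqr_sqrtr// ltW.
have mw := @measurable_hyp_weight R.
have mg : measurable_fun setT (fun y : R => hyp_weight y * ind (1 <= y)%R) by mea.
have q1 : (q != 0)%R by rewrite gt_eqF.
have h := @integral_affine R (fun y => hyp_weight y * ind (1 <= y)%R) q (1 - q)%R q1 mg.
rewrite integral_ind_ge// invr1 mule1 gtr0_norm// in h.
rewrite EFinM -h; last by epos.
rewrite -integralTZl; [|by mea|by epos|by []].
have b1 (v : R) : (0 < 1 + b * (v - 1) ^+ 2)%R.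
  by rewrite ltr_wpDr// mulr_ge0 ?sqr_ge0// ltW.
have p0 (v : R) : 0 <= ((1 + b * (v - 1) ^+ 2)^-1)%:E by rewrite lee_fin invr_ge0 ltW.
apply: integral_le; [by mea|by mea|by epos|move=> v].
rewrite {1}/ind; case: (leP 1%R v) => v1; last by rewrite mul0e; epos.
have x0 : (0 <= q * (v - 1))%R by rewrite mulr_ge0 ?(ltW q0)// subr_ge0.
have E : (q * v + (1 - q) = 1 + q * (v - 1))%R by ring.
have x1 : (1 <= q * v + (1 - q))%R by rewrite E lerDl.
rewrite mul1e /hyp_weight /ind x1 (lt_le_trans ltr01 x1) mul1e mule1 -EFinM lee_fin.
rewrite ler_pdivlMr ?exprn_gt0 ?(lt_le_trans ltr01 x1)// mulrC ler_pdivrMr//.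
rewrite E -qb; move: x0; set x := (q * (v - 1))%R => x0.
have -> : (q ^+ 2 * (v - 1) ^+ 2 = x ^+ 2)%R by rewrite -exprMn.
by have := sqr_ge0 (x - 1)%R; nra.
Qed.

(** The exponent is invariant under v -> 1 / v, so the part v < 1 folds onto v > 1. There e^X >= 1 +
    X, together with the factor 1 / v of the measure, gives the kernel 1 / (1 + b (v - 1)^2). *)
Lemma haar_gauss_le (b : R) : (0 < b)%R ->
  haar (fun v => (expR (- (b * ((v - 1) ^+ 2 / v))))%:E) <= (4 / Num.sqrt b)%:E.
Proof.
move=> b0; pose f (v : R) : \bar R := (expR (- (b * ((v - 1) ^+ 2 / v))))%:E.
pose g (v : R) := ind (1 <= v)%R * f v.
have f0 v : 0 <= f v by rewrite lee_fin expR_ge0.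
have mf : measurable_fun setT f by rewrite /f; mea.
have mg : measurable_fun setT g by rewrite /g; mea.
have g0 v : 0 <= g v by rewrite /g; epos.
have mg' : measurable_fun setT (fun v : R => g (1 / v)%R) by mea.
have : haar f <= haar g + haar (fun v => g (1 / v)%R).
  rewrite -haarD//; apply: le_haar => //; first by mea.
  move=> v v0; have [v1|v1] := leP 1%R v.
    by apply: (@le_trans _ _ (g v)); [rewrite /g /ind v1 mul1e|rewrite leeDl].
  apply: (@le_trans _ _ (g (1 / v)%R)); last by rewrite leeDr.
  rewrite /g /ind div1r invf_ge1 ?(ltW v1)// mul1e /f lee_fin ler_expR lerN2.
  rewrite le_eqVlt; apply/orP; left; apply/eqP; congr (_ * _)%R.
  by field; rewrite gt_eqF.
rewrite haar_inv//; move/le_trans; apply.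
have h : haar g <= (2 / Num.sqrt b)%:E.
  apply: le_trans (integral_cauchy_le b0).
  have w0 := @haar_weight_ge0 R.
  apply: integral_le; [by mea|by mea|by epos|move=> v].
  rewrite /g {2 3}/ind; case: (leP 1%R v) => v1; last by rewrite !mul0e mule0.
  have v0 := lt_le_trans ltr01 v1.
  rewrite /ind v0 !mul1e -EFinM lee_fin expRN -invfM.
  have q0 : (0 <= (v - 1) ^+ 2)%R by exact: sqr_ge0.
  rewrite lef_pV2 ?posrE; last 2 first.
    by rewrite mulr_gt0// expR_gt0.
    by rewrite ltr_wpDr// mulr_ge0// ltW.
  apply: (@le_trans _ _ (v * (1 + b * ((v - 1) ^+ 2 / v)))%R); last first.
    by rewrite ler_wpM2l ?(ltW v0)//; exact: expR_ge1Dx.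
  have -> : (v * (1 + b * ((v - 1) ^+ 2 / v)) = v + b * (v - 1) ^+ 2)%R.
    by field; rewrite gt_eqF.
  by rewrite lerD2r.
apply: (le_trans (leeD h h)); rewrite -EFinD lee_fin.
by rewrite -mulrDl; have -> : (2 + 2 = 4 :> R)%R by ring.
Qed.

(** The F of the overview, with n = k / 2 and M / 2 = 2 pi m, extended by 0 to t <= 0. *)
Definition wave n (t : R) : \bar R :=
  ind (0 < t)%R * (expR (- (M / 2 * t)) * t ^+ n)%:E.

Lemma wave_ge0 n t : 0 <= wave n t.
Proof.
rewrite /wave /ind; case: ltP => t0; last by rewrite mul0e.
by rewrite mul1e lee_fin mulr_ge0 ?expR_ge0// exprn_ge0// ltW.
Qed.

Lemma measurable_wave n : measurable_fun setT (wave n).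
Proof. by rewrite /wave; mea. Qed.

(** Put y = v / a. As v + 1/v = 2 + (v - 1)^2 / v, the product of the waves is [phi M (2 * n) a]
    times a Gaussian factor with b = M / (2 a). Its integral 4 / sqrt(b) is at most 2 / r + 2 r / b
    for every r > 0: no power a^{1/2} is left, only the powers 1 and a, which stay within the family
    [phi]. *)
Lemma haar_wave_le n (a r : R) : (0 < a)%R -> (0 < r)%R ->
  haar (fun y => wave n y * wave n (1 / (y * a ^+ 2))%R) <=
  (2 / r * phi M (2 * n) a + 4 * r / M * (a * phi M (2 * n) a))%:E.
Proof.
move=> a0 r0; have mw := measurable_wave n; have w0 := wave_ge0 n.
pose f y := wave n y * wave n (1 / (y * a ^+ 2))%R.
have mf : measurable_fun setT f by rewrite /f; mea.
have f0 y : 0 <= f y by rewrite /f; epos.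
have ai : (0 < a^-1)%R by rewrite invr_gt0.
rewrite -/f -(haar_scale ai mf f0).
pose b := (M / (2 * a))%R; have b0 : (0 < b)%R by rewrite divr_gt0// mulr_gt0.
have p0 : (0 <= phi M (2 * n) a)%R by rewrite phi_ge0// ltW.
have e0 (v : R) : 0 <= (expR (- (b * ((v - 1) ^+ 2 / v))))%:E by rewrite lee_fin expR_ge0.
have -> : haar (fun y => f (a^-1 * y)%R) =
    haar (fun v => (phi M (2 * n) a)%:E * (expR (- (b * ((v - 1) ^+ 2 / v))))%:E).
  apply: eq_integral => v _; rewrite /ind; case: (ltP 0%R v) => v0; last by rewrite !mul0e.
  congr (_ * _); rewrite /f /wave /ind.
  have av : (0 < a^-1 * v)%R by rewrite mulr_gt0.
  rewrite av divr_gt0 ?mulr_gt0 ?exprn_gt0// !mul1e -!EFinM; congr (_%:E).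
  rewrite mulrACA -expRD -exprMn /phi exprM [RHS]mulrAC -expRD -exprVn.
  congr (expR _ * _ ^+ _)%R; last by field; rewrite !gt_eqF.
  by rewrite /b; field; rewrite !gt_eqF.
rewrite haarZl; [|by mea|by epos|by rewrite lee_fin].
apply: (@le_trans _ _ ((phi M (2 * n) a)%:E * (4 / Num.sqrt b)%:E)).
  by apply: lee_wpmul2l; [rewrite lee_fin|exact: haar_gauss_le].
set q := Num.sqrt b; have q0 : (0 < q)%R by rewrite sqrtr_gt0.
have qb : (q ^+ 2 = b)%R by rewrite sqr_sqrtr// ltW.
have -> : (2 / r * phi M (2 * n) a + 4 * r / M * (a * phi M (2 * n) a) =
    phi M (2 * n) a * (2 / r + 2 * r / q ^+ 2))%R.
  by rewrite qb /b; field; rewrite !gt_eqF.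
rewrite -EFinM lee_fin ler_wpM2l// -subr_ge0.
have -> : (2 / r + 2 * r / q ^+ 2 - 4 / q = 2 * (q - r) ^+ 2 / (r * q ^+ 2))%R.
  by field; rewrite !gt_eqF.
by apply: divr_ge0; apply: mulr_ge0; rewrite ?sqr_ge0 ?(ltW r0).
Qed.

Lemma inv_sqrt_telescope (x : R) : (1 <= x)%R ->
  ((Num.sqrt x)^-1 <= 2 * (Num.sqrt x - Num.sqrt (x - 1)))%R.
Proof.
move=> x1; set u := Num.sqrt x; set w := Num.sqrt (x - 1).
have u0 : (0 < u)%R by rewrite sqrtr_gt0 (lt_le_trans ltr01).
have w0 : (0 <= w)%R by exact: sqrtr_ge0.
have uE : (u ^+ 2 = x)%R by rewrite sqr_sqrtr// (le_trans ler01).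
have wE : (w ^+ 2 = x - 1)%R by rewrite sqr_sqrtr// subr_ge0.
rewrite -[leLHS]mul1r ler_pdivrMr//.
have -> : (2 * (u - w) * u = (u - w) ^+ 2 + (u ^+ 2 - w ^+ 2))%R by ring.
by rewrite uE wE; have := sqr_ge0 (u - w)%R; lra.
Qed.

(** x^2 - C^2 >= x (x - C), and 1 / sqrt(x - C) is at most twice the difference of the square roots
    of x - C and x - C - 1. The sum telescopes to at most 2 sqrt(x) / sqrt(x). *)
Lemma esum_inv_sqrt_le (x : R) : (0 < x)%R ->
  \esum_(c in [set: nat]) (ind (c.+1%:R + 1 <= x)%R *
     ((Num.sqrt (x ^+ 2 - c.+1%:R ^+ 2))^-1)%:E) <= 2%:E.
Proof.
move=> x0.
have t0 c : 0 <= ind (c.+1%:R + 1 <= x)%R * ((Num.sqrt (x ^+ 2 - c.+1%:R ^+ 2))^-1)%:E.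
  by apply: mule_ge0; [epos|rewrite lee_fin invr_ge0 sqrtr_ge0].
rewrite -nneseries_esumT//; apply: lime_le; first by apply: is_cvg_nneseries => n _ _; exact: t0.
apply: nearW => N; rewrite big_mkord.
set q := Num.sqrt x; have q0 : (0 < q)%R by rewrite sqrtr_gt0.
apply: (@le_trans _ _ (\sum_(c < N) (q^-1 *
    (2 * (Num.sqrt (x - c.+1%:R) - Num.sqrt (x - c.+2%:R))))%:E)).
  apply: lee_sum => c _.
  have mono : (Num.sqrt (x - c.+2%:R) <= Num.sqrt (x - c.+1%:R))%R.
    by rewrite ler_wsqrtr// lerD2l lerN2 ler_nat.
  rewrite /ind; case: (leP (c.+1%:R + 1)%R x) => h; last first.
    by rewrite mul0e lee_fin mulr_ge0 ?invr_ge0 ?(ltW q0)// mulr_ge0// subr_ge0.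
  have c0 : (0 < c.+1%:R :> R)%R by [].
  have E : (x - c.+2%:R = (x - c.+1%:R) - 1)%R by rewrite -[c.+2%:R]natr1; ring.
  move: (c.+1%:R : R) c0 h E mono => C c0 h E mono.
  rewrite mul1e lee_fin E.
  have d1 : (1 <= x - C)%R by lra.
  have -> : (x ^+ 2 - C ^+ 2 = (x + C) * (x - C))%R by ring.
  apply: (@le_trans _ _ (q^-1 * (Num.sqrt (x - C))^-1)%R); last first.
    by rewrite ler_wpM2l ?invr_ge0 ?(ltW q0)// inv_sqrt_telescope.
  rewrite -invfM -sqrtrM ?(ltW x0)// lef_pV2 ?posrE ?sqrtr_gt0 ?mulr_gt0//; try lra.
  by rewrite ler_wsqrtr// ler_wpM2r; lra.
rewrite sumEFin lee_fin -mulr_sumr -mulr_sumr.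
have -> : (\sum_(c < N) (Num.sqrt (x - c.+1%:R) - Num.sqrt (x - c.+2%:R)) =
    Num.sqrt (x - 1) - Num.sqrt (x - N.+1%:R))%R.
  elim: N => [|N IH]; first by rewrite big_ord0 subrr.
  by rewrite big_ord_recr IH /= addrA subrK.
rewrite mulrC ler_pdivrMr// ler_wpM2l//.
have : (Num.sqrt (x - 1) <= q)%R by rewrite ler_wsqrtr// gerBl.
by have := sqrtr_ge0 (x - N.+1%:R)%R; lra.
Qed.

(** Substitution t = sqrt(a^2 - C^2), started at a = C + 1 to stay away from the singularity of
    dt/da at a = C. *)
Lemma integral_annulus_subst j (C : R) : (0 < C)%R ->
  \int[mu]_t (ind (Num.sqrt ((C + 1) ^+ 2 - C ^+ 2) <= t)%R *
     (phi M j (Num.sqrt (t ^+ 2 + C ^+ 2)))%:E) =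
  \int[mu]_a (ind (C + 1 <= a)%R * (phi M j a * (a / Num.sqrt (a ^+ 2 - C ^+ 2)))%:E).
Proof.
move=> C0.
have pos (x : R) : (C < x)%R -> (0 < x ^+ 2 - C ^+ 2)%R by move=> h; rewrite subr_gt0; nra.
pose F (x : R) : R := Num.sqrt (x ^+ 2 - C ^+ 2).
pose f (x : R) : R := (x / Num.sqrt (x ^+ 2 - C ^+ 2))%R.
have CC : (C < C + 1)%R by rewrite ltrDl.
have dF (x : R) : (C < x)%R -> is_derive x (1%R : R) F (f x).
  move=> Cx; have p0 := pos x Cx.
  have d2 : is_derive x (1%R : R) (fun y : R => y ^+ 2 - C ^+ 2)%R (2 * x)%R.
    have h := is_deriveB (@is_derive_exprn R 2 x) (is_derive_cst (C ^+ 2)%R x (1%R : R)).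
    by apply: is_derive_eq; rewrite /= subr0 expr1.
  have h := @is_derive1_comp R Num.sqrt (fun y : R => y ^+ 2 - C ^+ 2)%R x _ _ (is_derive1_sqrt p0) d2.
  apply: is_derive_eq; rewrite /f.
  by field; rewrite gt_eqF// sqrtr_gt0.
have cF2 (x : R) : {for x, continuous (fun y : R => y ^+ 2 - C ^+ 2)%R}.
  by apply: cvgB; [exact: exprn_continuous|exact: cvg_cst].
have cf (x : R) : (C < x)%R -> {for x, continuous f}.
  move=> Cx; apply: cvgM; first exact: cvg_id.
  apply: cvgV; first by rewrite gt_eqF// sqrtr_gt0 pos.
  exact: (@continuous_comp _ _ _ (fun y : R => y ^+ 2 - C ^+ 2)%R Num.sqrt x (cF2 x) (@sqrt_continuous R _)).
have f0 (x : R) : (C < x)%R -> (0 < f x)%R.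
  by move=> Cx; rewrite divr_gt0 ?sqrtr_gt0 ?pos// (lt_trans C0).
have hF : {in `[C + 1, +oo[%R &, {homo F : x y / (x < y)%R}}.
  move=> x y; rewrite !in_itv /= !andbT => hx hy xy; rewrite ltr_sqrt ?pos//; last by lra.
  by rewrite ltrD2r -subr_gt0 subr_sqr; apply: mulr_gt0; lra.
have fl : f x @[x --> +oo%R] --> (1%R : R).
  apply/cvgrPdist_le => e e0; near=> x.
  have x1 : (C < x)%R by near: x; apply: nbhs_pinfty_gt; exact: num_real.
  have x2 : (C / e + C <= x)%R by near: x; apply: nbhs_pinfty_ge; exact: num_real.
  have s0 : (0 < F x)%R by rewrite sqrtr_gt0 pos.
  have sE : (F x ^+ 2 = x ^+ 2 - C ^+ 2)%R by rewrite sqr_sqrtr// ltW ?pos.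
  have sx : (F x <= x)%R by nra.
  have xs : (x - C <= F x)%R by rewrite leNgt; apply/negP => h; nra.
  have fx : (1 <= f x)%R by rewrite /f -/(F x) ler_pdivlMr// mul1r.
  rewrite distrC ger0_norm ?subr_ge0// lerBlDl /f -/(F x) ler_pdivrMr//.
  have ec : (C <= e * (x - C))%R.
    by rewrite mulrC -ler_pdivrMr//; lra.
  have : (e * (x - C) <= e * F x)%R by rewrite ler_wpM2l// ltW.
  by lra.
have Fy : F x @[x --> +oo%R] --> +oo%R.
  apply/cvgryPge => A; near=> x.
  have x1 : (C < x)%R by near: x; apply: nbhs_pinfty_gt; exact: num_real.
  have x2 : (`|A| + C <= x)%R by near: x; apply: nbhs_pinfty_ge; exact: num_real.
  have s0 : (0 < F x)%R by rewrite sqrtr_gt0 pos.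
  have sE : (F x ^+ 2 = x ^+ 2 - C ^+ 2)%R by rewrite sqr_sqrtr// ltW ?pos.
  have xs : (x - C <= F x)%R by rewrite leNgt; apply/negP => h; nra.
  by have := ler_norm A; lra.
pose G (t : R) : R := phi M j (Num.sqrt (t ^+ 2 + C ^+ 2)).
have sp (t : R) : (0 < t ^+ 2 + C ^+ 2)%R by rewrite ltr_wpDl ?sqr_ge0// exprn_gt0.
have cG : continuous G.
  move=> t; have c2 : {for t, continuous (fun y : R => y ^+ 2 + C ^+ 2)%R}.
    by apply: cvgD; [exact: exprn_continuous|exact: cvg_cst].
  apply: (@continuous_comp _ _ _ (fun t : R => Num.sqrt (t ^+ 2 + C ^+ 2)) (phi M j)).
    exact: (@continuous_comp _ _ _ (fun y : R => y ^+ 2 + C ^+ 2)%R Num.sqrt t c2 (@sqrt_continuous R _)).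
  by apply: continuous_phi; rewrite // sqrtr_gt0.
have G0 t : (0 <= G t)%R by rewrite /G phi_ge0// sqrtr_ge0.
have := integral_substitutiony CC dF cf f0 hF fl Fy cG G0; rewrite /F /G => ->.
apply: eq_integral => a _; rewrite /ind; case: leP => h; last by rewrite !mul0e.
have a0 : (0 < a)%R by lra.
rewrite /f sqr_sqrtr ?(ltW (pos _ _))//; last by lra.
by rewrite subrK sqrtr_sqr gtr0_norm.
Unshelve. all: by end_near. Qed.

(** The index c stands for the positive integer c + 1, and the argument of [phi] is the radius a of
    the overview. *)
Definition annulus j (c : nat) : \bar R :=
  \int[mu]_t (ind (0 <= t)%R * (phi M j (Num.sqrt (t ^+ 2 + c.+1%:R ^+ 2)))%:E).

(** Majorant of 2 sqrt(y) (phi + |dphi|) for y >= 1: there sqrt(y) <= y, and 2 sqrt(y) |X| <= d y +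
    X^2 / d for X = M / y - j. The square X^2, unlike |X|, has an exact integral. *)
Definition cell_majorant j (d : R) (y : R) : \bar R :=
  ind (0 < y)%R * (2 * (y * phi M j y) + d * (y * phi M j.+1 y) +
    d^-1 * ((M / y - j%:R) ^+ 2 * phi M j.+1 y))%:E.

Lemma cell_majorant_ge0 j d y : (0 < d)%R -> 0 <= cell_majorant j d y.
Proof.
move=> d0; rewrite /cell_majorant /ind; case: ltP => y0; last by rewrite mul0e.
have y0' := ltW y0; have d0' := ltW d0; have di : (0 <= d^-1)%R by rewrite invr_ge0.
have P1 := phi_ge0 M j y0'; have P2 := phi_ge0 M j.+1 y0'.
have X2 := sqr_ge0 (M / y - j%:R)%R.
by rewrite mul1e lee_fin; do !apply: addr_ge0; apply: mulr_ge0 => //; apply: mulr_ge0.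
Qed.

Lemma measurable_cell_majorant j d : measurable_fun setT (cell_majorant j d).
Proof. by have mp := measurable_phi M; rewrite /cell_majorant; mea. Qed.

(** The integral is split where the radius reaches C + 1, with C = c + 1. Before, the radius stays
    in [C, C + 1], and [phi_cell] applies on a t-interval of length T; beyond, the radius becomes
    the variable. *)
Lemma annulus_le j c (d : R) : (0 < d)%R ->
  annulus j c <=
    \int[mu]_y (ind (c.+1%:R <= y <= c.+1%:R + 1)%R * cell_majorant j d y) +
    \int[mu]_a (ind (c.+1%:R + 1 <= a)%R *
      (phi M j a * (a / Num.sqrt (a ^+ 2 - c.+1%:R ^+ 2)))%:E).
Proof.
move=> d0; rewrite /annulus.
have C1 : (1 <= c.+1%:R :> R)%R by rewrite ler1n.
move: (c.+1%:R : R) C1 => C C1; have C0 : (0 < C)%R by lra.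
have mp := measurable_phi M; have md := measurable_dphi M.
have p0 (t : R) : 0 <= (phi M j (Num.sqrt (t ^+ 2 + C ^+ 2)))%:E.
  by rewrite lee_fin phi_ge0// sqrtr_ge0.
rewrite -integral_annulus_subst//.
set T := Num.sqrt ((C + 1) ^+ 2 - C ^+ 2).
have TE : (T ^+ 2 = 2 * C + 1)%R by rewrite sqr_sqrtr; [ring|nra].
have T0 : (0 <= T)%R by exact: sqrtr_ge0.
set K := \int[mu]_y (ind (C <= y <= C + 1)%R * (phi M j y + `|dphi M j y|)%:E).
have K0 : 0 <= K.
  apply: integral_ge0 => y _; rewrite /ind; case: (boolP (C <= y <= C + 1)%R) => [/andP[h _]|_].
    by rewrite mul1e lee_fin addr_ge0// phi_ge0//; lra.
  by rewrite mul0e.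
apply: (@le_trans _ _ (\int[mu]_t (K * ind (0 <= t <= T)%R) +
    \int[mu]_t (ind (T <= t)%R * (phi M j (Num.sqrt (t ^+ 2 + C ^+ 2)))%:E))).
  rewrite -ge0_integralD; [|by []|by epos|by mea|by epos|by mea].
  apply: integral_le; [by mea|by mea|by epos|move=> t].
  have [t0|t0] := leP 0%R t; last by rewrite {1}/ind mul0e; apply: adde_ge0; epos.
  have [tT|Tt] := leP T t.
    by rewrite leeDr//; epos.
  rewrite /ind (ltW Tt) /= mul0e adde0 mul1e mule1.
  apply: phi_cell => //.
  have s0 := sqrtr_ge0 (t ^+ 2 + C ^+ 2)%R.
  have sE : (Num.sqrt (t ^+ 2 + C ^+ 2) ^+ 2 = t ^+ 2 + C ^+ 2)%R by rewrite sqr_sqrtr// addr_ge0 ?sqr_ge0.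
  move: (Num.sqrt _) s0 sE => s s0 sE; have t2 : (t ^+ 2 <= T ^+ 2)%R by rewrite lerXn2r// ?nnegrE// ltW.
  have tt := sqr_ge0 t.
  apply/andP; split; rewrite leNgt; apply/negP => h; nra.
apply: leeD; last exact: lexx.
rewrite ge0_integralZl; [|by []|by mea|by epos|by []].
rewrite integral_ind_itv// subr0 muleC /K -integralTZl//; last 2 first.
- by mea.
- move=> y; rewrite /ind; case: (boolP (C <= y <= C + 1)%R) => [/andP[h _]|_].
    by rewrite mul1e lee_fin addr_ge0// phi_ge0//; lra.
  by rewrite mul0e.
have mc := measurable_cell_majorant j d; have c0 y := cell_majorant_ge0 j y d0.
apply: integral_le; [by mea|by mea| |].
  move=> y; rewrite /ind; case: (boolP (C <= y <= C + 1)%R) => [/andP[h _]|_].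
    by rewrite mul1e -EFinM lee_fin mulr_ge0// addr_ge0// phi_ge0//; lra.
  by rewrite mul0e mule0.
move=> y; rewrite muleCA; apply: (@le_trans _ _ (ind (C <= y <= C + 1)%R * cell_majorant j d y)); last exact: lexx.
rewrite /ind; case: (boolP (C <= y <= C + 1)%R) => [/andP[Cy yC]|_]; last by rewrite !mul0e.
have y0 : (0 < y)%R by lra.
rewrite !mul1e -?EFinM /cell_majorant /ind y0 mul1e lee_fin.
set s := Num.sqrt y; have s0 : (0 < s)%R by rewrite sqrtr_gt0.
have sE : (s ^+ 2 = y)%R by rewrite sqr_sqrtr// ltW.
(* T^2 = 2 C + 1 is at most 4 y because 1 <= C <= y. *)
have Ts : (T <= 2 * s)%R by rewrite leNgt; apply/negP => h; nra.
have s1 : (s <= y)%R by rewrite leNgt; apply/negP => h; nra.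
rewrite mulrDr -addrA; apply: lerD.
  rewrite mulrA; apply: ler_wpM2r; first by rewrite phi_ge0// ltW.
  by lra.
rewrite /dphi normrM (ger0_norm (phi_ge0 M j.+1 (ltW y0))).
move: (phi M j.+1 y) (phi_ge0 M j.+1 (ltW y0)) => P P0.
rewrite !mulrA -mulrDl; apply: ler_wpM2r => //.
set X := (M / y - j%:R)%R; have X0 := normr_ge0 X.
apply: (@le_trans _ _ (2 * s * `|X|)%R); first by rewrite ler_wpM2r.
have XE : (X ^+ 2 = `|X| ^+ 2)%R by rewrite real_normK// num_real.
rewrite -(mulrA (d^-1)%R) -expr2 XE -sE -subr_ge0.
have -> : (d * s ^+ 2 + d^-1 * `|X| ^+ 2 - 2 * s * `|X| = (d * s - `|X|) ^+ 2 / d)%R.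
  by field; rewrite gt_eqF.
by rewrite divr_ge0 ?sqr_ge0// ltW.
Qed.

(** Under y = 1 / u, the weight [phi M j.+1] with j = i + 3 becomes a Gamma law of shape j, under
    which M u has mean j and variance j. The quadratic term thus costs a factor j rather than
    j^2. *)
Lemma integral_cell_majorant i d : (0 < d)%R ->
  \int[mu]_y cell_majorant i.+3 d y =
  (2 * gamma_int M i + d * gamma_int M i.+1 + d^-1 * (i.+3%:R * gamma_int M i.+2))%:E.
Proof.
move=> d0; have mp := measurable_phi M.
have i0 (k : R) j : (0 <= k)%R -> \int[mu]_y (ind (0 < y)%R * (k * phi M j.+2 y)%:E) = (k * gamma_int M j)%:E.
  move=> k0; rewrite EFinM -integral_phi// -integralTZl//; last 2 first.
  - by mea.
  - move=> y; rewrite /ind; case: ltP => y0; last by rewrite mul0e.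
    by rewrite mul1e lee_fin phi_ge0// ltW.
  by apply: eq_integral => y _; rewrite EFinM muleCA.
have p0 (k : R) j : (0 <= k)%R -> forall y, 0 <= ind (0 < y)%R * (k * phi M j y)%:E.
  move=> k0 y; rewrite /ind; case: ltP => y0; last by rewrite mul0e.
  by rewrite mul1e lee_fin mulr_ge0// phi_ge0// ltW.
set j := i.+3.
pose X y := ind (0 < y)%R * ((M / y - j%:R) ^+ 2 * phi M j.+1 y)%:E.
have mX : measurable_fun setT X by rewrite /X; mea.
have X0 y : 0 <= X y.
  rewrite /X /ind; case: ltP => y0; last by rewrite mul0e.
  by rewrite mul1e lee_fin mulr_ge0 ?sqr_ge0// phi_ge0// ltW.
have XE : \int[mu]_y X y = (j%:R * gamma_int M i.+2)%:E.
  have jM : (0 <= 2 * j%:R * M)%R by rewrite !mulr_ge0// ltW.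
  have M2 : (0 <= M ^+ 2)%R by exact: sqr_ge0.
  have j2 : (0 <= j%:R ^+ 2 :> R)%R by exact: sqr_ge0.
  have q1 := p0 _ i.+4.+1 jM; have q2 := p0 _ i.+3.+3 M2; have q3 := p0 _ i.+4 j2.
  apply: (@adde_injr _ (2 * j%:R * M * gamma_int M i.+3)%:E) => //.
  rewrite -i0// -ge0_integralD; [|by []|by move=> y _|by []|by move=> y _|by mea].
  transitivity (\int[mu]_y (ind (0 < y)%R * (M ^+ 2 * phi M i.+3.+3 y)%:E +
      ind (0 < y)%R * (j%:R ^+ 2 * phi M i.+4 y)%:E)).
    apply: eq_integral => y _; rewrite /X /ind; case: ltP => y0; last by rewrite !mul0e.
    rewrite !mul1e -!EFinD; congr (_%:E).
    rewrite /j (@phiS _ M i.+4 y y0) (@phiS _ M i.+4.+1 y y0).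
    by move: (i.+3%:R : R) (phi _ _ _) => u w; field; rewrite gt_eqF.
  rewrite ge0_integralD; [|by []|by move=> y _|by mea|by move=> y _|by mea].
  rewrite !i0// -!EFinD; congr (_%:E).
  have g1 := gamma_intS M0 i.+3; have g2 := gamma_intS M0 i.+2.
  have -> : (M ^+ 2 * gamma_int M i.+4 = i.+4%:R * (i.+3%:R * gamma_int M i.+2))%R.
    by rewrite expr2 -mulrA g1 mulrCA g2.
  have -> : (2 * j%:R * M * gamma_int M i.+3 = 2 * j%:R * (i.+3%:R * gamma_int M i.+2))%R.
    by rewrite -mulrA g2.
  by rewrite /j -[i.+4%:R]natr1; ring.
have d0' := ltW d0; have di : (0 <= d^-1)%R by rewrite invr_ge0.
have r1 := p0 2%R i.+2 (ler0n _ _); have r2 := p0 _ i.+3 d0'.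
transitivity (\int[mu]_y ((ind (0 < y)%R * (2 * phi M i.+2 y)%:E + ind (0 < y)%R * (d * phi M i.+3 y)%:E) +
   d^-1%:E * X y)).
  apply: eq_integral => y _; rewrite /cell_majorant /X /ind; case: ltP => y0.
    rewrite !mul1e -EFinM -!EFinD; congr (_%:E).
    by rewrite (@phiS _ M i.+2 y y0) (@phiS _ M i.+3 y y0).
  by rewrite !mul0e mule0 !adde0.
have di' : 0 <= d^-1%:E by rewrite lee_fin.
rewrite ge0_integralD; [|by []|by move=> y _; rewrite adde_ge0|by mea|by epos|by mea].
rewrite ge0_integralD; [|by []|by move=> y _|by mea|by move=> y _|by mea].
by rewrite !i0// integralTZl// XE -EFinM -!EFinD.
Qed.

(** A point y lies in at most two of the intervals [c + 1, c + 2], which doubles the cell majorant.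
    The outer parts sum to twice a moment by [esum_inv_sqrt_le], whence 6 = 2 * 2 + 2. *)
Lemma annuli_le i (d : R) : (0 < d)%R ->
  \esum_(c in [set: nat]) annulus i.+3 c <=
  (6 * gamma_int M i + 2 * (d * gamma_int M i.+1) + 2 * (d^-1 * (i.+3%:R * gamma_int M i.+2)))%:E.
Proof.
move=> d0; have mp := measurable_phi M; set j := i.+3.
have mc := measurable_cell_majorant j d; have c0 y := cell_majorant_ge0 j y d0.
pose A c := \int[mu]_y (ind (c.+1%:R <= y <= c.+1%:R + 1)%R * cell_majorant j d y).
pose B c := \int[mu]_a (ind (c.+1%:R + 1 <= a)%R *
      (phi M j a * (a / Num.sqrt (a ^+ 2 - c.+1%:R ^+ 2)))%:E).
have b0 (c : nat) (a : R) : 0 <= ind (c.+1%:R + 1 <= a)%R *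
      (phi M j a * (a / Num.sqrt (a ^+ 2 - c.+1%:R ^+ 2)))%:E.
  rewrite /ind; case: (leP (c.+1%:R + 1)%R a) => h; last by rewrite mul0e.
  have a0 : (0 <= a)%R by apply: le_trans h; rewrite addr_ge0.
  by rewrite mul1e lee_fin mulr_ge0 ?phi_ge0// divr_ge0 ?sqrtr_ge0.
have A0 c : 0 <= A c by rewrite /A; epos.
have B0 c : 0 <= B c by apply: integral_ge0 => a _; exact: b0.
apply: (@le_trans _ _ (\esum_(c in [set: nat]) (A c + B c))).
  by apply: le_esumT => c; exact: annulus_le.
rewrite esumD//.
have AE : \esum_(c in [set: nat]) A c <= 2%:E * \int[mu]_y cell_majorant j d y.
  rewrite /A -integral_esum; [|by move=> c; mea|by epos].
  rewrite -integralTZl//.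
  apply: integral_le; [by apply: measurable_fun_esum; [move=> c; mea|epos]|by mea|by epos|move=> y].
  rewrite (eq_esum (b := fun c => cell_majorant j d y * ind (c.+1%:R <= y <= c.+1%:R + 1)%R)); last first.
    by move=> c _; rewrite muleC.
  rewrite esumZl; [|by []|by epos].
  rewrite muleC; apply: lee_wpmul2r => //.
  (* If y lies in [c + 1, c + 2], then -(c + 1) is one of the two integers n with 0 <= y + n < 2. *)
  rewrite -[leRHS](ind_int_count y 2).
  apply: (@le_esum_inj _ _ _ _ _ _ (fun c : nat => (- (c.+1%:Z))%R)); first by epos.
    by move=> c c' _ _ /oppr_inj [].
  move=> c _; rewrite /ind lee_fin ler_nat.
  case: (boolP (c.+1%:R <= y <= c.+1%:R + 1)%R) => //= /andP[h1 h2].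
  rewrite lt0b mulrNz -pmulrn; apply/andP; split; lra.
have BE : \esum_(c in [set: nat]) B c <= (2 * gamma_int M i)%:E.
  rewrite /B -integral_esum; [|by move=> c; mea|by move=> c a; exact: b0].
  have p0 y : 0 <= ind (0 < y)%R * (phi M i.+2 y)%:E.
    rewrite /ind; case: ltP => y0; last by rewrite mul0e.
    by rewrite mul1e lee_fin phi_ge0// ltW.
  rewrite EFinM -integral_phi// -integralTZl//; last by mea.
  apply: integral_le; [by apply: measurable_fun_esum; [move=> c; mea|move=> c a; exact: b0]|by mea| |move=> y].
    by move=> y; apply: esum_ge0 => c _; exact: b0.
  have [y0|y0] := ltP 0%R y; last first.
    rewrite esum1; first by rewrite /ind mul0e mule0.
    move=> c _; rewrite /ind leNgt (_ : (y < _)%R = true) ?mul0e//.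
    by apply: le_lt_trans y0 _; rewrite ltr_pwDr.
  rewrite (eq_esum (b := fun c => (phi M i.+2 y)%:E * (ind (c.+1%:R + 1 <= y)%R *
     ((Num.sqrt (y ^+ 2 - c.+1%:R ^+ 2))^-1)%:E))); last first.
    move=> c _; rewrite /ind; case: (leP (c.+1%:R + 1)%R y) => _; last by rewrite !mul0e mule0.
    rewrite !mul1e -EFinM (@phiS _ M i.+2 y y0) -/j; congr (_%:E).
    by move: (phi M j y) => P; rewrite mulrCA mulrA.
  have py : 0 <= (phi M i.+2 y)%:E by rewrite lee_fin phi_ge0// ltW.
  rewrite esumZl//; last first.
    by move=> c; apply: mule_ge0; [epos|rewrite lee_fin invr_ge0 sqrtr_ge0].
  rewrite [X in _ <= _ * (X * _)]/ind mul1e muleC; apply: lee_wpmul2r => //.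
  exact: esum_inv_sqrt_le.
apply: (le_trans (leeD AE BE)); rewrite integral_cell_majorant// -EFinM -EFinD lee_fin.
by rewrite -/j le_eqVlt; apply/orP; left; apply/eqP; ring.
Qed.

End Annuli.

(** * Off-diagonal pairs of cosets *)

Section OffDiagonal.
Context {R : realType}.
Local Notation mu := (@lebesgue_measure R).
Implicit Types (v w : int * int) (p : R * R).

(** With (a, b) the top row above v and w = (e, f), vanishing of the determinant gives w = g v for g
    = a f - b e; primitivity of w makes g a unit. *)
Lemma coprime_proportional v w : coprimez v.1 v.2 -> coprimez w.1 w.2 ->
  w.1 * v.2 - w.2 * v.1 = 0 -> w = v \/ w = (- v.1, - v.2).
Proof.
case: v w => c d [e f] /= cop cop' h.
have D := @toprow_det (c, d) cop; have D' := @toprow_det (e, f) cop'; rewrite /= in D D'.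
set a := topa (c, d) in D; set b := topb (c, d) in D.
set a' := topa (e, f) in D'; set b' := topb (e, f) in D'.
pose g := a * f - b * e.
have eE : e = g * c.
  have -> : g * c = e * (a * d - b * c) - a * (e * d - f * c) by rewrite /g; ring.
  by rewrite D h mulr0 subr0 mulr1.
have fE : f = g * d.
  have -> : g * d = f * (a * d - b * c) - b * (e * d - f * c) by rewrite /g; ring.
  by rewrite D h mulr0 subr0 mulr1.
have g1 : g * (a' * d - b' * c) = 1 by rewrite -D' eE fE; ring.
have : (absz g * absz (a' * d - b' * c)%R)%N = 1%N by rewrite -abszM g1.
move/eqP; rewrite muln_eq1 => /andP[/eqP gg _].
have [ge|ge] : g = 1 \/ g = -1 by lia.
  by left; rewrite eE fE ge !mul1r.
by right; rewrite eE fE ge !mulN1r.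
Qed.

Local Open Scope ereal_scope.

Lemma esum_int_abs_le (X : nat -> \bar R) : (forall c, 0 <= X c) ->
  \esum_(c in [set: int]) (ind (c != 0)%R * X `|c|%N.-1) <=
  2%:E * \esum_(c in [set: nat]) X c.
Proof.
move=> X0.
have half (b : int -> bool) : (forall c c' : int, b c -> b c' -> `|c|%N.-1 = `|c'|%N.-1 -> c = c') ->
    \esum_(c in [set: int]) (ind (b c) * X `|c|%N.-1) <= \esum_(c in [set: nat]) X c.
  move=> bi; rewrite esum_ind.
  by apply: (@le_esum_inj _ _ _ _ _ _ (fun c : int => `|c|%N.-1)).
apply: (@le_trans _ _ (\esum_(c in [set: int]) (ind (0 < c)%R * X `|c|%N.-1) +
    \esum_(c in [set: int]) (ind (c < 0)%R * X `|c|%N.-1))).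
  rewrite -esumD; [|by epos|by epos].
  apply: le_esumT => c; rewrite -ge0_muleDl; [|by epos|by epos].
  apply: lee_wpmul2r => //; rewrite /ind -EFinD lee_fin -natrD ler_nat.
  by case: ltgtP.
rewrite (_ : 2%:E = 1 + 1)%E; last by rewrite -EFinD.
rewrite ge0_muleDl ?mul1e ?lee_fin//.
by apply: leeD; apply: half; lia.
Qed.

Section wave.
Variables (M : R) (n : nat).
Hypothesis M0 : (0 < M)%R.

(** The off-diagonal row of the vector (0, 1), whose own height is [p.2]. Primitive w not
    proportional to (0, 1) have nonzero first entry; the sum is enlarged to all such w. *)
Definition wave_sum p : \bar R :=
  wave M n p.2 * \esum_(w in [set: int * int]) (ind (w.1 != 0)%R * wave M n (p.2 / vQ w p)%R).

Definition nonproportional v w : bool :=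
  [&& coprimez w.1 w.2, w != v & w != (- v.1, - v.2)%R].

Definition offdiag p : \bar R :=
  \esum_(v in [set: int * int]) (ind (coprimez v.1 v.2) * (wave M n (p.2 / vQ v p)%R *
    \esum_(w in [set: int * int]) (ind (nonproportional v w) * wave M n (p.2 / vQ w p)%R))).

Let wave0 := wave_ge0 M n.
Let mwave := measurable_wave M n.

Lemma measurable_wave_sum : measurable_fun setT wave_sum.
Proof.
have mq (v : int * int) := @measurable_vQ R v; rewrite /wave_sum.
apply: emeasurable_funM; first by mea.
by apply: measurable_fun_esum => [w|]; [mea|epos].
Qed.

Lemma measurable_offdiag : measurable_fun setT offdiag.
Proof.
have mq (v : int * int) := @measurable_vQ R v.
apply: measurable_fun_esum => [v|]; last by epos.
apply: emeasurable_funM; first by mea.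
apply: emeasurable_funM; first by mea.
by apply: measurable_fun_esum => [w|]; [mea|epos].
Qed.

Lemma offdiag_ge0 p : 0 <= offdiag p. Proof. by rewrite /offdiag; epos. Qed.

(* Multiplying the rows by the inverse of the matrix of v moves v to (0, 1). *)
Lemma offdiag_row_le v p : coprimez v.1 v.2 -> (0 < p.2)%R ->
  wave M n (p.2 / vQ v p)%R *
    (\esum_(w in [set: int * int]) (ind (nonproportional v w) * wave M n (p.2 / vQ w p)%R)) <=
  wave_sum (vmob v p).
Proof.
case: v => c d cop p0; rewrite /wave_sum.
apply: lee_wpmul2l; first exact: wave0.
have D := toprow_det cop; rewrite /= in D.
set a := topa (c, d) in D; set b := topb (c, d) in D.
rewrite esum_ind.
have K (w : int * int) : ((w.1 * d - w.2 * c) * a + (w.2 * a - w.1 * b) * c = w.1)%R /\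
    ((w.1 * d - w.2 * c) * b + (w.2 * a - w.1 * b) * d = w.2)%R.
  split.
    transitivity (w.1 * (a * d - b * c))%R; first by ring.
    by rewrite D mulr1.
  transitivity (w.2 * (a * d - b * c))%R; first by ring.
  by rewrite D mulr1.
apply: (@le_esum_inj _ _ _ _ _ _ (fun w : int * int => (w.1 * d - w.2 * c, w.2 * a - w.1 * b)%R)).
- by epos.
- move=> w w' _ _ [h1 h2]; have [k1 k2] := K w; have [k1' k2'] := K w'.
  have E1 : w.1 = w'.1 by rewrite -[LHS]k1 h1 h2.
  have E2 : w.2 = w'.2 by rewrite -[LHS]k2 h1 h2.
  by rewrite (surjective_pairing w) E1 E2 -surjective_pairing.
move=> w /= /and3P[copw wv wv'].
have w1 : (w.1 * d - w.2 * c != 0)%R.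
  apply/eqP => h; have [E|E] := @coprime_proportional (c, d) w cop copw h.
    by move: wv; rewrite E eqxx.
  by move: wv'; rewrite E eqxx.
rewrite {1}/ind w1 mul1e.
have [k1 k2] := K w.
have Qv := @vQ_gt0 R _ _ p0 (coprime_neq0 cop); have Qw := @vQ_gt0 R _ _ p0 (coprime_neq0 copw).
have -> : vQ (w.1 * d - w.2 * c, w.2 * a - w.1 * b)%R (vmob (c, d) p) = (vQ w p / vQ (c, d) p)%R.
  by rewrite /vmob vQ_imob// k1 k2 -surjective_pairing.
rewrite [X in _ <= wave M n X](_ : _ = p.2 / vQ w p)%R//.
rewrite -[rowQ _ _ p]/(vQ (c, d) p).
by field; rewrite !gt_eqF.
Qed.

Lemma wave_sum_periodic p (m : int) : wave_sum (p.1 + m%:~R, p.2)%R = wave_sum p.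
Proof.
rewrite /wave_sum /=; congr (_ * _).
rewrite (@reindex_esum R _ _ setT setT (fun w : int * int => (w.1, w.2 - w.1 * m)%R)); last first.
  split => //.
    move=> [c d] [c' d'] _ _ [<-] /eqP; rewrite -subr_eq0 => /eqP h; congr (_, _).
    by move/eqP: h; rewrite opprB addrA subrK subr_eq0 => /eqP.
  by move=> [c d] _; exists (c, d + c * m)%R => //=; congr (_, _); ring.
apply: eq_esum => -[c d] _ /=; congr (_ * wave M n (_ / _)).
by rewrite /vQ /rowQ /= !(intrD, intrM, mulrNz, intrN); ring.
Qed.

Lemma hyp_offdiag_le :
  hyp (fun p => ind (fund p) * offdiag p) <=
  2%:E * hyp (fun p => ind (0 <= p.1 < 1)%R * wave_sum p).
Proof.
have mF := @measurable_fund R; have mW := measurable_wave_sum.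
have W0 p : 0 <= wave_sum p by rewrite /wave_sum; epos.
have mq (v : int * int) := @measurable_vQ R v.
have mv v : measurable_fun setT (@vmob R v) by exact: measurable_imob.
rewrite -unfolding//; last exact: wave_sum_periodic.
pose g v p := wave M n (p.2 / vQ v p)%R *
    \esum_(w in [set: int * int]) (ind (nonproportional v w) * wave M n (p.2 / vQ w p)%R).
have mg v : measurable_fun setT (g v).
  apply: emeasurable_funM; first by mea.
  by apply: measurable_fun_esum => [w|]; [mea|epos].
have g0 v p : 0 <= g v p by rewrite /g; epos.
rewrite (_ : hyp _ = hyp (fun p => \esum_(v in [set: int * int])
    (ind (coprimez v.1 v.2) * (ind (fund p) * g v p)))); last first.
  apply: eq_hyp => p p0; rewrite /offdiag -esumZl; [|by epos|by epos].
  by apply: eq_esum => v _; rewrite muleCA.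
rewrite hyp_esum; [|by move=> v; mea|by move=> v p; epos].
apply: le_esumT => v; rewrite hypZl; [|by mea|by move=> p; epos|by epos].
have [cop|cop] := boolP (coprimez v.1 v.2); last by rewrite [ind _]/ind !mul0e.
apply: lee_wpmul2l; first by epos.
apply: le_hyp.
- by mea.
- by mea.
- by move=> p p0; epos.
- by move=> p p0; apply: lee_wpmul2l; [epos|exact: offdiag_row_le].
Qed.

(** For fixed c <> 0 the sum over d is absorbed by [integral_int_affine]: u = c x + d runs over the
    whole line. *)
Lemma strip_wave_sum :
  hyp (fun p => ind (0 <= p.1 < 1)%R * wave_sum p) =
  \esum_(c in [set: int]) (ind (c != 0)%R *
    hyp (fun p => wave M n p.2 * wave M n (p.2 / (p.1 ^+ 2 + (c%:~R * p.2) ^+ 2))%R)).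
Proof.
have mW := measurable_wave_sum; have W0 p : 0 <= wave_sum p by rewrite /wave_sum; epos.
have mw := @measurable_hyp_weight R.
have mq (v : int * int) := @measurable_vQ R v.
rewrite hypE; [|by mea|by move=> p; epos].
pose k (c : int) (y u : R) := wave M n (y / (u ^+ 2 + (c%:~R * y) ^+ 2))%R.
have mk c y : measurable_fun setT (k c y) by rewrite /k; mea.
have k0 c y u : 0 <= k c y u by rewrite /k; epos.
transitivity (\int[mu]_y \esum_(c in [set: int])
    (ind (c != 0)%R * (hyp_weight y * (wave M n y * \int[mu]_u k c y u)))).
  apply: eq_integral => y _.
  transitivity (hyp_weight y * (wave M n y * \esum_(c in [set: int])
      (ind (c != 0)%R * \int[mu]_u k c y u))); last first.
    rewrite -esumZl; [|by epos|by epos]; rewrite -esumZl; [|by epos|by epos].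
    by apply: eq_esum => c _; rewrite (muleCA (wave M n y)) (muleCA (hyp_weight y)).
  congr (_ * _).
  transitivity (\int[mu]_x (wave M n y * \esum_(w in [set: int * int])
      (ind (w.1 != 0)%R * (ind (0 <= x < 1)%R * k w.1 y (w.1%:~R * x + w.2%:~R)%R)))).
    apply: eq_integral => x _; rewrite /wave_sum /= muleCA; congr (_ * _).
    rewrite -esumZl; [|by epos|by epos].
    by apply: eq_esum => w _; rewrite muleCA.
  rewrite ge0_integralZl//; last 2 first.
  - by apply: measurable_fun_esum => [w|]; [have mk' := mk w.1 y; mea|epos].
  - by epos.
  congr (_ * _); rewrite integral_esum; last 2 first.
  - by move=> w; have mk' := mk w.1 y; mea.
  - by move=> w x; epos.
  rewrite -(@esum_pairT R _ _ (fun c d : int => \int[mu]_x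
     (ind (c != 0)%R * (ind (0 <= x < 1)%R * k c y (c%:~R * x + d%:~R)%R)))); last first.
    by move=> c d; epos.
  apply: eq_esum => c _.
  rewrite {2}/ind; case: (boolP (c != 0)%R) => c0; last first.
    rewrite mul0e esum1// => d _; rewrite integral0_eq// => x _.
    by rewrite /ind mul0e.
  rewrite mul1e -(integral_int_affine c0 (mk c y) (k0 c y)).
  by apply: eq_esum => d _; apply: eq_integral => x _; rewrite {1}/ind mul1e.
have mk2 (c : int) : measurable_fun setT (fun y : R => \int[mu]_u k c y u).
  by apply: measurable_fun_integral => //; rewrite /k; mea.
rewrite integral_esum; last 2 first.
- by move=> c; apply: emeasurable_funM; [mea|]; apply: emeasurable_funM; [mea|]; apply: emeasurable_funM; [mea|exact: mk2].
- by move=> c y; epos.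
apply: eq_esum => c _.
rewrite ge0_integralZl//; last 3 first.
- by apply: emeasurable_funM; [mea|apply: emeasurable_funM; [mea|exact: mk2]].
- by epos.
- by epos.
congr (_ * _); rewrite hypE; [|by mea|by move=> p; epos].
apply: eq_integral => y _; congr (_ * _).
by rewrite -ge0_integralZl; [|by []|exact: mk|by epos|by epos].
Qed.

Lemma measurable_phi_radius j (C : R) :
  measurable_fun setT (fun t : R => phi M j (Num.sqrt (t ^+ 2 + C))).
Proof. by have mp := measurable_phi M; mea. Qed.

(** With x = t y, the second height is 1 / (y a^2) for a^2 = t^2 + c^2, so [haar_wave_le] integrates
    out y. The factor a lowers the exponent from 2 n to 2 n - 1, and evenness in t leaves half-line
    integrals. *)
Lemma hyp_wave_pair_le (c : int) (r : R) : (c != 0)%R -> (0 < r)%R -> (0 < n)%N ->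
  hyp (fun p => wave M n p.2 * wave M n (p.2 / (p.1 ^+ 2 + (c%:~R * p.2) ^+ 2))%R) <=
  2%:E * ((2 / r)%:E * annulus M (2 * n) `|c|%N.-1 +
          (4 * r / M)%:E * annulus M (2 * n).-1 `|c|%N.-1).
Proof.
move=> c0 r0 n0.
have cE : (`|c|%N.-1.+1%:R ^+ 2 = c%:~R ^+ 2 :> R)%R.
  rewrite prednK ?absz_gt0// pmulrn abszE -[RHS]ger0_norm ?sqr_ge0//.
  by rewrite normrX intr_norm.
have c2 : (0 < c%:~R ^+ 2 :> R)%R by rewrite exprn_even_gt0//= intr_eq0.
pose a (t : R) := Num.sqrt (t ^+ 2 + c%:~R ^+ 2).
have ap (t : R) : (0 < t ^+ 2 + c%:~R ^+ 2)%R by rewrite ltr_wpDl ?sqr_ge0.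
have a0 t : (0 < a t)%R by rewrite sqrtr_gt0.
have a2 t : (a t ^+ 2 = t ^+ 2 + c%:~R ^+ 2)%R by rewrite sqr_sqrtr// ltW.
have mP j := measurable_phi_radius j (c%:~R ^+ 2)%R.
have P0 j t : 0 <= (phi M j (a t))%:E by rewrite lee_fin phi_ge0// ltW.
have k1 : (0 <= 2 / r)%R by rewrite divr_ge0// ltW.
have k2 : (0 <= 4 * r / M)%R by rewrite divr_ge0 ?mulr_ge0// ltW.
have k1' : 0 <= (2 / r)%:E by []; have k2' : 0 <= (4 * r / M)%:E by [].
rewrite hyp_haar; [|by mea|by move=> p; epos].
pose T t := (2 / r)%:E * (phi M (2 * n) (a t))%:E + (4 * r / M)%:E * (phi M (2 * n).-1 (a t))%:E.
have mT : measurable_fun setT T by rewrite /T /a; mea.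
have T0 t : 0 <= T t by rewrite /T; apply: adde_ge0; epos.
apply: (@le_trans _ _ (\int[mu]_t T t)).
  apply: integral_le => //.
  - apply: measurable_fun_integral; last by move=> t y; epos.
    by mea.
  - by move=> t; epos.
  move=> t.
  rewrite (_ : haar _ = haar (fun y => wave M n y * wave M n (1 / (y * a t ^+ 2))%R)); last first.
    apply: eq_integral => y _; rewrite /ind; case: (ltP 0%R y) => y0; last by rewrite !mul0e.
    congr (_ * (_ * wave M n _)) => /=; rewrite a2 !exprMn.
    by rewrite -mulrDl; have := ap t; move: (t ^+ 2 + c%:~R ^+ 2)%R => q q0; field; rewrite !gt_eqF.
  apply: le_trans (haar_wave_le M0 n (a0 t) r0) _.
  rewrite /T -!EFinM -EFinD lee_fin lerD2l.
  by rewrite (@phiS _ M (2 * n).-1 (a t) (a0 t)) prednK ?muln_gt0.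
have TN t : T (- t)%R = T t by rewrite /T /a sqrrN.
apply: le_trans (integral_even_le mT T0 TN) _.
apply: lee_wpmul2l => //.
have I0 j (t : R) : 0 <= ind (0 <= t)%R * (phi M j (Num.sqrt (t ^+ 2 + c%:~R ^+ 2)))%:E.
  by apply: mule_ge0; [epos|exact: P0].
have mI j : measurable_fun setT (fun t : R => ind (0 <= t)%R *
    (phi M j (Num.sqrt (t ^+ 2 + c%:~R ^+ 2)))%:E) by mea.
rewrite /annulus cE -integralTZl; [|exact: mI|exact: I0|by []].
rewrite -integralTZl; [|exact: mI|exact: I0|by []].
rewrite -ge0_integralD; [|by []|by move=> t _; rewrite mule_ge0| |by move=> t _; rewrite mule_ge0|]; last 2 first.
- by apply: emeasurable_funM; [exact: measurable_cst|exact: mI].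
- by apply: emeasurable_funM; [exact: measurable_cst|exact: mI].
rewrite le_eqVlt; apply/orP; left; apply/eqP; apply: eq_integral => t _.
by rewrite /T ge0_muleDr ?mule_ge0//; congr (_ + _); rewrite muleCA.
Qed.

Lemma hyp_offdiag_annuli (r : R) : (0 < r)%R -> (0 < n)%N ->
  hyp (fun p => ind (fund p) * offdiag p) <=
  8%:E * ((2 / r)%:E * (\esum_(c in [set: nat]) annulus M (2 * n) c) +
          (4 * r / M)%:E * (\esum_(c in [set: nat]) annulus M (2 * n).-1 c)).
Proof.
move=> r0 n0; apply: (le_trans hyp_offdiag_le); rewrite strip_wave_sum.
have A0 j c : 0 <= annulus M j c.
  by apply: integral_ge0 => t _; apply: mule_ge0; [epos|rewrite lee_fin phi_ge0// sqrtr_ge0].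
have k1 : 0 <= (2 / r)%:E by rewrite lee_fin divr_ge0// ltW.
have k2 : 0 <= (4 * r / M)%:E by rewrite lee_fin divr_ge0 ?mulr_ge0// ltW.
pose X c := 2%:E * ((2 / r)%:E * annulus M (2 * n) c + (4 * r / M)%:E * annulus M (2 * n).-1 c).
have X0 c : 0 <= X c by rewrite /X mule_ge0// adde_ge0// mule_ge0.
have E : \esum_(c in [set: nat]) X c = 2%:E * ((2 / r)%:E * (\esum_(c in [set: nat]) annulus M (2 * n) c) +
          (4 * r / M)%:E * (\esum_(c in [set: nat]) annulus M (2 * n).-1 c)).
  rewrite /X esumZl//; last by move=> c; rewrite adde_ge0// mule_ge0.
  by rewrite esumD; [rewrite !esumZl|by move=> c _; rewrite mule_ge0|by move=> c _; rewrite mule_ge0].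
(* One factor 2 comes from unfolding, one from the sign of c and one from the sign of t. *)
rewrite (_ : 8%:E = 2%:E * (2%:E * 2%:E)); last by rewrite -!EFinM; congr (_%:E); ring.
rewrite -[leRHS]muleA -[X in _ <= _ * X]muleA -E.
apply: lee_wpmul2l => //; apply: le_trans (esum_int_abs_le X0).
apply: le_esumT => c; rewrite /ind; case: (boolP (c != 0)%R) => c0; last by rewrite !mul0e.
by rewrite !mul1e; exact: hyp_wave_pair_le.
Qed.

End wave.

(** Here s^2 / r = M k^{-3/2} and 1 / s = (k / M)^{1/2}, and the moment of order k - 2 is the N of
    the overview. The overlap parameter is r = sqrt(k), since the radius a concentrates near M / k,
    where M / a has size k. *)
Lemma hyp_offdiag_bound (M k s r : R) (i : nat) : (0 < M)%R ->
  k = (2 * i.+3)%:R%R -> s = Num.sqrt (M / k) -> r = Num.sqrt k ->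
  hyp (fun p => ind (fund p) * offdiag M i.+3 p) <=
  ((960 * (s ^+ 2 / r) + 320 / s) * gamma_int M (2 * i.+2))%:E.
Proof.
move=> M0 kD sD rD.
have k0 : (0 < k)%R by rewrite kD ltr0n.
have l0 : (0 < M / k)%R by rewrite divr_gt0.
have s0 : (0 < s)%R by rewrite sD sqrtr_gt0.
have r0 : (0 < r)%R by rewrite rD sqrtr_gt0.
have sE : (s ^+ 2 = M / k)%R by rewrite sD sqr_sqrtr// ltW.
have rE : (r ^+ 2 = k)%R by rewrite rD sqr_sqrtr// ltW.
move: s r {sD rD} s0 r0 sE rE => s r s0 r0 sE rE.
(* This d balances the last two terms of [annuli_le]: by the recursion of the moments, k times the
   next moment is at most d^2 times the current one. *)
pose d := (r / s)%R; have d0 : (0 < d)%R by rewrite divr_gt0.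
apply: (le_trans (hyp_offdiag_annuli M0 r0 (ltn0Sn _))).
pose j := (2 * i)%N.
have e1 : (2 * i.+3 = j.+3.+3)%N by rewrite /j; lia.
have e2 : (2 * i.+2 = j.+4)%N by rewrite /j; lia.
rewrite e2 e1 /=.
have h1 := annuli_le M0 j.+3 d0; have h2 := annuli_le M0 j.+2 d0.
have g1 := gamma_intS M0 j.+4; have g2 := gamma_intS M0 j.+3; have g3 := gamma_intS M0 j.+2.
have N0 := gamma_int_gt0 M0 j.+4; have A0 := gamma_int_gt0 M0 j.+3.
have kE : (k = j.+3.+3%:R :> R)%R by rewrite kD e1.
have q1 : (j.+4.+1%:R = k - 1 :> R)%R by rewrite kE -[j.+3.+3%:R]natr1 addrK.
have q2 : (j.+4%:R = k - 2 :> R)%R by have := q1; rewrite -[j.+4.+1%:R]natr1; lra.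
have q3 : (j.+3%:R = k - 3 :> R)%R by have := q2; rewrite -[j.+4%:R]natr1; lra.
have k6 : (6 <= k)%R by rewrite kE ler_nat.
rewrite -kE in h1; rewrite q1 in h2 g1; rewrite q2 in g2; rewrite q3 in g3.
move: h1 h2 g1 g2 g3 N0 A0.
move: (gamma_int M j.+4) (gamma_int M j.+3) (gamma_int M j.+2) (gamma_int M j.+4.+1) => N A B E.
move=> h1 h2 g1 g2 g3 N0 A0.
have Mk : (M = s ^+ 2 * k)%R by rewrite sE divfK// gt_eqF.
have dE : (d ^+ 2 = k / s ^+ 2)%R by rewrite /d expr_div_n rE.
have s20 : (0 < s ^+ 2)%R by rewrite exprn_gt0.
(* Lowering the order of a moment costs about M / k = s^2; as k >= 6, the shifts k - 2 and k - 3 are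
   at least k / 2, whence the factor 2. *)
have AN : (A <= 2 * s ^+ 2 * N)%R.
  have hk : (0 < k - 2)%R by lra.
  rewrite -(ler_pM2l hk) -g2 Mk.
  have -> : (s ^+ 2 * k * N = k * (s ^+ 2 * N))%R by ring.
  have -> : ((k - 2) * (2 * s ^+ 2 * N) = (2 * (k - 2)) * (s ^+ 2 * N))%R by ring.
  by rewrite ler_wpM2r ?mulr_ge0 ?(ltW s20) ?(ltW N0)//; lra.
have BA : (B <= 2 * s ^+ 2 * A)%R.
  have hk : (0 < k - 3)%R by lra.
  rewrite -(ler_pM2l hk) -g3 Mk.
  have -> : (s ^+ 2 * k * A = k * (s ^+ 2 * A))%R by ring.
  have -> : ((k - 3) * (2 * s ^+ 2 * A) = (2 * (k - 3)) * (s ^+ 2 * A))%R by ring.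
  by rewrite ler_wpM2r ?mulr_ge0 ?(ltW s20) ?(ltW A0)//; lra.
have Md : (M * d ^+ 2 = k ^+ 2)%R by rewrite Mk dE; field; rewrite gt_eqF.
have EN : (k * E <= d ^+ 2 * N)%R.
  rewrite -(ler_pM2l M0) mulrCA g1 [leRHS]mulrA Md expr2 -mulrA ler_wpM2l ?(ltW k0)//.
  by rewrite ler_wpM2r ?(ltW N0)//; lra.
have NA : ((k - 1) * N <= d ^+ 2 * A)%R.
  rewrite -(ler_pM2l M0) mulrCA g2 [leRHS]mulrA Md [leLHS]mulrA.
  by rewrite ler_wpM2r ?(ltW A0)//; nra.
have dd (x y : R) : (x <= d ^+ 2 * y -> d^-1 * x <= d * y)%R.
  by move=> h; rewrite ler_pdivrMl// mulrA -expr2.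
have W1 : \esum_(c in [set: nat]) annulus M j.+3.+3 c <= ((12 * s ^+ 2 + 4 * d) * N)%:E.
  apply: (le_trans h1); rewrite lee_fin; have := dd _ _ EN; clear -AN.
  by move: (d^-1 * _)%R => x; lra.
have W2 : \esum_(c in [set: nat]) annulus M j.+4.+1 c <= ((12 * s ^+ 2 + 4 * d) * (2 * s ^+ 2 * N))%:E.
  apply: (@le_trans _ _ ((12 * s ^+ 2 + 4 * d) * A)%:E).
    apply: (le_trans h2); rewrite lee_fin; have := dd _ _ NA; clear -BA.
    by move: (d^-1 * _)%R => x; lra.
  by rewrite lee_fin; apply: ler_wpM2l => //; apply: addr_ge0; apply: mulr_ge0 => //; exact: ltW.
apply: (@le_trans _ _ (8%:E * ((2 / r)%:E * ((12 * s ^+ 2 + 4 * d) * N)%:E +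
    (4 * r / M)%:E * ((12 * s ^+ 2 + 4 * d) * (2 * s ^+ 2 * N))%:E))).
  apply: lee_wpmul2l => //; apply: leeD; apply: lee_wpmul2l => //.
    by rewrite lee_fin divr_ge0// ltW.
  by rewrite lee_fin divr_ge0 ?mulr_ge0// ltW.
(* Since M = s^2 r^2, the total is 8 (2/r + 8/r) (12 s^2 + 4 r/s) N, which produces 960 and 320. *)
rewrite -(EFinM (2 / r)%R) -(EFinM (4 * r / M)%R) -EFinD -EFinM lee_fin le_eqVlt; apply/orP; left; apply/eqP.
by rewrite Mk -rE /d; field; rewrite !gt_eqF.
Qed.

End OffDiagonal.

#[local] Existing Instance totally_filter.

(** * Unconditional sums of real families *)

Section Summation.
Context {R : realType} {I : choiceType}.
Implicit Types (c x : I -> R) (A B : {fset I}).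

Lemma partial_sumE (V : zmodType) (x : I -> V) A : partial_sum x A = \sum_(i <- A) x i.
Proof. by rewrite /partial_sum big_seq_fsetE. Qed.

Lemma sum_le_esum (c : I -> \bar R) B :
  (\sum_(i <- B) c i <= \esum_(i in [set: I]) c i)%E.
Proof.
apply: esum_ge; exists [set` B]; first by split => //; exact: finite_fset.
by rewrite -fsbig_seq ?fset_uniq.
Qed.

Lemma esum_approx c (e : R) : (\esum_(i in [set: I]) (c i)%:E)%E \is a fin_num -> 0 < e ->
  exists B, fine (\esum_(i in [set: I]) (c i)%:E)%E - e < \sum_(i <- B) c i.
Proof.
move=> fin e0; have [_ [X [fX _] <-] h] := ub_ereal_sup_adherent e0 fin.
exists (fset_set X); rewrite -lte_fin EFinB fineK//; apply: (lt_le_trans h).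
by rewrite fsbig_finite// sumEFin.
Qed.

Lemma ler_sum_fset c A B : (forall i, 0 <= c i) -> (A `<=` B)%fset ->
  \sum_(i <- A) c i <= \sum_(i <- B) c i.
Proof.
move=> c0 AB; rewrite big_seq_cond.
rewrite (eq_bigr (fun i => if i \in A then c i else 0)); last by move=> i /andP[-> _].
rewrite -big_seq_cond (big_fset_incl _ AB); last by move=> i _ /negbTE ->.
by apply: ler_sum => i _; case: ifP.
Qed.

Lemma cvg_partial_sum c : (forall i, 0 <= c i) ->
  (\esum_(i in [set: I]) (c i)%:E)%E \is a fin_num ->
  partial_sum c @ totally --> fine (\esum_(i in [set: I]) (c i)%:E)%E.
Proof.
move=> c0 fin; apply/cvgrPdist_lt => e e0.
have [B hB] := esum_approx fin e0; exists B => // D BD /=.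
rewrite partial_sumE ger0_norm; last first.
  by rewrite subr_ge0 -lee_fin fineK// -sumEFin; exact: sum_le_esum.
by rewrite ltrBlDl -ltrBlDr (lt_le_trans hB)//; exact: ler_sum_fset.
Qed.

(* Sum of an absolutely summable real family, as a difference of two sums of
   nonnegative terms; this form makes measurability in a parameter visible. *)
Definition rsum x : R :=
  fine (\esum_(i in [set: I]) (Num.max (x i) 0)%:E)%E -
  fine (\esum_(i in [set: I]) (Num.max (- x i) 0)%:E)%E.

Lemma esum_fin_le (a b : I -> R) : (forall i, 0 <= a i) -> (forall i, a i <= b i) ->
  (\esum_(i in [set: I]) (b i)%:E)%E \is a fin_num ->
  (\esum_(i in [set: I]) (a i)%:E)%E \is a fin_num.
Proof.
move=> a0 ab fb; rewrite ge0_fin_numE; last by apply: esum_ge0 => i _; rewrite lee_fin.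
have b0 i := le_trans (a0 i) (ab i).
have : (\esum_(i in [set: I]) (b i)%:E < +oo)%E.
  by rewrite -ge0_fin_numE//; apply: esum_ge0 => i _; rewrite lee_fin.
by apply: le_lt_trans; apply: le_esumT => i; rewrite lee_fin.
Qed.

Lemma cvg_rsum x a : (forall i, `|x i| <= a i) ->
  (\esum_(i in [set: I]) (a i)%:E)%E \is a fin_num ->
  partial_sum x @ totally --> rsum x.
Proof.
move=> xa fa.
have m0 (t : R) : 0 <= Num.max t 0 by rewrite le_max lexx orbT.
have p1 i : Num.max (x i) 0 <= a i.
  by rewrite ge_max (le_trans (ler_norm _) (xa i)) (le_trans (normr_ge0 _) (xa i)).
have p2 i : Num.max (- x i) 0 <= a i.
  by rewrite ge_max (le_trans (ler_norm _) _) ?normrN ?xa// (le_trans (normr_ge0 _) (xa i)).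
have -> : partial_sum x = (fun A => partial_sum (fun i => Num.max (x i) 0) A -
     partial_sum (fun i => Num.max (- x i) 0) A).
  apply/funext => A; rewrite !partial_sumE -sumrB; apply: eq_bigr => i _.
  have [h|h] := leP (x i) 0.
    by rewrite max_l ?oppr_ge0// sub0r opprK.
  by rewrite max_r ?oppr_le0 ?(ltW h)// subr0.
by apply: cvgB; apply: cvg_partial_sum => //; [exact: (esum_fin_le _ p1)|exact: (esum_fin_le _ p2)].
Qed.

End Summation.

(** * Complex families and the squared modulus of their sum *)

Section ComplexLimits.
Context {R : realType}.
Implicit Types z w : R[i].

(** The norm of [R[i]] takes its values in [R[i]]; this is its square as a real number. *)
Definition cabs2 z : R := complex.Re z ^+ 2 + complex.Im z ^+ 2.

Lemma cabs2E z : (cabs2 z)%:C = `|z| ^+ 2.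
Proof. exact: add_Re2_Im2. Qed.

Lemma cabs2M z w : cabs2 (z * w) = cabs2 z * cabs2 w.
Proof. by apply: complexI; rewrite rmorphM /= !cabs2E normrM exprMn. Qed.

Lemma cabs2V z : cabs2 z^-1 = (cabs2 z)^-1.
Proof. by apply: complexI; rewrite fmorphV /= !cabs2E normfV exprVn. Qed.

Lemma cabs2X z n : cabs2 (z ^+ n) = cabs2 z ^+ n.
Proof. by apply: complexI; rewrite rmorphXn /= !cabs2E normrX -!exprM mulnC. Qed.

Lemma cvg_complex (T : Type) (F : set_system T) (f : T -> R[i]^o) (a b : R) : Filter F ->
  complex.Re (f x) @[x --> F] --> a -> complex.Im (f x) @[x --> F] --> b ->
  f x @[x --> F] --> (a +i* b : R[i]^o).
Proof.
move=> FF ha hb; apply/cvgrPdist_lt => e; rewrite ltcE /= => /andP[/eqP eI e0].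
have e2 : 0 < complex.Re e / 2 by rewrite divr_gt0.
have eE : e = (complex.Re e)%:C by move: eI; case: (e) => er ei /= ->.
near=> x.
have h1 : `|a - complex.Re (f x)| < complex.Re e / 2.
  by near: x; move/cvgrPdist_lt: ha; exact.
have h2 : `|b - complex.Im (f x)| < complex.Re e / 2.
  by near: x; move/cvgrPdist_lt: hb; exact.
rewrite [ltRHS]eE normc_def ltcR.
have -> : complex.Re ((a +i* b : R[i]) - f x) = a - complex.Re (f x) by case: (f x).
have -> : complex.Im ((a +i* b : R[i]) - f x) = b - complex.Im (f x) by case: (f x).
move: h1 h2; set u := a - _; set v := b - _ => h1 h2.
apply: (@le_lt_trans _ _ (`|u| + `|v|)); last by lra.
rewrite -[leRHS]ger0_norm ?addr_ge0// -sqrtr_sqr ler_wsqrtr//.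
have uE : u ^+ 2 = `|u| ^+ 2 by rewrite real_normK// num_real.
have vE : v ^+ 2 = `|v| ^+ 2 by rewrite real_normK// num_real.
by rewrite uE vE; have := mulr_ge0 (normr_ge0 u) (normr_ge0 v); nra.
Unshelve. all: by end_near. Qed.

Lemma abs_Re_le z (a : R) : 0 <= a -> cabs2 z = a ^+ 2 -> `|complex.Re z| <= a.
Proof.
move=> a0 h; rewrite -[leRHS]ger0_norm// -!sqrtr_sqr ler_wsqrtr// -h.
by rewrite lerDl sqr_ge0.
Qed.

Lemma abs_Im_le z (a : R) : 0 <= a -> cabs2 z = a ^+ 2 -> `|complex.Im z| <= a.
Proof.
move=> a0 h; rewrite -[leRHS]ger0_norm// -!sqrtr_sqr ler_wsqrtr// -h.
by rewrite lerDr sqr_ge0.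
Qed.

Section family.
Variables (I : choiceType) (u : I -> R[i]) (a : I -> R).
Hypotheses (a0 : forall i, 0 <= a i) (ua : forall i, cabs2 (u i) = a i ^+ 2)
  (fa : (\esum_(i in [set: I]) (a i)%:E)%E \is a fin_num).

Let xr i := complex.Re (u i).
Let xi i := complex.Im (u i).

Lemma partial_sum_Re A : complex.Re (partial_sum u A) = partial_sum xr A.
Proof.
rewrite !partial_sumE; apply: (big_morph (@complex.Re R)) => //.
by case=> ? ? [].
Qed.

Lemma partial_sum_Im A : complex.Im (partial_sum u A) = partial_sum xi A.
Proof.
rewrite !partial_sumE; apply: (big_morph (@complex.Im R)) => //.
by case=> ? ? [].
Qed.

Lemma cvg_Re : partial_sum xr @ totally --> rsum xr.
Proof. by apply: cvg_rsum fa => i; exact: abs_Re_le. Qed.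

Lemma cvg_Im : partial_sum xi @ totally --> rsum xi.
Proof. by apply: cvg_rsum fa => i; exact: abs_Im_le. Qed.

Lemma complex_sumE : sum (u : I -> R[i]^o) = rsum xr +i* rsum xi.
Proof.
apply: cvg_lim; first exact: norm_hausdorff.
apply: cvg_complex.
  by under eq_cvg do rewrite partial_sum_Re; exact: cvg_Re.
by under eq_cvg do rewrite partial_sum_Im; exact: cvg_Im.
Qed.

Lemma esum_sqr_fin : (\esum_(i in [set: I]) (a i ^+ 2)%:E)%E \is a fin_num.
Proof.
set S := fine (\esum_(i in [set: I]) (a i)%:E)%E.
have aS i : a i <= S.
  rewrite -lee_fin fineK//.
  by have := sum_le_esum (fun i => (a i)%:E) [fset i]%fset; rewrite big_seq_fset1.
have S0 (i : I) : 0 <= S := le_trans (a0 i) (aS i).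
apply: (@esum_fin_le _ _ _ (fun i => S * a i)); first by move=> i; exact: sqr_ge0.
  by move=> i; rewrite expr2 ler_wpM2r.
rewrite ge0_fin_numE; last by apply: esum_ge0 => i _; rewrite lee_fin mulr_ge0 ?(S0 i).
(* S is known to be nonnegative only from an element of I; [|S|] also serves for empty I. *)
have -> : (\esum_(i in [set: I]) (S * a i)%:E = \esum_(i in [set: I]) (`|S| * a i)%:E)%E.
  by apply: eq_esum => i _; rewrite ger0_norm// (S0 i).
apply: (@le_lt_trans _ _ (`|S|%:E * S%:E)%E); last by rewrite -EFinM ltry.
apply: ub_ereal_sup => _ [X [fX _] <-].
rewrite fsbig_finite//= sumEFin -mulr_sumr EFinM lee_wpmul2l ?lee_fin//.
rewrite -lee_fin fineK// -sumEFin; exact: sum_le_esum.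
Qed.

Variable nu : I -> I.
Hypotheses (nuK : forall i, nu (nu i) = i) (nu_neq : forall i, nu i != i)
  (u_nu : forall i, u (nu i) = u i).

Definition family_offdiag : \bar R :=
  (\esum_(i in [set: I]) ((a i)%:E *
    \esum_(j in [set: I]) (ind ((j != i) && (j != nu i)) * (a j)%:E)))%E.

Let dot i j := xr i * xr j + xi i * xi j.

Lemma dot_le i j : `|dot i j| <= a i * a j.
Proof.
rewrite -[leRHS]ger0_norm ?mulr_ge0// -!sqrtr_sqr ler_wsqrtr// exprMn -!ua /dot /cabs2 -/(xr i) -/(xi i) -/(xr j) -/(xi j).
by have := sqr_ge0 (xr i * xi j - xi i * xr j); nra.
Qed.

(** Squaring out the sum, the pairs (i, i) and (i, nu i) contribute a_i^2 each because u is
    invariant under nu, whence the factor 2. The remaining pairs are bounded by Cauchy-Schwarz. *)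
Lemma finite_offdiag (A : {fset I}) : (forall i, i \in A -> nu i \in A) ->
  ((`|(partial_sum xr A) ^+ 2 + (partial_sum xi A) ^+ 2 -
      2 * partial_sum (fun i => a i ^+ 2) A|)%:E <= family_offdiag)%E.
Proof.
move=> Anu; rewrite !partial_sumE.
pose Q i j := (j != i) && (j != nu i).
have row i : i \in A -> \sum_(j <- A) dot i j = 2 * a i ^+ 2 + \sum_(j <- A | Q i j) dot i j.
  move=> iA; rewrite (bigD1_seq i) ?fset_uniq//= -big_filter.
  rewrite (bigD1_seq (nu i)) ?filter_uniq ?fset_uniq ?mem_filter ?nu_neq ?Anu//=.
  rewrite big_filter_cond addrA; congr (_ + _).
  have dd : dot i i = a i ^+ 2 by rewrite -ua /dot /cabs2 -!expr2.
  have -> : dot i (nu i) = dot i i by rewrite /dot /xr /xi !u_nu.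
  by rewrite dd mulr_natl mulr2n.
have -> : (\sum_(i <- A) xr i) ^+ 2 + (\sum_(i <- A) xi i) ^+ 2 - 2 * (\sum_(i <- A) a i ^+ 2) =
    \sum_(i <- A) \sum_(j <- A | Q i j) dot i j.
  rewrite !expr2 !big_distrlr /= -big_split /=.
  rewrite (eq_bigr (fun i => \sum_(j <- A) dot i j)); last by move=> i _; rewrite -big_split.
  rewrite big_seq (eq_bigr _ row) -big_seq big_split /= mulr_sumr addrAC subrr add0r//.
apply: (@le_trans _ _ (\sum_(i <- A) ((a i)%:E *
    \esum_(j in [set: I]) (ind ((j != i) && (j != nu i)) * (a j)%:E)))%E); last exact: sum_le_esum.
apply: (@le_trans _ _ (\sum_(i <- A) (a i * \sum_(j <- A | Q i j) a j))%:E).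
  rewrite lee_fin; apply: le_trans (ler_norm_sum _ _ _) _; apply: ler_sum => i _.
  apply: le_trans (ler_norm_sum _ _ _) _; rewrite mulr_sumr; apply: ler_sum => j _.
  exact: dot_le.
rewrite -sumEFin; apply: lee_sum => i _; rewrite EFinM; apply: lee_wpmul2l; first by rewrite lee_fin.
rewrite big_mkcond /= -sumEFin.
rewrite (eq_bigr (fun j => ind ((j != i) && (j != nu i)) * (a j)%:E)%E); first exact: sum_le_esum.
by move=> j _; rewrite /Q /ind; case: (_ && _); rewrite ?mul1e ?mul0e.
Qed.

(** A strict violation would persist for all large finite index sets; adding the image under nu
    makes such a set stable, contrary to [finite_offdiag]. *)
Lemma sum_square_offdiag :
  ((`|(rsum xr) ^+ 2 + (rsum xi) ^+ 2 -
      2 * fine (\esum_(i in [set: I]) (a i ^+ 2)%:E)%E|)%:E <= family_offdiag)%E.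
Proof.
have O0 : (0 <= family_offdiag)%E.
  apply: esum_ge0 => i _; apply: mule_ge0; first by rewrite lee_fin.
  by apply: esum_ge0 => j _; apply: mule_ge0; [exact: ind_ge0|rewrite lee_fin].
case E : family_offdiag O0 => [b| |//]; last by rewrite !leey.
rewrite lee_fin => b0; rewrite lee_fin leNgt; apply/negP => lt.
have c2 : partial_sum (fun i => a i ^+ 2) @ totally --> fine (\esum_(i in [set: I]) (a i ^+ 2)%:E)%E.
  by apply: cvg_partial_sum => [i|]; [exact: sqr_ge0|exact: esum_sqr_fin].
have cv : `|(partial_sum xr A) ^+ 2 + (partial_sum xi A) ^+ 2 -
      2 * partial_sum (fun i => a i ^+ 2) A| @[A --> totally] -->
    `|(rsum xr) ^+ 2 + (rsum xi) ^+ 2 - 2 * fine (\esum_(i in [set: I]) (a i ^+ 2)%:E)%E|.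
  apply: cvg_norm; apply: cvgB; last by apply: cvgM; [exact: cvg_cst|exact: c2].
  by apply: cvgD; rewrite expr2; under eq_cvg do rewrite expr2; apply: cvgM;
    first [exact: cvg_Re|exact: cvg_Im].
have [A _ HA] := cvgr_gt _ cv _ lt.
pose B := (A `|` [fset nu i | i in A])%fset.
have Bnu i : i \in B -> nu i \in B.
  rewrite !inE => /orP[iA|/imfsetP[j /= jA ->]].
    by apply/orP; right; apply/imfsetP; exists i.
  by rewrite nuK jA.
have := finite_offdiag Bnu; rewrite E lee_fin leNgt => /negP; apply.
by apply: HA; rewrite /= fsubsetUl.
Qed.

End family.
End ComplexLimits.

(** * Pointwise comparison of the squared Poincare series with the incomplete Eisenstein series *)

Section PoincarePointwise.
Context {R : realType}.
Implicit Types (v w : int * int) (p : R * R) (A : 'M[int]_2).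

Lemma intrC (c : int) : c%:~R = (c%:~R)%:C :> R[i].
Proof. by rewrite (rmorph_int (real_complex R)). Qed.

Lemma natrC (c : nat) : c%:R = (c%:R)%:C :> R[i].
Proof. by rewrite (rmorph_nat (real_complex R)). Qed.

Lemma SL2Z_det A : SL2Z A -> A 0 0 * A 1 1 - A 0 1 * A 1 0 = 1.
Proof.
rewrite /SL2Z /= => <-.
rewrite (expand_det_row _ 0) !big_ord_recl big_ord0 addr0 /cofactor !det_mx11.
rewrite !mxE /= expr0 expr1 mul1r mulN1r mulrN.
have -> : lift 0 0 = 1 :> 'I_2 by apply/val_inj.
by have -> : lift 1 0 = 0 :> 'I_2 by apply/val_inj.
Qed.

Lemma autjE A p : autj A (ofxy p) =
  ((A 1 0)%:~R * p.1 + (A 1 1)%:~R) +i* ((A 1 0)%:~R * p.2).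
Proof. by rewrite /autj /ofxy !intrC; simpc. Qed.

Lemma autj_neq0 A p : SL2Z A -> 0 < p.2 -> autj A (ofxy p) != 0.
Proof.
move=> /SL2Z_det D p0; rewrite autjE eq_complex /= negb_and.
have [E|E] := eqVneq (A 1 0) 0; last first.
  by apply/orP; right; rewrite mulf_neq0 ?intr_eq0// gt_eqF.
apply/orP; left; rewrite E mul0r add0r intr_eq0.
by apply/eqP => F; move: D; rewrite E F !mulr0 subrr.
Qed.

Lemma mobius_imob A p : SL2Z A -> 0 < p.2 ->
  mobius A (ofxy p) = ofxy (imob (A 0 0) (A 0 1) (A 1 0) (A 1 1) p).
Proof.
move=> SA p0; have w0 := autj_neq0 SA p0; have D := SL2Z_det SA.
have Q0 : 0 < vQ (A 1 0, A 1 1) p.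
  by apply: vQ_gt0 => //; apply: coprime_neq0; exact: (det_coprime D).
have DR := @detR R _ _ _ _ D.
rewrite /mobius; apply: (canLR (mulfK w0)); rewrite autjE /ofxy !intrC.
rewrite /imob /mob /=; rewrite /vQ /= in Q0; simpc.
move: Q0 DR; set Q := rowQ _ _ _ => Q0 DR.
have QE : Q = ((A 1 0)%:~R * p.1 + (A 1 1)%:~R) ^+ 2 + ((A 1 0)%:~R * p.2) ^+ 2 by [].
move: (A 0 0)%:~R (A 0 1)%:~R (A 1 0)%:~R (A 1 1)%:~R Q Q0 QE DR => a b c d Q Q0 QE DR.
congr (_ +i* _).
  apply: (mulIf (lt0r_neq0 Q0)); rewrite {1}QE.
  transitivity (((a * p.1 + b) * (c * p.1 + d) + a * c * p.2 ^+ 2) * (c * p.1 + d) - (p.2 * (a * d - b * c)) * (c * p.2)).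
    by ring.
  by rewrite DR; field; rewrite gt_eqF.
apply: (mulIf (lt0r_neq0 Q0)); rewrite {1}QE.
transitivity (((a * p.1 + b) * (c * p.1 + d) + a * c * p.2 ^+ 2) * (c * p.2) + (p.2 * (a * d - b * c)) * (c * p.1 + d)).
  by ring.
by rewrite DR; field; rewrite gt_eqF.
Qed.

Lemma gammaE v : [/\ gamma_cd v.1 v.2 0 0 = topa v, gamma_cd v.1 v.2 0 1 = topb v,
  gamma_cd v.1 v.2 1 0 = v.1 & gamma_cd v.1 v.2 1 1 = v.2].
Proof. by rewrite !mxE. Qed.

Definition pterm (m k : nat) v p : R[i] :=
  e2pi (m%:R * mobius (gamma_cd v.1 v.2) (ofxy p)) / autj (gamma_cd v.1 v.2) (ofxy p) ^+ k.

(** The modulus of [pterm m (2 * n) v p]: the weight is k = 2 n, so |c z + d|^k is the n-th power of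
    [vQ v p]. *)
Definition pabs (m n : nat) v p : R :=
  expR (- (2 * pi * (m%:R * (p.2 / vQ v p)))) / vQ v p ^+ n.

Lemma mobius_vmob v p : coprimez v.1 v.2 -> 0 < p.2 ->
  mobius (gamma_cd v.1 v.2) (ofxy p) = ofxy (vmob v p).
Proof.
move=> cop p0; rewrite mobius_imob//; last exact: gamma_cd_SL2Z.
by have [-> -> -> ->] := gammaE v.
Qed.

Lemma autj_gamma v p : autj (gamma_cd v.1 v.2) (ofxy p) =
  (v.1%:~R * p.1 + v.2%:~R) +i* (v.1%:~R * p.2).
Proof. by rewrite autjE; have [_ _ -> ->] := gammaE v. Qed.

Lemma cabs2C (r : R) : cabs2 r%:C = r ^+ 2.
Proof. by rewrite /cabs2 /= expr0n addr0. Qed.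

Lemma cabs2_e2pi (z : R[i]) : cabs2 (e2pi z) = expR (- (2 * pi * complex.Im z)) ^+ 2.
Proof. by rewrite /e2pi cabs2M cabs2C /cabs2 /= cos2Dsin2 mulr1. Qed.

Lemma pabs_ge0 m n v p : 0 <= pabs m n v p.
Proof.
rewrite /pabs divr_ge0 ?expR_ge0// exprn_ge0// /vQ /rowQ.
by rewrite addr_ge0 ?sqr_ge0.
Qed.

Lemma cabs2_pterm m n v p : coprimez v.1 v.2 -> 0 < p.2 ->
  cabs2 (pterm m (2 * n) v p) = pabs m n v p ^+ 2.
Proof.
move=> cop p0; rewrite /pterm cabs2M cabs2V cabs2X cabs2_e2pi mobius_vmob//.
rewrite autj_gamma /pabs expr_div_n; congr (expR (- (_ * _)) ^+ 2 / _).
  by rewrite natrC /ofxy; simpc.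
by rewrite exprM -exprM mulnC exprM.
Qed.

Lemma e2pi_period (z : R[i]) (n : int) : e2pi (z + n%:~R) = e2pi z.
Proof.
have per (f : R -> R) (x : R) : periodic f (pi *+ 2) -> f (2 * pi * (x + n%:~R)) = f (2 * pi * x).
  move=> pf; have E (y : R) (j : nat) : 2 * pi * (y + j%:R) = 2 * pi * y + pi *+ 2 *+ j.
    by rewrite -[pi *+ 2 *+ j]mulr_natr -[pi *+ 2]mulr_natr; ring.
  case: n => j; first by rewrite -pmulrn E periodicn.
  rewrite NegzE mulrNz -pmulrn -[in RHS](subrK j.+1%:R x) E periodicn//.
rewrite intrC; case: z => x y; rewrite /e2pi /=; simpc.
by rewrite (per cos)// ?(per sin)//; [exact: sinD2pi|exact: cosD2pi].
Qed.

(** The even weight removes the sign of c z + d. The Bezout top rows above v and -v differ by a sign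
    and a left factor T^j, which shifts the point by an integer and leaves e(m z) unchanged. *)
Lemma pterm_opp m n v p : coprimez v.1 v.2 -> 0 < p.2 ->
  pterm m (2 * n) (- v.1, - v.2) p = pterm m (2 * n) v p.
Proof.
move=> cop p0; pose v' : int * int := (- v.1, - v.2).
have cop' : coprimez v'.1 v'.2 by rewrite /= /coprimez gcdzN gcdNz.
rewrite /pterm -/v' !mobius_vmob// !autj_gamma; congr (_ / _); last first.
  rewrite !exprM; congr (_ ^+ _).
  have -> : ((v'.1%:~R * p.1 + v'.2%:~R) +i* (v'.1%:~R * p.2) : R[i]) =
      - ((v.1%:~R * p.1 + v.2%:~R) +i* (v.1%:~R * p.2)).
    by rewrite /= !intrN; simpc; congr (_ +i* _); ring.
  by rewrite sqrrN.
have D := toprow_det cop; have D' := toprow_det cop'.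
have D'' : (- topa v') * v.2 - (- topb v') * v.1 = 1 by rewrite -D' /=; ring.
have [ea eb] := toprow_uniq D D''.
set j := topa v * - topb v' - topb v * - topa v' in ea eb.
clearbody j.
have E : ofxy (vmob v' p) = ofxy (vmob v p) + j%:~R :> R[i].
  have Q0 := vQ_gt0 p0 (coprime_neq0 cop).
  rewrite intrC /ofxy /vmob /imob /mob /=; simpc.
  have e1 : topa v' = - (topa v + j * v.1) by rewrite -ea opprK.
  have e2 : topb v' = - (topb v + j * v.2) by rewrite -eb opprK.
  have QE : rowQ (- v.1)%:~R (- v.2)%:~R p = vQ v p.
    by rewrite /vQ /rowQ !intrN; ring.
  rewrite QE -[rowQ v.1%:~R v.2%:~R p]/(vQ v p) e1 e2.
  move: (topa v) (topb v) => ta tb; rewrite !(intrN, intrD, intrM).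
  have QD : vQ v p = (v.1%:~R * p.1 + v.2%:~R) ^+ 2 + (v.1%:~R * p.2) ^+ 2 by [].
  have Qn : vQ v p != 0 by rewrite gt_eqF.
  congr (_ +i* _); apply: (mulIf Qn); rewrite [RHS]mulrDl !divfK// QD; ring.
have h : m%:R * j%:~R = (m%:Z * j)%:~R :> R[i] by rewrite intrM -pmulrn.
by rewrite E mulrDr h e2pi_period.
Qed.

Lemma wave_pabs m n v p : coprimez v.1 v.2 -> 0 < p.2 ->
  wave (4 * pi * m%:R) n (p.2 / vQ v p) = (p.2 ^+ n * pabs m n v p)%:E.
Proof.
move=> cop p0; have Q0 := vQ_gt0 p0 (coprime_neq0 cop).
rewrite /wave /ind divr_gt0// mul1e; congr (_%:E); rewrite /pabs expr_div_n.
rewrite [RHS]mulrCA; congr (expR _ * _).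
by field; rewrite gt_eqF.
Qed.

Local Notation primitive := {q : int * int | coprimez q.1 q.2}.

Lemma esum_primitive (g : int * int -> \bar R) :
  (\esum_(v in [set: int * int]) (ind (coprimez v.1 v.2) * g v) =
   \esum_(i in [set: primitive]) g (val i))%E.
Proof.
rewrite esum_ind; apply: reindex_esum; split.
- by move=> i _ /=; exact: (valP i).
- by move=> i j _ _; exact: val_inj.
- by move=> v /= cop; exists (exist _ v cop).
Qed.

Lemma inv_sqr_nat_fin : (\esum_(c in [set: nat]) ((c.+1%:R ^+ 2)^-1 : R)%:E <= 2%:E)%E.
Proof.
have c0 (c : nat) : (0 <= ((c.+1%:R ^+ 2)^-1 : R)%:E)%E by rewrite lee_fin invr_ge0 sqr_ge0.
rewrite -nneseries_esumT// (@nneseries_split _ _ 0%N 1%N)// add0n big_nat1.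
rewrite (_ : 2%:E = 1%:E + (1%:R^-1)%:E)%E; last by rewrite invr1 -EFinD.
by apply: leeD; [rewrite expr1n invr1|exact: tail_inv_sqr].
Qed.

Lemma inv_sqr_int_fin : (\esum_(c in [set: int]) ((1 + c%:~R ^+ 2)^-1 : R)%:E)%E \is a fin_num.
Proof.
have s0 (c : int) : 0 < 1 + c%:~R ^+ 2 :> R by rewrite ltr_wpDr ?sqr_ge0.
have c0 (c : nat) : (0 <= ((c.+1%:R ^+ 2)^-1 : R)%:E)%E by rewrite lee_fin invr_ge0 sqr_ge0.
rewrite ge0_fin_numE; last by apply: esum_ge0 => c _; rewrite lee_fin invr_ge0 ltW.
apply: (@le_lt_trans _ _ (1 + 2%:E * 2%:E)%E); last by rewrite -EFinM -EFinD ltry.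
apply: (@le_trans _ _ (\esum_(c in [set: int]) (ind (c == 0%R) * 1 +
    ind (c != 0%R) * ((`|c|%N.-1.+1%:R ^+ 2)^-1 : R)%:E))%E).
  apply: le_esumT => c; have [->|c1] := eqVneq c 0.
    by rewrite /ind mul1e mul0e adde0 expr0n /= addr0 invr1.
  rewrite /ind mul0e add0e mul1e lee_fin lef_pV2 ?posrE ?s0 ?exprn_gt0//.
  rewrite prednK ?absz_gt0//; apply: ler_wpDl => //.
  by rewrite pmulrn abszE intr_norm real_normK ?num_real.
rewrite esumD; last 2 first.
- by move=> c _; rewrite mule_ge0 ?ind_ge0.
- by move=> c _; apply: mule_ge0; [exact: ind_ge0|exact: c0].
apply: leeD.
  rewrite esum_ind (_ : [set i | i == 0] = [set 0 : int]) ?esum_set1//.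
  by apply/seteqP; split => c /= /eqP.
apply: le_trans (esum_int_abs_le c0) _.
by apply: lee_wpmul2l; [rewrite lee_fin|exact: inv_sqr_nat_fin].
Qed.

(** With s = c^2 + d^2 >= 1 and K depending only on z, s <= K |c z + d|^2. Hence the term is at most
    K^n s^{-n} <= K^n s^{-2}, and (1 + c^2) (1 + d^2) <= 3 s^2 separates the variables. *)
Lemma pabs_le m n v p : (2 <= n)%N -> coprimez v.1 v.2 -> 0 < p.2 ->
  pabs m n v p <= (2 + (1 + 2 * p.1 ^+ 2) / p.2 ^+ 2) ^+ n *
    (3 * ((1 + v.1%:~R ^+ 2)^-1 * (1 + v.2%:~R ^+ 2)^-1)).
Proof.
case: v => c d n2 cop p0; have v0 := coprime_neq0 cop; have Q0 := vQ_gt0 p0 v0.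
set K := 2 + _ / _; set Q := vQ _ _ in Q0 *.
pose s : R := c%:~R ^+ 2 + d%:~R ^+ 2.
have s1 : 1 <= s.
  rewrite /s -!rmorphXn -rmorphD /= -[1]/(1%:~R) ler_int.
  have : (c != 0) || (d != 0) by rewrite -negb_and; apply: contra v0 => /andP[/eqP-> /eqP->].
  by move=> /orP[h|h]; nia.
have K0 : 0 < K by rewrite ltr_pwDl// divr_ge0 ?sqr_ge0// addr_ge0// mulr_ge0// sqr_ge0.
have sQ : s <= Q * K.
  have y2 : 0 < p.2 ^+ 2 by rewrite exprn_gt0.
  have QE : Q = (c%:~R * p.1 + d%:~R) ^+ 2 + (c%:~R * p.2) ^+ 2 by [].
  have E : Q * K - s = 2 * (c%:~R * p.1 + d%:~R) ^+ 2 - d%:~R ^+ 2 + 2 * (c%:~R * p.1) ^+ 2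
     + 2 * (c%:~R * p.2) ^+ 2 + (1 + 2 * p.1 ^+ 2) * ((c%:~R * p.1 + d%:~R) ^+ 2 / p.2 ^+ 2).
    by rewrite /s /K QE; field; rewrite gt_eqF.
  rewrite -subr_ge0 E.
  have t1 : 0 <= (1 + 2 * p.1 ^+ 2) * ((c%:~R * p.1 + d%:~R) ^+ 2 / p.2 ^+ 2).
    by rewrite mulr_ge0 ?divr_ge0 ?sqr_ge0// addr_ge0// mulr_ge0// sqr_ge0.
  have t2 := sqr_ge0 (c%:~R * p.2).
  have t3 := sqr_ge0 (2 * (c%:~R * p.1) + d%:~R).
  apply: addr_ge0 => //; apply: addr_ge0; last by rewrite mulr_ge0.
  rewrite (_ : _ + _ = (2 * (c%:~R * p.1) + d%:~R) ^+ 2)//.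
  by ring.
apply: (@le_trans _ _ (Q ^+ n)^-1).
  rewrite /pabs -[leRHS]mul1r ler_wpM2r ?invr_ge0 ?exprn_ge0 ?(ltW Q0)//.
  rewrite -expR0 ler_expR oppr_le0; apply: mulr_ge0; first by rewrite mulr_ge0 ?pi_ge0.
  by apply: mulr_ge0 => //; apply: divr_ge0; exact: ltW.
apply: (@le_trans _ _ (K ^+ n * (s ^+ 2)^-1)).
  rewrite -[leLHS]mul1r ler_pdivrMr ?exprn_gt0// mulrAC ler_pdivlMr ?exprn_gt0 ?(lt_le_trans ltr01)//.
  rewrite mul1r -exprMn mulrC.
  apply: (@le_trans _ _ (s ^+ n)); first by rewrite ler_weXn2l.
  rewrite mulrC lerXn2r ?nnegrE ?(le_trans ler01 s1)// ?mulr_ge0 ?(ltW Q0) ?(ltW K0)//.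
  by rewrite mulrC.
apply: ler_wpM2l; first by rewrite exprn_ge0// ltW.
rewrite -invfM ler_pdivlMr; last by rewrite mulr_gt0// ltr_wpDr ?sqr_ge0.
rewrite mulrC ler_pdivrMr ?exprn_gt0 ?(lt_le_trans ltr01)//.
have := sqr_ge0 (c%:~R ^+ 2 - d%:~R ^+ 2 : R).
move: s1; rewrite /s; have := sqr_ge0 (c%:~R : R); have := sqr_ge0 (d%:~R : R).
move: (c%:~R ^+ 2 : R) (d%:~R ^+ 2 : R) => C D.
by nra.
Qed.

Lemma esum_pabs_fin m n p : (2 <= n)%N -> 0 < p.2 ->
  (\esum_(i in [set: primitive]) (pabs m n (val i) p)%:E)%E \is a fin_num.
Proof.
move=> n2 p0; set K := (2 + (1 + 2 * p.1 ^+ 2) / p.2 ^+ 2) ^+ n.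
have K0 : 0 <= K.
  by rewrite exprn_ge0// addr_ge0// divr_ge0 ?sqr_ge0// addr_ge0// mulr_ge0// sqr_ge0.
pose g (c : int) : R := (1 + c%:~R ^+ 2)^-1.
have g0 c : 0 <= g c by rewrite invr_ge0 addr_ge0// sqr_ge0.
have gE c : (0 <= (g c)%:E)%E by rewrite lee_fin.
rewrite ge0_fin_numE; last by apply: esum_ge0 => i _; rewrite lee_fin pabs_ge0.
set S := (\esum_(c in [set: int]) (g c)%:E)%E.
have SE : S = (fine S)%:E by rewrite fineK// inv_sqr_int_fin.
apply: (@le_lt_trans _ _ ((K * 3)%:E * (S * S))%E); last by rewrite SE -!EFinM ltry.
apply: (@le_trans _ _ (\esum_(v in [set: int * int]) ((K * 3)%:E * ((g v.1)%:E * (g v.2)%:E)))%E).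
  apply: (@le_esum_inj _ _ _ _ _ _ (fun i : primitive => val i)).
  - by move=> v; rewrite !mule_ge0// lee_fin mulr_ge0.
  - by move=> i j _ _; exact: val_inj.
  - move=> i _; rewrite -!EFinM lee_fin -mulrA; exact: (pabs_le m n2 (valP i) p0).
rewrite esumZl; [|by rewrite lee_fin mulr_ge0|by move=> v; rewrite mule_ge0].
rewrite lee_wpmul2l// ?lee_fin ?mulr_ge0//.
rewrite -(@esum_pairT R _ _ (fun c d : int => (g c)%:E * (g d)%:E)%E); last by move=> c d; rewrite mule_ge0.
rewrite le_eqVlt; apply/orP; left; apply/eqP.
transitivity (\esum_(c in [set: int]) (S * (g c)%:E))%E.
  by apply: eq_esum => c _; rewrite esumZl// muleC.
by rewrite esumZl//; apply: esum_ge0 => c _.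
Qed.

Definition opp_primitive (i : primitive) : primitive.
Proof.
exists (- (val i).1, - (val i).2); rewrite /= coprimeNz coprimezN; exact: (valP i).
Defined.

(** The G = F^2 of the overview. *)
Definition diag_wave (M : R) n (t : R) : \bar R := (wave M n t * wave M n t)%E.

(** The factor 1/2 in the series becomes 1/4 in the square. The diagonal counts every term twice,
    once for each sign of the pair, which leaves half of [eis]. *)
Theorem Poincare_pointwise (m n : nat) p : (2 <= n)%N -> 0 < p.2 ->
  let M : R := 4 * pi * m%:R in
  eis (diag_wave M n) p \is a fin_num /\
  ((`|cabs2 (Poincare (2 * n) m (ofxy p)) * p.2 ^+ (2 * n) - fine (eis (diag_wave M n) p) / 2|)%:E
    <= (4^-1)%:E * offdiag M n p)%E.
Proof.
move=> n2 p0 M.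
pose u (i : primitive) := pterm m (2 * n) (val i) p.
pose a (i : primitive) := pabs m n (val i) p.
have a0 i : 0 <= a i by exact: pabs_ge0.
have ua i : cabs2 (u i) = a i ^+ 2 by apply: cabs2_pterm => //; exact: (valP i).
have fa := esum_pabs_fin m n2 p0.
have nuK i : opp_primitive (opp_primitive i) = i.
  by apply: val_inj => /=; rewrite !opprK -surjective_pairing.
have nu_neq i : opp_primitive i != i.
  apply/eqP => /(congr1 val) /= h; have := coprime_neq0 (valP i).
  move/eqP; apply; move: h; rewrite -[sval i]/(val i); case: (val i) => c d /= [hc hd].
  by congr (_, _); lia.
have u_nu i : u (opp_primitive i) = u i by apply: pterm_opp => //; exact: (valP i).
have main := sum_square_offdiag a0 ua fa nuK nu_neq u_nu.
have fa2 := esum_sqr_fin a0 fa.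
set X := rsum _ in main; set Y := rsum _ in main.
have PE : cabs2 (Poincare (2 * n) m (ofxy p)) = 4^-1 * (X ^+ 2 + Y ^+ 2).
  rewrite /Poincare cabs2M cabs2V.
  have -> : cabs2 (2 : R[i]) = 4 by rewrite natrC cabs2C; ring.
  congr (_ * _); rewrite [X in cabs2 X](_ : _ = X +i* Y)//.
  exact: (complex_sumE a0 ua fa).
set y2 := p.2 ^+ (2 * n); have y20 : 0 <= y2 by rewrite exprn_ge0// ltW.
have y2E : y2 = p.2 ^+ n * p.2 ^+ n by rewrite -exprD addnn -mul2n.
have wE (i : primitive) : wave M n (p.2 / vQ (val i) p) = (p.2 ^+ n * a i)%:E.
  by apply: wave_pabs => //; exact: (valP i).
have eE : eis (diag_wave M n) p = (y2%:E * \esum_(i in [set: primitive]) (a i ^+ 2)%:E)%E.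
  rewrite /eis esum_primitive -esumZl//; last by move=> i; rewrite lee_fin sqr_ge0.
  apply: eq_esum => i _; rewrite /diag_wave wE -!EFinM; congr (_%:E); rewrite y2E; ring.
have oE : offdiag M n p = (y2%:E * family_offdiag a opp_primitive)%E.
  rewrite /offdiag (esum_primitive (fun v => (wave M n (p.2 / vQ v p)%R *
    \esum_(w in [set: int * int]) (ind (nonproportional v w) * wave M n (p.2 / vQ w p)%R))%E)).
  have b0 i : (0 <= \esum_(j in [set: primitive]) (ind ((j != i) && (j != opp_primitive i)) * (a j)%:E))%E.
    by apply: esum_ge0 => j _; apply: mule_ge0; [exact: ind_ge0|rewrite lee_fin].
  rewrite /family_offdiag -esumZl//; last by move=> i; rewrite mule_ge0// lee_fin.
  apply: eq_esum => i _; rewrite wE.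
  have -> : (\esum_(w in [set: int * int]) (ind (nonproportional (val i) w) * wave M n (p.2 / vQ w p)%R) =
     (p.2 ^+ n)%:E * \esum_(j in [set: primitive]) (ind ((j != i) && (j != opp_primitive i)) * (a j)%:E))%E.
    rewrite -esumZl//; last 2 first.
    - by rewrite lee_fin exprn_ge0// ltW.
    - by move=> j; apply: mule_ge0; [exact: ind_ge0|rewrite lee_fin].
    transitivity (\esum_(w in [set: int * int]) (ind (coprimez w.1 w.2) *
       (ind ((w != val i) && (w != (- (val i).1, - (val i).2)%R)) * wave M n (p.2 / vQ w p)%R)))%E.
      apply: eq_esum => w _; rewrite /nonproportional /ind.
      by case: (coprimez w.1 w.2); rewrite ?mul1e ?mul0e.
    rewrite (esum_primitive (fun w => (ind ((w != val i) && (w != (- (val i).1, - (val i).2)%R)) * wave M n (p.2 / vQ w p)%R)%E)).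
    apply: eq_esum => j _.
    have -> : ((j != i) && (j != opp_primitive i)) =
        ((val j != val i) && (val j != (- (val i).1, - (val i).2))) by rewrite -!val_eqE.
    by rewrite wE EFinM muleCA.
  by rewrite y2E (EFinM _ (a i)) (EFinM (p.2 ^+ n) (p.2 ^+ n)) -!muleA; congr (_ * _)%E; exact: muleCA.
split; first by rewrite eE fin_numM.
rewrite PE eE fineM//= oE.
have -> : ((4^-1)%:E * (y2%:E * family_offdiag a opp_primitive) =
   (y2 / 4)%:E * family_offdiag a opp_primitive)%E.
  by rewrite muleA -EFinM mulrC.
set Z := fine _ in main *.
have -> : 4^-1 * (X ^+ 2 + Y ^+ 2) * y2 - y2 * Z / 2 = (y2 / 4) * (X ^+ 2 + Y ^+ 2 - 2 * Z).
  by field.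
rewrite normrM ger0_norm ?divr_ge0// EFinM; apply: lee_wpmul2l => //.
by rewrite lee_fin divr_ge0.
Qed.

End PoincarePointwise.

(** * Measurability of the Poincare series *)

Section PoincareMeasurable.
Context {R : realType}.

Definition cmeasurable (f : R * R -> R[i]) : Prop :=
  measurable_fun setT (fun p => complex.Re (f p)) /\
  measurable_fun setT (fun p => complex.Im (f p)).

Lemma cmeasurable_cst (z : R[i]) : cmeasurable (fun=> z).
Proof. by split; exact: measurable_cst. Qed.

Lemma cmeasurable_ofxy : cmeasurable (@ofxy R).
Proof. by split; rewrite /ofxy /=; mea. Qed.

Lemma cmeasurableD f g : cmeasurable f -> cmeasurable g -> cmeasurable (fun p => f p + g p).
Proof.
move=> [f1 f2] [g1 g2]; split.
  rewrite (_ : (fun p => _) = (fun p => complex.Re (f p) + complex.Re (g p))); first by mea.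
  by apply/funext => p; case: (f p) (g p) => ? ? [].
rewrite (_ : (fun p => _) = (fun p => complex.Im (f p) + complex.Im (g p))); first by mea.
by apply/funext => p; case: (f p) (g p) => ? ? [].
Qed.

Lemma cmeasurableM f g : cmeasurable f -> cmeasurable g -> cmeasurable (fun p => f p * g p).
Proof.
move=> [f1 f2] [g1 g2]; split.
  rewrite (_ : (fun p => _) = (fun p => complex.Re (f p) * complex.Re (g p) -
     complex.Im (f p) * complex.Im (g p))); first by mea.
  by apply/funext => p; case: (f p) (g p) => ? ? [].
rewrite (_ : (fun p => _) = (fun p => complex.Re (f p) * complex.Im (g p) +
   complex.Im (f p) * complex.Re (g p))); first by mea.
by apply/funext => p; case: (f p) (g p) => ? ? [].
Qed.

Lemma cmeasurableV f : cmeasurable f -> cmeasurable (fun p => (f p)^-1).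
Proof.
move=> [f1 f2]; split.
  rewrite (_ : (fun p => _) = (fun p => complex.Re (f p) /
     (complex.Re (f p) ^+ 2 + complex.Im (f p) ^+ 2))); first by mea.
  by apply/funext => p; case: (f p).
rewrite (_ : (fun p => _) = (fun p => - (complex.Im (f p) /
   (complex.Re (f p) ^+ 2 + complex.Im (f p) ^+ 2)))); first by mea.
by apply/funext => p; case: (f p).
Qed.

Lemma cmeasurableX f n : cmeasurable f -> cmeasurable (fun p => f p ^+ n).
Proof.
move=> mf; elim: n => [|n IH]; first exact: cmeasurable_cst.
rewrite (_ : (fun p => _) = (fun p => f p * f p ^+ n)); first exact: cmeasurableM.
by apply/funext => p; rewrite exprS.
Qed.

Lemma cmeasurable_e2pi f : cmeasurable f -> cmeasurable (fun p => e2pi (f p)).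
Proof.
move=> [f1 f2].
have mc : measurable_fun setT (@cos R).
  by apply: continuous_measurable_fun; exact: continuous_cos.
have ms : measurable_fun setT (@sin R).
  by apply: continuous_measurable_fun; exact: continuous_sin.
by apply: cmeasurableM; split => /=; [mea|exact: measurable_cst|mea|mea].
Qed.

Lemma cmeasurable_pterm m k v : cmeasurable (pterm m k v).
Proof.
have ma : cmeasurable (fun p : R * R => autj (gamma_cd v.1 v.2) (ofxy p)).
  apply: cmeasurableD; last exact: cmeasurable_cst.
  by apply: cmeasurableM; [exact: cmeasurable_cst|exact: cmeasurable_ofxy].
apply: cmeasurableM; last by apply: cmeasurableV; exact: cmeasurableX.
apply: cmeasurable_e2pi; apply: cmeasurableM; first exact: cmeasurable_cst.
apply: cmeasurableM; last exact: cmeasurableV.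
apply: cmeasurableD; last exact: cmeasurable_cst.
by apply: cmeasurableM; [exact: cmeasurable_cst|exact: cmeasurable_ofxy].
Qed.

Lemma measurable_rsum (I : countType) (x : I -> R * R -> R) :
  (forall i, measurable_fun setT (x i)) ->
  measurable_fun setT (fun p => rsum (fun i => x i p)).
Proof.
move=> mx.
have m0 (t : R) : (0 <= (Num.max t 0)%:E)%E by rewrite lee_fin le_max lexx orbT.
have mfi : measurable_fun setT (@fine R) by exact: fine_measurable.
have part (y : I -> R * R -> R) : (forall i, measurable_fun setT (y i)) ->
    measurable_fun setT (fun p => fine (\esum_(i in [set: I]) (Num.max (y i p) 0)%:E)%E).
  move=> my; apply: (measurable_fun_comp2 mfi); apply: measurable_fun_esum => // i.
  apply: measurable_EFin; apply: measurable_maxr; first exact: my.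
  exact: measurable_cst.
apply: measurable_funB; first exact: part.
by apply: part => i; have mi := mx i; mea.
Qed.

(** Absolute convergence is established for y > 0. The sums [rsum] are measurable on the whole plane
    and agree with the series there, so they give a global measurable representative. *)
Lemma measurable_Poincare (m n : nat) : (2 <= n)%N ->
  exists g : R * R -> R, [/\ measurable_fun setT g, forall p, 0 <= g p &
    forall p, 0 < p.2 -> g p = cabs2 (Poincare (2 * n) m (ofxy p)) * p.2 ^+ (2 * n)].
Proof.
move=> n2; pose I := {q : int * int | coprimez q.1 q.2}.
pose X (p : R * R) := rsum (fun i : I => complex.Re (pterm m (2 * n) (val i) p)).
pose Y (p : R * R) := rsum (fun i : I => complex.Im (pterm m (2 * n) (val i) p)).
have mX : measurable_fun setT X.
  by apply: measurable_rsum => i; have [] := cmeasurable_pterm m (2 * n) (val i).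
have mY : measurable_fun setT Y.
  by apply: measurable_rsum => i; have [] := cmeasurable_pterm m (2 * n) (val i).
exists (fun p => 4^-1 * (X p ^+ 2 + Y p ^+ 2) * p.2 ^+ (2 * n)); split.
- by mea.
- move=> p; apply: mulr_ge0; last by rewrite exprM exprn_ge0// sqr_ge0.
  by apply: mulr_ge0 => //; rewrite addr_ge0 ?sqr_ge0.
move=> p p0; congr (_ * _).
have -> : cabs2 (Poincare (2 * n) m (ofxy p)) = cabs2 (2^-1 * (X p +i* Y p)).
  rewrite /Poincare; congr (cabs2 (_ * _)).
  apply: (@complex_sumE _ I (fun i => pterm m (2 * n) (val i) p) (fun i => pabs m n (val i) p)).
  - by move=> i; exact: pabs_ge0.
  - by move=> i; apply: cabs2_pterm => //; exact: (valP i).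
  - exact: esum_pabs_fin.
rewrite cabs2M cabs2V.
by have -> : cabs2 (2 : R[i]) = 4 by rewrite natrC cabs2C; ring.
Qed.

End PoincareMeasurable.

(** * Main term and comparison of masses *)

Section MassEstimates.
Context {R : realType}.
Local Notation mu := (@lebesgue_measure R).
Local Open Scope ereal_scope.
Implicit Types p : R * R.

Lemma measurable_diag_wave (M : R) n : measurable_fun setT (diag_wave M n).
Proof. by have mw := measurable_wave M n; rewrite /diag_wave; mea. Qed.

Lemma diag_wave_ge0 (M : R) n t : 0 <= diag_wave M n t.
Proof. by rewrite /diag_wave mule_ge0 ?wave_ge0. Qed.

Lemma diag_waveE (M : R) n (t : R) :
  diag_wave M n.+1 t = ind (0 < t)%R * (expR (- (M * t)) * t ^+ (2 * n).+2)%:E.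
Proof.
rewrite /diag_wave /wave /ind; case: ltP => t0; last by rewrite !mul0e.
rewrite !mul1e -EFinM; congr (_%:E); rewrite mulrACA -expRD -exprD.
congr (expR _ * _ ^+ _)%R; first by field.
by lia.
Qed.

Section one.
Variables (M : R) (n : nat).
Hypothesis M0 : (0 < M)%R.

Local Notation D := (diag_wave M n.+1).
Local Notation N := (gamma_int M (2 * n)).

Let mD := measurable_diag_wave M n.+1.
Let D0 := diag_wave_ge0 M n.+1.

(** For k = 2 n + 2, the weight 1 / y^2 lowers the exponent of y from k to 2 n = k - 2, which gives
    the moment N. *)
Lemma integral_diag_wave : \int[mu]_y (hyp_weight y * D y) = N%:E.
Proof.
rewrite -integral_gamma//; apply: eq_integral => y _; rewrite diag_waveE /hyp_weight /ind.
case: ltP => y0; last by rewrite !mul0e.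
rewrite !mul1e -EFinM; congr (_%:E); rewrite !exprSr.
by move: (y ^+ (2 * n))%R (expR _) => u v; field; rewrite gt_eqF.
Qed.

(** On the tail 1 <= y / y0, so the next moment bounds it; the ratio of consecutive moments is (2 n
    + 1) / M. *)
Lemma integral_diag_wave_tail (y0 : R) : (0 < y0)%R ->
  \int[mu]_y (hyp_weight y * (ind (y0 <= y)%R * D y)) <=
  ((2 * n).+1%:R / (M * y0) * N)%:E.
Proof.
move=> y00; have mw := @measurable_hyp_weight R.
have -> : ((2 * n).+1%:R / (M * y0) * N = y0^-1 * gamma_int M (2 * n).+1)%R.
  have E := gamma_intS M0 (2 * n).
  apply: (mulfI (lt0r_neq0 M0)); rewrite [RHS]mulrCA E.
  by move: ((2 * n).+1%:R : R)%R N => u v; field; rewrite !gt_eqF.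
have i0 (y : R) : 0 <= ind (0 < y)%R * (y ^+ (2 * n).+1 * expR (- (M * y)))%:E.
  rewrite /ind; case: ltP => y1; last by rewrite mul0e.
  by rewrite mul1e lee_fin mulr_ge0 ?expR_ge0// exprn_ge0// ltW.
rewrite EFinM -integral_gamma// -integralTZl//; last 2 first.
- by mea.
- by rewrite invr_ge0 ltW.
apply: integral_le; [by mea|by mea|by epos|move=> y].
rewrite diag_waveE /hyp_weight; have := i0 y; rewrite /ind.
case: (ltP 0%R y) => y1; last by rewrite !mul0e mule0.
rewrite !mul1e => h; case: (leP y0 y) => yy; last by rewrite mul0e mule0 mule_ge0// lee_fin invr_ge0 ltW.
rewrite mul1e -!EFinM lee_fin !exprSr.
have E : (0 <= y ^+ (2 * n) * expR (- (M * y)))%R by rewrite mulr_ge0 ?expR_ge0// exprn_ge0// ltW.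
move: (y ^+ (2 * n))%R (expR _) E => u v E.
have -> : ((y ^+ 0 * y * y)^-1 * (v * (u * y * y)) = u * v)%R.
  by rewrite expr0 mul1r; field; rewrite gt_eqF.
have -> : (y0^-1 * (u * y * v) = (y / y0) * (u * v))%R by field; rewrite gt_eqF.
by rewrite ler_peMl// ler_pdivlMr// mul1r.
Qed.

Section withf.
Variables (f : R * R -> R) (B : R).
Hypotheses (mf : measurable_fun setT f) (f0 : forall p, (0 <= f p)%R)
  (fB : forall p, (f p <= B)%R) (fA : automorphic f).

Let B0 : (0 <= B)%R. Proof. exact: (le_trans (f0 (0%R, 0%R)) (fB (0%R, 0%R))). Qed.

(** Below y0 the horocycle means are within eta of the average; above y0 both lie in [0, B], so the
    deviation is at most B on the tail. *)
Lemma eisenstein_mass (y0 eta : R) : (0 < y0)%R -> (0 < eta)%R ->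
  (forall y : R, (0 < y < y0)%R -> (`|fine (horo f y) - average f| <= eta)%R) ->
  let I := \int[mu]_y (hyp_weight y * (D y * horo f y)) in
  let err := ((eta + B * ((2 * n).+1%:R / (M * y0))) * N)%:E in
  I <= (average f * N)%:E + err /\ (average f * N)%:E <= I + err.
Proof.
move=> y00 eta0 H I err; have mw := @measurable_hyp_weight R.
have mh := measurable_horo mf f0; have h0 := horo_ge0 f0.
have hE := horo_fin mf f0 fB; have hB := horo_le mf f0 fB.
have N0 : (0 <= N)%R by exact: (ltW (gamma_int_gt0 M0 _)).
have /andP[a0 aB] := average_bounds mf f0 fB.
have tl := integral_diag_wave_tail y00.
set t := (_ / _)%R in tl err *.
have errE : \int[mu]_y (hyp_weight y * (D y * (eta%:E + B%:E * ind (y0 <= y)%R))) <= err.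
  have e0 : 0 <= eta%:E by rewrite lee_fin ltW.
  have b0 : 0 <= B%:E by rewrite lee_fin.
  rewrite (_ : \int[mu]_y _ = \int[mu]_y (eta%:E * (hyp_weight y * D y) +
      B%:E * (hyp_weight y * (ind (y0 <= y)%R * D y)))); last first.
    apply: eq_integral => y _; rewrite ge0_muleDr; [|by []|by epos].
    rewrite ge0_muleDr; [|by epos|by epos]; congr (_ + _).
      by rewrite [D y * _]muleC muleCA.
    by rewrite (muleC (D y)) -(muleA B%:E) muleCA.
  rewrite ge0_integralD; [|by []|by epos|by mea|by epos|by mea].
  rewrite integralTZl; [|by mea|by epos|by rewrite ltW].
  rewrite integralTZl; [|by mea|by epos|by []].
  rewrite integral_diag_wave /err mulrDl EFinD EFinM leeD2l// -mulrA EFinM.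
  exact: lee_wpmul2l.
have cmp (y : R) : (0 < y)%R ->
    (fine (horo f y) <= average f + (eta + B * (y0 <= y)%R%:R))%R /\
    (average f <= fine (horo f y) + (eta + B * (y0 <= y)%R%:R))%R.
  move=> yp; have hy0 : (0 <= fine (horo f y))%R by exact: fine_ge0.
  have hyB : (fine (horo f y) <= B)%R by rewrite -lee_fin -hE.
  case: (leP y0 y) => yy; rewrite ?mulr1 ?mulr0; first by split; lra.
  have := H y; rewrite yp yy => /(_ isT); rewrite ler_norml => /andP[]; split; lra.
have aE : (average f * N)%:E = \int[mu]_y (hyp_weight y * (D y * (average f)%:E)).
  rewrite EFinM -integral_diag_wave -integralTZl; [|by mea|by epos|by []].
  by apply: eq_integral => y _; rewrite muleC -muleA.
have e0 : 0 <= eta%:E by rewrite lee_fin ltW.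
have b0 : 0 <= B%:E by rewrite lee_fin.
have aE0 : 0 <= (average f)%:E by rewrite lee_fin.
have X0 (y : R) : 0 <= eta%:E + B%:E * ind (y0 <= y)%R by apply: adde_ge0; epos.
split.
  apply: le_trans (leeD2l _ errE).
  rewrite aE -ge0_integralD; [|by []|by epos|by mea|by epos|by mea].
  apply: integral_le; [by mea|by mea|by epos|move=> y].
  rewrite -ge0_muleDr; [|by epos|by epos]; rewrite /hyp_weight {1 2}/ind.
  case: (ltP 0%R y) => y1; last by rewrite !mul0e.
  apply: lee_wpmul2l; first by rewrite mul1e lee_fin invr_ge0 sqr_ge0.
  rewrite -ge0_muleDr//; apply: lee_wpmul2l => //.
  by rewrite hE -EFinM -!EFinD lee_fin; have [] := cmp y y1.
apply: le_trans (leeD2l _ errE).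
rewrite aE /I -ge0_integralD; [|by []|by epos|by mea|by epos|by mea].
apply: integral_le; [by mea|by mea|by epos|move=> y].
rewrite -ge0_muleDr; [|by epos|by epos]; rewrite /hyp_weight {1 2}/ind.
case: (ltP 0%R y) => y1; last by rewrite !mul0e.
apply: lee_wpmul2l; first by rewrite mul1e lee_fin invr_ge0 sqr_ge0.
rewrite -ge0_muleDr//; apply: lee_wpmul2l => //.
by rewrite hE -EFinM -!EFinD lee_fin; have [] := cmp y y1.
Qed.

(* [X] stands for the squared Poincare series times y^k. *)
Lemma mass_comparison (X : R * R -> R) (y0 eta O : R) :
  measurable_fun setT X -> (forall p, (0 <= X p)%R) ->
  (forall p, (0 < p.2)%R -> eis D p \is a fin_num /\
    (`|X p - fine (eis D p) / 2|)%:E <= (4^-1)%:E * offdiag M n.+1 p) ->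
  hyp (fun p => ind (fund p) * offdiag M n.+1 p) <= (O * N)%:E ->
  (0 < y0)%R -> (0 < eta)%R ->
  (forall y : R, (0 < y < y0)%R -> (`|fine (horo f y) - average f| <= eta)%R) ->
  let J := hyp (fun p => ind (fund p) * (f p * X p)%:E) in
  J \is a fin_num /\
  (`|fine J - average f * N| <= (eta + B * ((2 * n).+1%:R / (M * y0)) + B * O) * N)%R.
Proof.
move=> mX X0 HX HO y00 eta0 Hh J.
have mF := @measurable_fund R; have mE := measurable_eis mD D0.
have E0 p : 0 <= eis D p by exact: eis_ge0.
have mO := measurable_offdiag M n.+1; have O0 := offdiag_ge0 M n.+1.
have fE0 p : 0 <= (f p)%:E by rewrite lee_fin.
have fX0 p : 0 <= (f p * X p)%:E by rewrite lee_fin mulr_ge0.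
have q0 : 0 <= (4^-1 : R)%:E by rewrite lee_fin.
have h0 : 0 <= (2^-1 : R)%:E by rewrite lee_fin.
have [I1 I2] := eisenstein_mass y00 eta0 Hh.
set I := \int[mu]_y _ in I1 I2.
have IE : hyp (fun p => (2^-1)%:E * (ind (fund p) * ((f p)%:E * eis D p))) = I.
  rewrite hypZl; [|by mea|by epos|by []].
  rewrite (unfold_eis mf f0 fA mD D0) muleA -EFinM mulVf// mul1e.
  by apply: eq_integral.
pose W := hyp (fun p => (B / 4)%:E * (ind (fund p) * offdiag M n.+1 p)).
have B4 : 0 <= (B / 4)%:E by rewrite lee_fin divr_ge0.
have WO : W <= (B * O * N)%:E.
  rewrite /W hypZl; [|by mea|by epos|by []].
  apply: le_trans (lee_wpmul2l B4 HO) _; rewrite -EFinM lee_fin.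
  have ON : (0 <= O * N)%R by rewrite -lee_fin; apply: le_trans HO; epos.
  rewrite -mulrA; apply: ler_wpM2r => //.
  by rewrite ler_pdivrMr// ler_peMr// ler1n.
have pt p : (0 < p.2)%R ->
    (f p * X p)%:E <= (2^-1)%:E * ((f p)%:E * eis D p) + (B / 4)%:E * offdiag M n.+1 p /\
    (2^-1)%:E * ((f p)%:E * eis D p) <= (f p * X p)%:E + (B / 4)%:E * offdiag M n.+1 p.
  move=> p0; have [fin] := HX p p0.
  have := O0 p; case: (offdiag M n.+1 p) => [b| |//]; last first.
    (* An infinite off-diagonal sum makes both bounds trivial unless B = 0, and then f vanishes. *)
    move=> _ _; have [B00|B00] := eqVneq B 0%R; last first.
      have B40 : (0 < B / 4)%R by rewrite divr_gt0// lt_neqAle eq_sym B00.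
      by rewrite gt0_muley ?lte_fin// -(fineK fin) -!EFinM; split; rewrite addey ?leey.
    have fz : f p = 0%R by apply/eqP; rewrite eq_le f0 andbT -B00 fB.
    by rewrite B00 fz !mul0r !mul0e mule0 !adde0.
  rewrite lee_fin => b0; rewrite -(fineK fin); set e := fine _; rewrite -!EFinM -!EFinD !lee_fin => h.
  have ff := f0 p; have fb := fB p.
  move: h; rewrite ler_norml => /andP[h1 h2].
  have k1 : (f p * (4^-1 * b) <= B * (4^-1 * b))%R by rewrite ler_wpM2r// mulr_ge0.
  have k2 : (f p * (X p - e / 2) <= f p * (4^-1 * b))%R by rewrite ler_wpM2l.
  have k3 : (f p * (- (4^-1 * b)) <= f p * (X p - e / 2))%R by rewrite ler_wpM2l.
  have E1 : (B / 4 * b = B * (4^-1 * b))%R by ring.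
  have E2 : (2^-1 * (f p * e) = f p * (e / 2))%R by ring.
  by rewrite E1 E2; split; nra.
have J1 : J <= I + W.
  rewrite -IE -hypD; [|by mea|by epos|by mea|by epos].
  apply: le_hyp; [by mea|by mea|by epos|move=> p p0].
  rewrite muleCA [X in _ + X]muleCA -ge0_muleDr; [|by epos|by epos].
  by apply: lee_wpmul2l; [epos|have [] := pt p p0].
have J2 : I <= J + W.
  rewrite -IE /J -hypD; [|by mea|by epos|by mea|by epos].
  apply: le_hyp; [by mea|by mea|by epos|move=> p p0].
  rewrite muleCA [X in _ + X]muleCA -ge0_muleDr; [|by epos|by epos].
  by apply: lee_wpmul2l; [epos|have [] := pt p p0].
have J0 : 0 <= J by rewrite /J; epos.
have If : I \is a fin_num.
  rewrite ge0_fin_numE; last by rewrite -IE; epos.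
  by apply: (le_lt_trans I1); rewrite -EFinD ltry.
have W0 : 0 <= W by rewrite /W; epos.
have Wf : W \is a fin_num by rewrite ge0_fin_numE// (le_lt_trans WO)// ltry.
have Jf : J \is a fin_num.
  by rewrite ge0_fin_numE//; apply: (le_lt_trans J1); rewrite -(fineK If) -(fineK Wf) -EFinD ltry.
split => //.
move: I1 I2 J1 J2 WO; rewrite -(fineK If) -(fineK Wf) -(fineK Jf) -!EFinD !lee_fin.
move=> I1 I2 J1 J2 WO; rewrite ler_norml; apply/andP; split; lra.
Qed.

End withf.
End one.
End MassEstimates.

(** * Continuous functions on the upper half-plane *)

Section HalfPlaneFunctions.
Context {R : realType}.
Local Notation mu := (@lebesgue_measure R).
Implicit Types p q : R * R.

Lemma measurable_grid (F : int * int -> R) (n : nat) : (forall v, 0 <= F v) ->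
  measurable_fun setT (fun p : R * R => F (Num.floor (n%:R * p.1), Num.floor (n%:R * p.2))).
Proof.
move=> F0; have FE v : (0 <= (F v)%:E)%E by rewrite lee_fin.
have mfi : measurable_fun setT (@fine R) by exact: fine_measurable.
pose b (v : int * int) p : bool := (v.1%:~R <= n%:R * p.1 < v.1%:~R + 1) &&
   (v.2%:~R <= n%:R * p.2 < v.2%:~R + 1).
rewrite (_ : (fun p => _) = (fun p => fine (\esum_(v in [set: int * int]) (ind (b v p) * (F v)%:E))%E)).
  apply: (measurable_fun_comp2 mfi); apply: measurable_fun_esum.
    by move=> v; rewrite /b; mea.
  by move=> v p; epos.
apply/funext => p; set w := (Num.floor _, Num.floor _).
have bw v : b v p = (v == w).
  have fl (x : R) (j : int) : (j%:~R <= x < j%:~R + 1) = (j == Num.floor x).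
    apply/idP/eqP => [h|->]; last first.
      by rewrite floor_le_tmp /=; have := lt_succ_floor x; rewrite intrD.
    by apply/esym/floor_def; rewrite intrD.
  by rewrite /b !fl [RHS]xpair_eqE.
rewrite esum_ind (_ : [set i | b i p] = [set w]) ?esum_set1//.
by apply/seteqP; split => v /=; rewrite bw => /eqP.
Qed.

Lemma floor_approx (x : R) (n : nat) : (0 < n)%N ->
  let t := (Num.floor (n%:R * x))%:~R in t / n%:R <= x /\ x < (t + 1) / n%:R.
Proof.
move=> n0 t; have N0 : 0 < n%:R :> R by rewrite ltr0n.
rewrite ler_pdivrMr// ltr_pdivlMr// [x * _]mulrC; split; first exact: floor_le_tmp.
by have := lt_succ_floor (n%:R * x); rewrite intrD.
Qed.

Lemma continuous_box (f : R * R -> R) q : {for q, continuous f} ->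
  forall e : R, 0 < e -> exists2 r : R, 0 < r & forall q',
    `|q.1 - q'.1| < r -> `|q.2 - q'.2| < r -> `|f q - f q'| < e.
Proof.
move=> cf e e0; have /cvgrPdist_lt /(_ _ e0) := cf.
case=> -[U V] /= [[r1 /= r10 U1] [r2 /= r20 V2]] UV.
exists (Num.min r1 r2); first by rewrite lt_min r10.
move=> q' h1 h2; apply: (UV q'); split.
  by apply: U1 => /=; apply: lt_le_trans h1 _; rewrite ge_min lexx.
by apply: V2 => /=; apply: lt_le_trans h2 _; rewrite ge_min lexx orbT.
Qed.

(** Pointwise limit of functions that, within the half-plane, are constant on the cells of grids of
    mesh 1/(n + 1). *)
Lemma measurable_half_plane (f : R * R -> R) (b : R) : (forall p, 0 <= f p) ->
  (forall p, 0 < p.2 -> {for p, continuous f}) ->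
  measurable_fun setT (fun p => if 0 < p.2 then f p else b).
Proof.
move=> f0 cf.
pose F (n : nat) (v : int * int) : R := f (v.1%:~R / n.+1%:R, (v.2%:~R + 1) / n.+1%:R).
pose fn (n : nat) p : R := if 0 < p.2 then
  F n (Num.floor (n.+1%:R * p.1), Num.floor (n.+1%:R * p.2)) else b.
apply: (@measurable_fun_cvg _ _ _ _ fn).
  move=> n; rewrite /fn; apply: measurable_fun_ifT; first by mea.
    by apply: measurable_grid => v; exact: f0.
  exact: measurable_cst.
move=> p _; rewrite /fn; case: ltP => p0; last exact: cvg_cst.
have inv0 : (n.+1%:R^-1 : R) @[n --> \oo] --> (0 : R) by exact: cvg_harmonic.
have c1 : ((Num.floor (n.+1%:R * p.1))%:~R / n.+1%:R : R) @[n --> \oo] --> p.1.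
  apply: (@squeeze_cvgr _ _ _ _ (fun n : nat => p.1 - n.+1%:R^-1) (fun=> p.1)).
  - apply: nearW => n; have [h1 h2] := @floor_approx p.1 n.+1 isT.
    by rewrite h1 andbT; move: h2; rewrite mulrDl mul1r lerBlDr => /ltW.
  - by rewrite -[X in _ --> X]subr0; apply: cvgB; [exact: cvg_cst|exact: inv0].
  - exact: cvg_cst.
have c2 : (((Num.floor (n.+1%:R * p.2))%:~R + 1) / n.+1%:R : R) @[n --> \oo] --> p.2.
  apply: (@squeeze_cvgr _ _ _ _ (fun=> p.2) (fun n : nat => p.2 + n.+1%:R^-1)).
  - apply: nearW => n; have [h1 h2] := @floor_approx p.2 n.+1 isT.
    by rewrite (ltW h2) /= mulrDl mul1r lerD2r.
  - exact: cvg_cst.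
  - by rewrite -[X in _ --> X]addr0; apply: cvgD; [exact: cvg_cst|exact: inv0].
apply/cvgrPdist_lt => e e0; have [r r0 H] := continuous_box (cf p p0) e0.
near=> n; rewrite /F /=; apply: H => /=; near: n.
  by move/cvgrPdist_lt: c1; exact.
by move/cvgrPdist_lt: c2; exact.
Unshelve. all: by end_near. Qed.

(** Invariance of |z - w|^2 / (Im z Im w), a function of the hyperbolic distance, with the
    denominator on the left cleared. *)
Lemma hyp_distance (a b c d : R) (z w : R * R) : a * d - b * c = 1 -> 0 < z.2 -> 0 < w.2 ->
  ((mob a b c d z).1 - (mob a b c d w).1) ^+ 2 + ((mob a b c d z).2 - (mob a b c d w).2) ^+ 2 =
  ((z.1 - w.1) ^+ 2 + (z.2 - w.2) ^+ 2) / (z.2 * w.2) *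
    ((mob a b c d z).2 * (mob a b c d w).2) :> R.
Proof.
move=> D z0 w0.
have Qz := rowQ_gt0 z0 (det_row D); have Qw := rowQ_gt0 w0 (det_row D).
rewrite /mob /=.
have Ez : rowQ c d z = (c * z.1 + d) ^+ 2 + (c * z.2) ^+ 2 by [].
have Ew : rowQ c d w = (c * w.1 + d) ^+ 2 + (c * w.2) ^+ 2 by [].
set P := rowQ c d z in Qz Ez *; set Q := rowQ c d w in Qw Ew *.
set Az := (a * z.1 + b) * (c * z.1 + d) + a * c * z.2 ^+ 2.
set Aw := (a * w.1 + b) * (c * w.1 + d) + a * c * w.2 ^+ 2.
have key : (Az * Q - Aw * P) ^+ 2 + (z.2 * Q - w.2 * P) ^+ 2 =
    ((z.1 - w.1) ^+ 2 + (z.2 - w.2) ^+ 2) * P * Q.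
  have e3 : Az * Q - Aw * P = (a * d - b * c) * ((z.1 - w.1) * ((c * z.1 + d) * (c * w.1 + d))
      + c * (z.2 ^+ 2 * (c * w.1 + d) - w.2 ^+ 2 * (c * z.1 + d))).
    by rewrite /Az /Aw Ez Ew; ring.
  by rewrite e3 D Ez Ew; ring.
transitivity (((Az * Q - Aw * P) ^+ 2 + (z.2 * Q - w.2 * P) ^+ 2) / (P ^+ 2 * Q ^+ 2)).
  by field; rewrite !gt_eqF.
rewrite key.
by field; rewrite !gt_eqF.
Qed.

Lemma nbhs_box q (r : R) : 0 < r ->
  nbhs q [set q0 : R * R | `|q.1 - q0.1| < r /\ `|q.2 - q0.2| < r].
Proof.
move=> r0; exists ([set x : R | `|q.1 - x| < r], [set x : R | `|q.2 - x| < r]) => /=.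
  by split; exists r.
by move=> [x y] [].
Qed.

Lemma compact_bound (K : set (R * R)) (f : R * R -> R) :
  compact K -> (forall q, K q -> {for q, continuous f}) ->
  exists2 B : R, 0 <= B & forall q, K q -> `|f q| <= B.
Proof.
move=> /compact_near_coveringP cK cf.
have H : \forall B \near +oo, K `<=` [set q | `|f q| <= B].
  apply: cK => q Kq; have [r r0 near_q] := continuous_box (cf q Kq) ltr01.
  exists ([set q0 : R * R | `|q.1 - q0.1| < r /\ `|q.2 - q0.2| < r], [set B : R | `|f q| + 1 <= B]).
    by split => /=; [exact: nbhs_box|apply: nbhs_pinfty_ge; exact: num_real].
  move=> [q0 B] /= [[a1 a2] hB]; have := near_q q0 a1 a2.
  by have := ler_normB (f q) (f q - f q0); rewrite opprB addrC subrK; lra.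
have H2 : \forall B \near +oo, 0 <= B /\ K `<=` [set q | `|f q| <= B].
  by near=> B; split; [near: B; apply: nbhs_pinfty_ge; exact: num_real|near: B; exact: H].
by have [B [B0 HB]] := filter_ex H2; exists B => // q /HB.
Unshelve. all: by end_near. Qed.

(** Only q is confined to K while q' may leave it. This suits a pair of nearby points of which just
    one has been moved into K. *)
Lemma compact_uniform_continuity (K : set (R * R)) (f : R * R -> R) :
  compact K -> (forall q, K q -> {for q, continuous f}) ->
  forall e : R, 0 < e -> exists2 eta : R, 0 < eta & forall q q', K q ->
    `|q'.1 - q.1| < eta -> `|q'.2 - q.2| < eta -> `|f q' - f q| < e.
Proof.
move=> /compact_near_coveringP cK cf e e0.
pose P (eta : R) q := forall q', `|q'.1 - q.1| < eta -> `|q'.2 - q.2| < eta -> `|f q' - f q| < e.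
have : \forall eta \near 0^'+, K `<=` P eta.
  apply: cK => q Kq.
  have e2 : 0 < e / 2 by rewrite divr_gt0.
  have [r r0 near_q] := continuous_box (cf q Kq) e2.
  have r2' : 0 < r / 2 by rewrite divr_gt0.
  exists ([set q0 : R * R | `|q.1 - q0.1| < r / 2 /\ `|q.2 - q0.2| < r / 2], [set eta : R | eta < r / 2]).
    split => /=; last exact: nbhs_right_lt.
    exact: nbhs_box.
  move=> [q0 eta] /= [[a1 a2] he] q' b1 b2.
  have n1 : `|f q - f q0| < e / 2 by apply: near_q; lra.
  have n2 : `|f q - f q'| < e / 2.
    apply: near_q.
      have := ler_normB (q.1 - q0.1) (q'.1 - q0.1); rewrite opprB addrA subrK; lra.
    have := ler_normB (q.2 - q0.2) (q'.2 - q0.2); rewrite opprB addrA subrK; lra.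
  have := ler_normB (f q - f q0) (f q - f q').
  have -> : f q - f q0 - (f q - f q') = f q' - f q0 by ring.
  by lra.
move=> H; have H0 : \forall eta \near (0 : R)^'+, 0 < eta by exact: nbhs_right_gt.
have [eta [eta0 HK]] := filter_ex (filterI H0 H).
by exists eta => // q q' Kq; exact: (HK q Kq).
Qed.

End HalfPlaneFunctions.

(** * Boundedness and slow variation of automorphic observables *)

Section Observable.
Context {R : realType}.
Implicit Types p q : R * R.

Definition toxy (z : R[i]^o) : R * R := (complex.Re z, complex.Im z).

Lemma continuous_toxy : continuous toxy.
Proof.
move=> z A [[U V] /= [[r1 /= r10 U1] [r2 /= r20 V2]] UV].
pose r := Num.min r1 r2; have r0 : 0 < r by rewrite lt_min r10.
suff : nbhs z (toxy @^-1` A) by [].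
exists r%:C; first by rewrite /= ltcR.
move=> w /=; rewrite normc_def ltcR => h; apply: UV.
have bound (x y : R) : Num.sqrt (x ^+ 2 + y ^+ 2) < r -> `|x| < r /\ `|y| < r.
  by move=> hr; split; apply: le_lt_trans hr; rewrite -sqrtr_sqr ler_wsqrtr// ?lerDl ?lerDr sqr_ge0.
have [h1 h2] : `|complex.Re z - complex.Re w| < r /\ `|complex.Im z - complex.Im w| < r.
  by apply: bound; move: h; case: (z) (w) => ? ? [].
split.
  by apply: U1 => /=; apply: lt_le_trans h1 _; rewrite ge_min lexx.
by apply: V2 => /=; apply: lt_le_trans h2 _; rewrite ge_min lexx orbT.
Qed.

Definition matrix_of (a b c d : int) : 'M[int]_2 :=
  \matrix_(i < 2, j < 2) if i == 0 then (if j == 0 then a else b) else (if j == 0 then c else d).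

Lemma matrix_of_SL2Z a b c d : a * d - b * c = 1 -> SL2Z (matrix_of a b c d).
Proof.
move=> D; rewrite /SL2Z /= (expand_det_row _ 0) !big_ord_recl big_ord0 addr0 /cofactor !det_mx11.
by rewrite !mxE /= expr0 expr1 mul1r mulN1r mulrN.
Qed.

Lemma mobius_matrix_of a b c d p : a * d - b * c = 1 -> 0 < p.2 ->
  mobius (matrix_of a b c d) (ofxy p) = ofxy (imob a b c d p) :> R[i].
Proof. by move=> D p0; rewrite mobius_imob//; [rewrite !mxE|exact: matrix_of_SL2Z]. Qed.

Section fixed.
(** [L] stands for the real or the imaginary part. *)
Variables (psi : R[i] -> R[i]) (L : R[i] -> R).
Hypotheses (L0 : L 0 = 0)
  (cont : forall p, 0 < p.2 -> {for p, continuous (fun p => L (psi (ofxy p)))})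
  (inv : SL2Z_invariant psi) (supp : compact_support_mod_SL2Z psi).

Let phi p := L (psi (ofxy p)).

Lemma observable_inv a b c d p : a * d - b * c = 1 -> 0 < p.2 ->
  phi (imob a b c d p) = phi p.
Proof.
move=> D p0; rewrite /phi -mobius_matrix_of// inv//.
exact: matrix_of_SL2Z.
Qed.

Lemma observable_support : exists K : set (R * R), [/\ compact K, forall q, K q -> 0 < q.2 &
  forall p, 0 < p.2 -> phi p = 0 \/
    exists a b c d, a * d - b * c = 1 /\ K (imob a b c d p)].
Proof.
have [K [cK KH HK]] := supp; exists (toxy @` K); split.
- apply: continuous_compact => //; apply: continuous_subspaceT; exact: continuous_toxy.
- by move=> _ [z Kz <-]; exact: (KH z Kz).
move=> p p0; have [E|E] := eqVneq (psi (ofxy p)) 0; first by left; rewrite /phi E.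
right; have [|A SA KA] := HK (ofxy p) p0; first by apply: subset_closure; split.
exists (A 0 0), (A 0 1), (A 1 0), (A 1 1); split; first exact: SL2Z_det.
by exists (mobius A (ofxy p)) => //; rewrite mobius_imob// /toxy /=; case: (imob _ _ _ _ _).
Qed.

Lemma observable_bounded : exists2 B : R, 0 <= B & forall p, 0 < p.2 -> `|phi p| <= B.
Proof.
have [K [cK KH HK]] := observable_support.
have [B B0 HB] := compact_bound cK (fun q Kq => cont (KH q Kq)).
exists B => // p p0; have [->|[a [b [c [d [D Kp]]]]]] := HK p p0; first by rewrite normr0.
by rewrite -(observable_inv D p0); exact: HB.
Qed.

(** Unless the observable vanishes at both points, a matrix moves one of them into K. The hyperbolic
    distance is kept, and heights in K are bounded, so the images are close in the Euclidean sense,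
    where uniform continuity applies. *)
Lemma observable_slow (e : R) : 0 < e -> exists2 d : R, 0 < d &
  forall x y y' : R, 0 < y -> y <= y' -> y' <= (1 + d) * y -> `|phi (x, y') - phi (x, y)| <= e.
Proof.
move=> e0; have [K [cK KH HK]] := observable_support.
have [eta eta0 Heta] := compact_uniform_continuity cK (fun q Kq => cont (KH q Kq)) e0.
have [H H0 HH] : exists2 H : R, 0 <= H & forall q, K q -> `|q.2| <= H.
  by apply: (compact_bound cK) => q _; exact: cvg_snd.
(* The squared Euclidean distance of the images will be at most 3 (d (H + 1))^2 <= 3 (eta / 2)^2 <
   eta^2. *)
pose d := Num.min 1 (eta / (2 * (H + 1))).
have H1 : 0 < H + 1 by rewrite ltr_wpDl.
have d0 : 0 < d by rewrite lt_min ltr01 divr_gt0// mulr_gt0.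
have d1 : d <= 1 by rewrite ge_min lexx.
have d2 : d * (H + 1) <= eta / 2.
  apply: (@le_trans _ _ (eta / (2 * (H + 1)) * (H + 1))).
    by rewrite ler_wpM2r ?(ltW H1)// ge_min lexx orbT.
  by rewrite invfM mulrA divfK// gt_eqF.
exists d => // x y y' y0 yy' y'd.
have y'0 : 0 < y' by exact: lt_le_trans yy'.
have ratio : (y' - y) ^+ 2 / (y' * y) <= d ^+ 2.
  rewrite ler_pdivrMr ?mulr_gt0//.
  have h1 : y' - y <= d * y by move: y'd; rewrite mulrDl mul1r; lra.
  have h2 : 0 <= y' - y by lra.
  apply: (@le_trans _ _ ((d * y) ^+ 2)); first by rewrite lerXn2r// nnegrE mulr_ge0 ?ltW.
  by rewrite exprMn ler_wpM2l ?sqr_ge0// expr2 ler_wpM2r// ltW.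
have key (z w : R * R) : 0 < z.2 -> 0 < w.2 ->
    ((z.1 - w.1) ^+ 2 + (z.2 - w.2) ^+ 2) / (z.2 * w.2) <= d ^+ 2 ->
    (exists a b c d, a * d - b * c = 1 /\ K (imob a b c d z)) -> `|phi w - phi z| <= e.
  move=> z0 w0 hzw [a [b [c [dd [D Kz]]]]].
  rewrite -(observable_inv D z0) -(observable_inv D w0).
  have := hyp_distance (@detR R _ _ _ _ D) z0 w0; rewrite -!/(imob _ _ _ _ _).
  have u0 := imob_im_gt0 D z0; have v0 := imob_im_gt0 D w0.
  have uH := HH _ Kz; rewrite gtr0_norm// in uH.
  move: (imob a b c dd z) (imob a b c dd w) Kz u0 v0 uH => u v Kz u0 v0 uH dist.
  have {}dist : (u.1 - v.1) ^+ 2 + (u.2 - v.2) ^+ 2 <= d ^+ 2 * (u.2 * v.2).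
    by rewrite dist ler_wpM2r// mulr_ge0 ?ltW.
  have dd1 : d ^+ 2 <= 1 by rewrite expr_le1// ltW.
  have s1 := sqr_ge0 (u.1 - v.1); have s2 := sqr_ge0 (u.2 - v.2).
  have uv0 : 0 < u.2 * v.2 by rewrite mulr_gt0.
  (* With d <= 1, the distance bound gives (u.2 - v.2)^2 <= u.2 v.2, which v.2 > 3 u.2 would
     contradict. *)
  have v3 : v.2 <= 3 * u.2.
    rewrite leNgt; apply/negP => h.
    have h1 : d ^+ 2 * (u.2 * v.2) <= u.2 * v.2 by rewrite ler_piMl// ltW.
    by nra.
  have bnd : d ^+ 2 * (u.2 * v.2) < eta ^+ 2.
    apply: (@le_lt_trans _ _ (3 * (d * (H + 1)) ^+ 2)).
      rewrite exprMn [leRHS]mulrCA; apply: ler_wpM2l; first exact: sqr_ge0.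
      have : u.2 * v.2 <= u.2 * (3 * u.2) by rewrite ler_wpM2l// ltW.
      have : u.2 ^+ 2 <= (H + 1) ^+ 2 by rewrite lerXn2r// ?nnegrE ?ltW//; lra.
      by rewrite !expr2; lra.
    apply: (@le_lt_trans _ _ (3 * (eta / 2) ^+ 2)).
      by rewrite ler_pM2l// lerXn2r// nnegrE ltW// ?mulr_gt0// divr_gt0.
    by have := exprn_gt0 2 eta0; rewrite expr_div_n; lra.
  have sq (t : R) : t ^+ 2 < eta ^+ 2 -> `|t| < eta.
    by move=> ht; rewrite -[ltRHS]gtr0_norm// -!sqrtr_sqr ltr_sqrt ?exprn_gt0.
  apply/ltW; apply: Heta => //.
    by rewrite distrC; apply: sq; lra.
  by rewrite distrC; apply: sq; lra.
have r1 : ((x - x) ^+ 2 + (y' - y) ^+ 2) / (y' * y) <= d ^+ 2 by rewrite subrr expr0n add0r.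
have r2 : ((x - x) ^+ 2 + (y - y') ^+ 2) / (y * y') <= d ^+ 2.
  by rewrite -[(y - y') ^+ 2]sqrrN opprB [y * y']mulrC.
have [z1|ex1] := HK (x, y) y0; last first.
  exact: (key (x, y) (x, y')).
have [z2|ex2] := HK (x, y') y'0; last first.
  by rewrite distrC; exact: (key (x, y') (x, y)).
by rewrite z1 z2 subrr normr0 ltW.
Qed.

(* Shifting by a bound of the observable makes it nonnegative. *)
Lemma shifted_observable : exists (f : R * R -> R) (B : R),
  [/\ measurable_fun setT f, forall p, 0 <= f p, forall p, f p <= 2 * B & automorphic f] /\
  [/\ 0 <= B, forall e : R, 0 < e -> exists2 d : R, 0 < d &
    forall x y y' : R, 0 < y -> y <= y' -> y' <= (1 + d) * y -> `|f (x, y') - f (x, y)| <= e &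
    forall p, 0 < p.2 -> f p = phi p + B].
Proof.
have [B B0 HB] := observable_bounded.
pose f p := if 0 < p.2 then `|phi p + B| else B.
have fE p : 0 < p.2 -> f p = phi p + B.
  move=> p0; rewrite /f p0 ger0_norm//.
  by have := HB p p0; rewrite ler_norml => /andP[]; lra.
exists f, B; split; split => //.
- apply: measurable_half_plane => [p|p p0]; first exact: normr_ge0.
  by apply: cvg_norm; apply: cvgD; [exact: cont|exact: cvg_cst].
- by move=> p; rewrite /f; case: ltP.
- move=> p; case: (ltP 0 p.2) => p0; last by rewrite /f ltNge p0 /=; lra.
  by rewrite fE//; have := HB p p0; rewrite ler_norml => /andP[]; lra.
- by move=> a b c d p D p0; rewrite !fE ?imob_im_gt0// observable_inv.
- move=> e e0; have [d d0 H] := observable_slow e0; exists d => // x y y' y0 yy' y'd.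
  have y'0 : 0 < y' by exact: lt_le_trans yy'.
  by rewrite !fE// opprD addrACA subrr addr0; exact: H.
Qed.

End fixed.
End Observable.

(** * Integrals over the fundamental domain and the normalized mass *)

Section NormalizedMass.
Context {R : realType}.
Implicit Types p q : R * R.

Lemma Rintegral_fund (h : R * R -> R) :
  \int[@lebesgue2 R]_(p in @fund_domain R) (h p / p.2 ^+ 2) =
  fine (hyp (fun p => (ind (fund p) * (h p)%:E)%E)).
Proof.
rewrite /Rintegral integral_mkcond; congr fine; apply: eq_integral => p _.
rewrite patchE; case: ifPn => [|] hp.
  have [p0 p1 p2] : fund_domain p by move: hp; rewrite inE.
  by rewrite /hyp_weight /fund /ind p0 p1 p2 /= !mul1e -EFinM mulrC.
suff -> : fund p = false by rewrite /ind mul0e mule0.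
by apply/negbTE/negP => /and3P[p0 p1 p2]; move/negP: hp; apply; rewrite inE.
Qed.

Lemma hyp_fund_sub (u v : R * R -> R) :
  measurable_fun setT u -> (forall p, 0 <= u p) ->
  measurable_fun setT v -> (forall p, 0 <= v p) ->
  hyp (fun p => (ind (fund p) * (u p)%:E)%E) \is a fin_num ->
  hyp (fun p => (ind (fund p) * (v p)%:E)%E) \is a fin_num ->
  fine (hyp (fun p => (ind (fund p) * (u p - v p)%:E)%E)) =
  fine (hyp (fun p => (ind (fund p) * (u p)%:E)%E)) -
  fine (hyp (fun p => (ind (fund p) * (v p)%:E)%E)).
Proof.
move=> mu u0 mv v0 uf vf; rewrite -fineB//; congr fine.
have int (w : R * R -> R) : measurable_fun setT w -> (forall p, 0 <= w p) ->
    hyp (fun p => (ind (fund p) * (w p)%:E)%E) \is a fin_num ->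
    (@lebesgue2 R).-integrable setT (fun p => (hyp_weight p.2 * (ind (fund p) * (w p)%:E))%E).
  move=> mw w0 wf; apply/integrableP; split.
    by have mH := @measurable_hyp_weight R; have mF := @measurable_fund R; mea.
  have -> : (\int[@lebesgue2 R]_p `|hyp_weight p.2 * (ind (fund p) * (w p)%:E)| =
      hyp (fun p => ind (fund p) * (w p)%:E))%E.
    by apply: eq_integral => p _; rewrite gee0_abs//; apply: mule_ge0; [epos|apply: mule_ge0; [epos|rewrite lee_fin]].
  by rewrite ltey_eq wf.
rewrite /hyp -integralB//; [|exact: int|exact: int].
apply: eq_integral => p _; rewrite /hyp_weight /ind EFinB.
by rewrite -!EFinM -!EFinB; congr EFin; ring.
Qed.

Lemma hyp_fund_shift (f X h : R * R -> R) (B : R) : 0 <= B ->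
  measurable_fun setT f -> (forall p, 0 <= f p) ->
  measurable_fun setT X -> (forall p, 0 <= X p) ->
  (forall p, 0 < p.2 -> h p = f p - B) ->
  hyp (fun p => (ind (fund p) * (f p * X p)%:E)%E) \is a fin_num ->
  hyp (fun p => (ind (fund p) * (X p)%:E)%E) \is a fin_num ->
  fine (hyp (fun p => (ind (fund p) * (h p * X p)%:E)%E)) =
  fine (hyp (fun p => (ind (fund p) * (f p * X p)%:E)%E)) -
  B * fine (hyp (fun p => (ind (fund p) * (X p)%:E)%E)).
Proof.
move=> B0 mf f0 mX X0 hE fin1 fin2.
have BE : hyp (fun p => (ind (fund p) * (B * X p)%:E)%E) =
    (B%:E * hyp (fun p => ind (fund p) * (X p)%:E))%E.
  rewrite -hypZl//; [|by have mF := @measurable_fund R; mea|by move=> p; apply: mule_ge0; [epos|rewrite lee_fin ?mulr_ge0]].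
  by apply: eq_hyp => p _; rewrite EFinM muleCA.
have -> : B * fine (hyp (fun p => (ind (fund p) * (X p)%:E)%E)) =
    fine (hyp (fun p => (ind (fund p) * (B * X p)%:E)%E)).
  by rewrite BE fineM.
rewrite -hyp_fund_sub//.
- by congr fine; apply: eq_hyp => p p0; rewrite hE// mulrBl.
- by apply: measurable_funM.
- by move=> p; rewrite mulr_ge0.
- by apply: measurable_funM.
- by move=> p; rewrite mulr_ge0.
by rewrite BE fin_numM.
Qed.

(** For f = 1 this is the squared Petersson norm; for the shifted observable it is the numerator of
    the normalized mass. *)
Definition poincare_mass (k m : nat) (f : R * R -> R) : \bar R :=
  hyp (fun p => (ind (fund p) * (f p * (cabs2 (Poincare k m (ofxy p)) * p.2 ^+ k))%:E)%E).

Lemma petersson_Poincare (k m : nat) :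
  petersson k (Poincare k m) (Poincare k m) = (fine (poincare_mass k m (fun=> 1)))%:C :> R[i].
Proof.
have E p : Poincare k m (ofxy p) * (Poincare k m (ofxy p))^* * ((complex.Im (ofxy p)) ^+ k)%:C =
    (cabs2 (Poincare k m (ofxy p)) * p.2 ^+ k)%:C :> R[i].
  by rewrite [RHS]rmorphM /= cabs2E normCK.
rewrite /petersson /modular_integral; congr (_ +i* _).
  rewrite -Rintegral_fund; congr Rintegral; apply/funext => p.
  by rewrite E /= mul1r.
rewrite /Rintegral integral0_eq// => p _.
by rewrite E /= mul0r.
Qed.

(** The normalized series has total mass 1, so undoing the shift of the observable subtracts exactly
    B. *)
Lemma normalized_mass (L : R[i] -> R) (k m : nat) (psi : R[i] -> R[i]) (f X : R * R -> R) (B : R) :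
  (forall (r : R) (w : R[i]), L (r%:C * w) = r * L w) -> 0 <= B ->
  measurable_fun setT f -> (forall p, 0 <= f p) ->
  measurable_fun setT X -> (forall p, 0 <= X p) ->
  (forall p, 0 < p.2 -> X p = cabs2 (Poincare k m (ofxy p)) * p.2 ^+ k) ->
  (forall p, 0 < p.2 -> f p = L (psi (ofxy p)) + B) ->
  poincare_mass k m f \is a fin_num ->
  poincare_mass k m (fun=> 1) \is a fin_num ->
  0 < fine (poincare_mass k m (fun=> 1)) ->
  \int[@lebesgue2 R]_(p in @fund_domain R)
    (L (`|Poincare_normalized k m (ofxy p)| ^+ 2 * psi (ofxy p)
         * ((complex.Im (ofxy p)) ^+ k)%:C) / p.2 ^+ 2) =
  fine (poincare_mass k m f) / fine (poincare_mass k m (fun=> 1)) - B.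
Proof.
move=> LZ B0 mf f0 mX X0 XE fE fin1 fin2 I0.
set I := fine (poincare_mass k m (fun=> 1)) in I0 *.
have Iinv : 0 <= I^-1 by rewrite invr_ge0 ltW.
have normE p : `|Poincare_normalized k m (ofxy p)| ^+ 2 =
    (I^-1 * cabs2 (Poincare k m (ofxy p)))%:C :> R[i].
  rewrite /Poincare_normalized normrM exprMn -cabs2E normfV exprVn -normrX sqrtCK.
  rewrite petersson_Poincare -/I ger0_norm ?lecR ?ltW//.
  by rewrite mulrC [RHS]rmorphM /= fmorphV.
have JE (g : R * R -> R) : measurable_fun setT g -> (forall p, 0 <= g p) ->
    hyp (fun p => (ind (fund p) * (g p * (I^-1 * X p))%:E)%E) = ((I^-1)%:E * poincare_mass k m g)%E.
  move=> mg g0; rewrite /poincare_mass.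
  transitivity ((I^-1)%:E * hyp (fun p => ind (fund p) * (g p * X p)%:E))%E.
    rewrite -hypZl//; [|by have mF := @measurable_fund R; mea|by move=> p; apply: mule_ge0; [epos|rewrite lee_fin ?mulr_ge0]].
    by apply: eq_hyp => p _; rewrite /ind -!EFinM; congr EFin; ring.
  by congr (_ * _)%E; apply: eq_hyp => p p0; rewrite XE.
have mX' : measurable_fun setT (fun p => I^-1 * X p) by apply: measurable_funM.
have E1 : hyp (fun p => (ind (fund p) * (I^-1 * X p)%:E)%E) = 1%E.
  have := JE (fun=> 1) (measurable_cst _) (fun=> ler01).
  rewrite -(fineK fin2) -/I -EFinM mulVf ?gt_eqF// => <-.
  by apply: eq_hyp => p _; rewrite mul1r.
rewrite Rintegral_fund.
transitivity (fine (hyp (fun p => (ind (fund p) * (L (psi (ofxy p)) * (I^-1 * X p))%:E)%E))).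
  congr fine; apply: eq_hyp => p p0; congr (_ * _%:E)%E.
  by rewrite normE mulrAC -rmorphM LZ XE// mulrC; congr (_ * _); rewrite /= mulrA.
rewrite (@hyp_fund_shift f _ _ B)//.
- by rewrite JE// E1 fineM//= mulr1 mulrC.
- by move=> p; rewrite mulr_ge0.
- by move=> p p0; rewrite fE// addrK.
- by rewrite JE// fin_numM.
by rewrite E1.
Qed.

End NormalizedMass.

(** * Passage to the limit along even weights *)

Section Limits.
Context {R : realType}.
Implicit Types p q : R * R.

Local Instance even_oo_filter : Filter even_oo.
Proof. exact: within_filter. Qed.

Lemma even_oo_near (P : nat -> Prop) :
  (forall k, ~~ odd k -> P k) -> \forall k \near even_oo, P k.
Proof. by move=> H; apply: filterS (near_withinT _ _) => k; exact: H. Qed.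

Lemma even_oo_oo (P : nat -> Prop) :
  (\forall k \near \oo, P k) -> \forall k \near even_oo, P k.
Proof. by move=> H; apply: cvg_within. Qed.

Lemma cvg_powR_inv (eps : R) : 0 < eps -> k%:R `^ (- eps) @[k --> even_oo] --> (0 : R).
Proof.
move=> e0.
have E : (fun k : nat => k%:R `^ (- eps)) = (fun k : nat => (k%:R `^ eps)^-1) :> (nat -> R).
  by apply/funext => k; rewrite powRN.
rewrite E; apply/gtr0_cvgV0.
  apply: even_oo_oo; exists 1%N => // k /= k1.
  by rewrite powR_gt0// ltr0n.
apply/cvgryPge => A; apply: even_oo_oo.
near=> k.
apply: (@le_trans _ _ `|A|); first exact: ler_norm.
have -> : `|A| = (`|A| `^ eps^-1) `^ eps.
  by rewrite -powRrM mulVf ?gt_eqF// powRr1.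
apply: ge0_ler_powR; rewrite ?nnegrE ?powR_ge0 ?ler0n ?(ltW e0)//.
near: k; exact: nbhs_infty_ger.
Unshelve. all: by end_near. Qed.

Section fixed.
Variables (eps : R) (m : nat -> nat) (C : R).
Hypotheses (eps0 : 0 < eps)
  (m_gt0 : forall k : nat, (0 < k)%N -> ~~ odd k -> (0 < m k)%N)
  (m_large : ((m k)%:R / k%:R : R) @[k --> even_oo] --> +oo)
  (C0 : 0 < C)
  (m_small : forall k : nat, (0 < k)%N -> ~~ odd k -> (m k)%:R <= C * k%:R `^ (3 / 2 - eps)).

Let M k : R := 4 * pi * (m k)%:R.
Let N k : R := gamma_int (M k) (k - 2).
Let T k : R := k%:R / M k.

Lemma cvg_height : T k @[k --> even_oo] --> 0.
Proof.
have inv0 : ((m k)%:R / k%:R : R)^-1 @[k --> even_oo] --> 0.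
  by apply/gtr0_cvgV0 => //; move/cvgryPgt: m_large => /(_ 0).
have -> : (0 : R) = (4 * pi)^-1 * 0 by rewrite mulr0.
have -> : T = (fun k => (4 * pi)^-1 * ((m k)%:R / k%:R : R)^-1).
  by apply/funext => k; rewrite /T /M invf_div invfM mulrCA.
by apply: cvgM => //; exact: cvg_cst.
Qed.

(** The exponent 3/2 - eps splits as 1 + 1/2 - eps; the first two parts cancel against k and
    sqrt(k), so this error term is O(k^{-eps}). *)
Lemma offdiag_ratio (k : nat) : (0 < k)%N -> ~~ odd k ->
  Num.sqrt (M k / k%:R) ^+ 2 / Num.sqrt k%:R <= 4 * pi * C * k%:R `^ (- eps).
Proof.
move=> k0 ek; have kR : 0 < k%:R :> R by rewrite ltr0n.
have M0 : 0 <= M k by rewrite /M !mulr_ge0// pi_ge0.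
rewrite sqr_sqrtr ?divr_ge0// ?(ltW kR)//.
rewrite ler_pdivrMr ?sqrtr_gt0// ler_pdivrMr//.
apply: (@le_trans _ _ (4 * pi * (C * k%:R `^ (3 / 2 - eps)))).
  by rewrite ler_wpM2l ?mulr_ge0 ?pi_ge0// m_small.
have -> : 3 / 2 - eps = - eps + 2^-1 + 1 by field.
have k_neq : k%:R != 0 :> R by rewrite gt_eqF.
rewrite powRD ?k_neq ?implybT// powRD ?k_neq ?implybT// powRr1 ?ler0n// powR12_sqrt ?ler0n//.
by rewrite !mulrA.
Qed.

(** The relative error is e from the horocycles, plus a Markov term in k / M, plus the two
    off-diagonal terms. For fixed e and y0 all but the first tend to 0. *)
Lemma cvg_poincare_mass (f : R * R -> R) (B : R) : 0 <= B ->
  measurable_fun setT f -> (forall p, 0 <= f p) -> (forall p, f p <= B) -> automorphic f ->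
  (forall e : R, 0 < e -> exists2 d : R, 0 < d &
    forall x y y' : R, 0 < y -> y <= y' -> y' <= (1 + d) * y -> `|f (x, y') - f (x, y)| <= e) ->
  (\forall k \near even_oo, poincare_mass k (m k) f \is a fin_num) /\
  fine (poincare_mass k (m k) f) / N k @[k --> even_oo] --> average f.
Proof.
move=> B0 mf f0 fB fA fs.
have est (e y0 : R) : 0 < e -> 0 < y0 ->
    (forall y : R, 0 < y < y0 -> `|fine (horo f y) - average f| <= e) ->
    forall k, (5 < k)%N -> ~~ odd k ->
      poincare_mass k (m k) f \is a fin_num /\
      `|fine (poincare_mass k (m k) f) / N k - average f| <=
        e + (B / y0 * T k + B * (960 * (4 * pi * C * k%:R `^ (- eps)) + 320 * Num.sqrt (T k))).
  move=> e0 y00 hor k k5 ek.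
  (* From k = 6 on, k / 2 has the form i + 3 that the off-diagonal bound requires. *)
  have [i ki] : exists i, k = (2 * i.+3)%N.
    by exists (k./2 - 3)%N; have := odd_double_half k; rewrite (negbTE ek); lia.
  have k0 : (0 < k)%N by lia.
  have le_k : ((2 * i.+2).+1 <= k)%N by lia.
  have kR : 0 < k%:R :> R by rewrite ltr0n.
  have M0 : 0 < M k by rewrite /M !mulr_gt0// ?pi_gt0// ltr0n m_gt0.
  have NE : N k = gamma_int (M k) (2 * i.+2).
    by rewrite /N; congr gamma_int; lia.
  have N0 : 0 < N k by exact: gamma_int_gt0.
  have [//|X [mX X0 XE]] := @measurable_Poincare R (m k) i.+3.
  have off := @hyp_offdiag_bound R (M k) k%:R _ _ i M0 (congr1 _ ki) erefl erefl.
  have ratio := offdiag_ratio k0 ek.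
  have [|fin bnd] := mass_comparison M0 mf f0 fB fA mX X0 _ off y00 e0 hor.
    by move=> p p0; rewrite XE//; exact: Poincare_pointwise.
  have JE : poincare_mass k (m k) f = hyp (fun p => (ind (fund p) * (f p * X p)%:E)%E).
    by apply: eq_hyp => p p0; rewrite XE// ki.
  rewrite JE; split => //.
  set J := fine _ in bnd *.
  have -> : J / N k - average f = (J - average f * N k) / N k.
    by rewrite mulrBl mulfK// gt_eqF.
  rewrite normrM normfV (gtr0_norm N0) ler_pdivrMr// NE; apply: le_trans bnd _.
  rewrite ler_wpM2r ?(ltW (gamma_int_gt0 M0 _))// -addrA lerD2l; apply: lerD.
    have -> : B * ((2 * i.+2).+1%:R / (M k * y0)) = B / y0 * ((2 * i.+2).+1%:R / M k).
      by rewrite invfM; ring.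
    apply: ler_wpM2l; first by rewrite divr_ge0// ltW.
    by rewrite /T ler_wpM2r ?invr_ge0 ?(ltW M0)// ler_nat.
  apply: (ler_wpM2l B0); apply: lerD; first exact: (ler_wpM2l (ler0n R 960) ratio).
  have -> : Num.sqrt (T k) = (Num.sqrt (M k / k%:R))^-1.
    by rewrite /T -[k%:R / M k]invf_div sqrtrV// divr_ge0// ltW.
  exact: lexx.
have [y0 y00 hor] := horocycle_equidistribution mf f0 fB fA fs ltr01.
split.
  near=> k; have [||//] := est 1 y0 ltr01 y00 hor k.
    near: k; apply: even_oo_oo; exact: nbhs_infty_gt.
  near: k; exact: even_oo_near.
apply/cvgrPdist_le => e e0.
have e2 : 0 < e / 2 by rewrite divr_gt0.
have [y1 y10 hor1] := horocycle_equidistribution mf f0 fB fA fs e2.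
have err : (B / y1 * T k + B * (960 * (4 * pi * C * k%:R `^ (- eps)) + 320 * Num.sqrt (T k)))
    @[k --> even_oo] --> (0 : R).
  have -> : (0 : R) = B / y1 * 0 + B * (960 * (4 * pi * C * 0) + 320 * Num.sqrt 0).
    by rewrite sqrtr0 !mulr0 addr0 mulr0 addr0.
  apply: cvgD; first by apply: cvgM; [exact: cvg_cst|exact: cvg_height].
  apply: cvgM; first exact: cvg_cst.
  apply: cvgD.
    apply: cvgM; first exact: cvg_cst.
    by apply: cvgM; [exact: cvg_cst|exact: cvg_powR_inv].
  apply: cvgM; first exact: cvg_cst.
  apply: (cvg_comp _ _ cvg_height); exact: sqrt_continuous.
move/cvgrPdist_le: err => /(_ _ e2) small.
near=> k; rewrite distrC.
have [||_ h] := est _ y1 e2 y10 hor1 k.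
- near: k; apply: even_oo_oo; exact: nbhs_infty_gt.
- near: k; exact: even_oo_near.
apply: le_trans h _.
have : `|0 - (B / y1 * T k + B * (960 * (4 * pi * C * k%:R `^ (- eps)) + 320 * Num.sqrt (T k)))| <= e / 2.
  by near: k; exact: small.
by rewrite sub0r normrN => /(le_trans (ler_norm _)); lra.
Unshelve. all: by end_near. Qed.

Lemma average_one : average (fun=> 1 : R) = 1.
Proof.
rewrite /average /mass.
have -> : hyp (fun p : R * R => (ind (fund p) * 1%:E)%E) = hyp (fun p : R * R => ind (fund p)).
  by apply: eq_hyp => p _; rewrite mule1.
by rewrite hyp_fund /= mulrA divfK ?divff// gt_eqF// pi_gt0.
Qed.

(** Divided by N, the mass of the shifted observable tends to its average and the squared norm tends
    to 1. Their quotient minus the shift B is the normalized integral, and the average of the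
    observable is that of f minus B. *)
Lemma equidistribution_part (L : R[i] -> R) (psi : R[i] -> R[i]) :
  (forall (r : R) (w : R[i]), L (r%:C * w) = r * L w) ->
  (forall p, 0 < p.2 -> {for p, continuous (fun p => L (psi (ofxy p)))}) ->
  SL2Z_invariant psi -> compact_support_mod_SL2Z psi ->
  \int[@lebesgue2 R]_(p in @fund_domain R)
    (L (`|Poincare_normalized k (m k) (ofxy p)| ^+ 2 * psi (ofxy p)
         * ((complex.Im (ofxy p)) ^+ k)%:C) / p.2 ^+ 2) @[k --> even_oo] -->
  3 / pi * \int[@lebesgue2 R]_(p in @fund_domain R) (L (psi (ofxy p)) / p.2 ^+ 2).
Proof.
move=> LZ cont inv supp.
have L0 : L 0 = 0 by rewrite -[X in L X](mul0r 0) LZ mul0r.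
have [f [B [[mf f0 fB fA] [B0 fs fE]]]] := shifted_observable L0 cont inv supp.
have [fin_f cvg_f] := cvg_poincare_mass (mulr_ge0 (ler0n R 2) B0) mf f0 fB fA fs.
have [|||||fin_1 cvg_1] := @cvg_poincare_mass (fun=> 1) 1 ler01.
- exact: measurable_cst.
- by [].
- by [].
- by [].
- by move=> e e0; exists 1 => // *; rewrite subrr normr0 ltW.
rewrite average_one in cvg_1.
have limE : 3 / pi * \int[@lebesgue2 R]_(p in @fund_domain R) (L (psi (ofxy p)) / p.2 ^+ 2) =
    average f * 1^-1 - B.
  rewrite Rintegral_fund.
  have shift := @hyp_fund_shift R f (fun=> 1) (fun p => L (psi (ofxy p))) B B0 mf f0 (measurable_cst _) (fun=> ler01).
  have massE : hyp (fun p => (ind (fund p) * (f p * 1)%:E)%E) = mass f.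
    by apply: eq_hyp => p _; rewrite mulr1.
  have piE : hyp (fun p : R * R => (ind (fund p) * (1%R)%:E)%E) = (pi / 3)%:E.
    by rewrite -hyp_fund; apply: eq_hyp => p _; rewrite mule1.
  have LE : hyp (fun p => (ind (fund p) * (L (psi (ofxy p)) * 1)%:E)%E) =
      hyp (fun p => (ind (fund p) * (L (psi (ofxy p)))%:E)%E).
    by apply: eq_hyp => p _; rewrite mulr1.
  move: shift; rewrite massE piE LE => ->.
  - rewrite invr1 mulr1 mulrBr -/(average f); congr (_ - _).
    by rewrite /=; move: (@pi R) (@pi_gt0 R) => P P0; field; rewrite gt_eqF.
  - by move=> p p0; rewrite fE// addrK.
  - by have [-> _] := mass_fin mf f0 fB.
  by [].
rewrite limE.
have lim : (fine (poincare_mass k (m k) f) / N k) * (fine (poincare_mass k (m k) (fun=> 1)) / N k)^-1 - B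
    @[k --> even_oo] --> average f * 1^-1 - B.
  apply: cvgB; last exact: cvg_cst.
  apply: cvgM => //; apply: cvgV => //; exact: oner_neq0.
apply: cvg_trans lim; apply: near_eq_cvg.
(* Closeness of the norm over N to 1 also shows that the norm is positive for large k. *)
move/cvgrPdist_lt: (cvg_1) => /(_ _ ltr01) close.
near=> k.
have k5 : (5 < k)%N by near: k; apply: even_oo_oo; exact: nbhs_infty_gt.
have ek : ~~ odd k by near: k; exact: even_oo_near.
have [n kn n2] : exists2 n, k = (2 * n)%N & (1 < n)%N.
  by exists k./2; have := odd_double_half k; rewrite (negbTE ek); lia.
have [//|X [mX X0 XE]] := @measurable_Poincare R (m k) n.
rewrite -kn in XE.
have N0 : 0 < N k by apply: gamma_int_gt0; rewrite /M !mulr_gt0// ?pi_gt0// ltr0n m_gt0//; lia.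
have I0 : 0 < fine (poincare_mass k (m k) (fun=> 1 : R)).
  have : `|1 - fine (poincare_mass k (m k) (fun=> 1 : R)) / N k| < 1 by near: k; exact: close.
  rewrite ltr_norml => /andP[_ h].
  have : 0 < fine (poincare_mass k (m k) (fun=> 1 : R)) / N k by lra.
  by rewrite pmulr_lgt0// invr_gt0.
rewrite (@normalized_mass R L k (m k) psi f X B)//.
- congr (_ - _); move: (fine (poincare_mass k (m k) f)) (fine (poincare_mass k (m k) _)) (N k) I0 N0.
  by move=> a b c b0 c0; field; rewrite !gt_eqF.
- by near: k.
- by near: k.
Unshelve. all: by end_near. Qed.

End fixed.
End Limits.

Theorem theorem1p1 (R : realType) (eps : R) (m : nat -> nat) :
  0 < eps ->
  (forall k : nat, (0 < k)%N -> ~~ odd k -> (0 < m k)%N) ->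
  (((m k)%:R / k%:R : R) @[k --> even_oo] --> +oo) ->
  (exists2 C : R, 0 < C &
    forall k : nat, (0 < k)%N -> ~~ odd k ->
      (m k)%:R <= C * k%:R `^ (3 / 2 - eps)) ->
  forall psi : R[i] -> R[i], Cc_infty_modular psi ->
    (modular_integral (fun z =>
       `|Poincare_normalized k (m k) z| ^+ 2 * psi z
         * ((complex.Im z) ^+ k)%:C) : R[i]^o) @[k --> even_oo]
      --> ((3 / pi)%:C * modular_integral psi : R[i]^o).
Proof.
move=> eps0 m_gt0 m_large [C C0 m_small] psi [[smooth_re smooth_im] inv supp].
have -> : (3 / pi)%:C * modular_integral psi =
    (3 / pi * \int[@lebesgue2 R]_(p in @fund_domain R) (complex.Re (psi (ofxy p)) / p.2 ^+ 2)) +i*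
    (3 / pi * \int[@lebesgue2 R]_(p in @fund_domain R) (complex.Im (psi (ofxy p)) / p.2 ^+ 2)).
  by apply/eqP; rewrite eq_complex /= !mul0r subr0 addr0 !eqxx.
have ReZ (r : R) (w : R[i]) : complex.Re (r%:C * w) = r * complex.Re w.
  by case: w => a b /=; rewrite mul0r subr0.
have ImZ (r : R) (w : R[i]) : complex.Im (r%:C * w) = r * complex.Im w.
  by case: w => a b /=; rewrite mul0r addr0.
have even_filter : Filter even_oo by exact: within_filter.
apply: cvg_complex.
- apply: (equidistribution_part eps0 m_gt0 m_large C0 m_small ReZ _ inv supp) => p p0.
  (* The empty list of partial derivatives gives continuity of the function itself. *)
  by have [] := smooth_re [::] p p0.
- apply: (equidistribution_part eps0 m_gt0 m_large C0 m_small ImZ _ inv supp) => p p0.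
  by have [] := smooth_im [::] p p0.
Qed.
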